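(* Let $\Omega\subset\mathbb{R}^3$ be a bounded simply-connected Lipschitz domain with connected, piecewise $C^{2,1}$-smooth boundary $\partial\Omega$, let $\lambda>0$, $\mu>0$, $\omega>0$ and $\boldsymbol{f}\in\boldsymbol{H}^1(\Omega)$. Let $\boldsymbol{u}\in\boldsymbol{X}_N$ be a solution of the variational problem $$(\mu\nabla\wedge\boldsymbol{u},\nabla\wedge\boldsymbol{v})+((\lambda+2\mu)\nabla\cdot\boldsymbol{u},\nabla\cdot\boldsymbol{v})-\omega^2(\boldsymbol{u},\boldsymbol{v})=(\boldsymbol{f},\boldsymbol{v})\qquad\text{for all }\boldsymbol{v}\in\boldsymbol{X}_N,$$ and suppose that $\boldsymbol{u}\in\boldsymbol{H}^3(\Omega)$. Put $k_p:=\omega/\sqrt{\lambda+2\mu}$ and $k_s:=\omega/\sqrt{\mu}$. Then $v_p:=-\nabla\cdot\boldsymbol{u}$ solves $$\begin{cases}\Delta v_p+k_p^2v_p=\dfrac{1}{\lambda+2\mu}\nabla\cdot\boldsymbol{f}&\text{in }\Omega,\\ v_p=0&\text{on }\partial\Omega,\end{cases}$$ and $\boldsymbol{E}_s:=\nabla\wedge\boldsymbol{u}$ solves the Maxwell system $$\begin{cases}\nabla\wedge(\nabla\wedge\boldsymbol{E}_s)-k_s^2\boldsymbol{E}_s=\dfrac1\mu\nabla\wedge\boldsymbol{f}&\text{in }\Omega,\\ \nabla\cdot\boldsymbol{E}_s=0&\text{in }\Omega,\\ \boldsymbol{\nu}\wedge(\nabla\wedge\boldsymbol{E}_s)=\dfrac1\mu\boldsymbol{\nu}\wedge\boldsymbol{f}&\text{on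 }\partial\Omega.\end{cases}$$
   Context: $\wedge$ is the cross product in $\mathbb{R}^3$, so $\nabla\wedge\boldsymbol{v}$ is the curl of $\boldsymbol{v}$ and $\nabla\cdot\boldsymbol{v}$ its divergence (distributional). $(\cdot,\cdot)$ is the $L^2(\Omega)$ scalar product (of scalar- or vector-valued functions), over a fixed scalar field. $\boldsymbol{L}^2(\Omega)=L^2(\Omega)^3$, $\boldsymbol{H}^s(\Omega)=H^s(\Omega)^3$. The outward unit normal on $\partial\Omega$ is $\boldsymbol{\nu}$; boundary conditions are understood in the sense of traces. $\boldsymbol{X}:=\{\boldsymbol{v}\in\boldsymbol{L}^2(\Omega):\nabla\wedge\boldsymbol{v}\in\boldsymbol{L}^2(\Omega),\ \nabla\cdot\boldsymbol{v}\in L^2(\Omega)\}$, and $\boldsymbol{X}_N:=\{\boldsymbol{v}\in\boldsymbol{X}:\boldsymbol{\nu}\wedge\boldsymbol{v}=\boldsymbol{0}\text{ on }\partial\Omega\}$ (tangential trace in the standard sense). *)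

(* Defs.v *)
From HB Require Import structures.
From mathcomp Require Import all_boot all_order all_algebra.
From mathcomp Require Import complex.
From mathcomp Require Import all_classical all_reals all_analysis.

Set Implicit Arguments.
Unset Strict Implicit.
Unset Printing Implicit Defensive.

Import Order.TTheory GRing.Theory Num.Theory.
Import numFieldNormedType.Exports.

Local Open Scope classical_set_scope.
Local Open Scope ring_scope.

Notation R3 R := (R * R * R)%type.

Section Geometry.
Context {R : realType}.
Implicit Types (A Om : set (R3 R)).

Definition enorm (x : R3 R) : R :=
  Num.sqrt (x.1.1 ^+ 2 + x.1.2 ^+ 2 + x.2 ^+ 2).

Definition euclidean_isometry (Q : R3 R -> R3 R) : Prop :=
  forall x y, enorm (Q x - Q y) = enorm (x - y).

Definition boundary A : set (R3 R) := closure A `\` interior A.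

Definition domain Om : Prop := [/\ Om !=set0, open Om & connected Om].

Definition path_connected A : Prop :=
  forall x y, A x -> A y -> exists g : R -> R3 R,
    [/\ {within `[0, 1], continuous g}, g @` `[0, 1] `<=` A, g 0 = x & g 1 = y].

Definition simply_connected A : Prop :=
  path_connected A /\
  forall g : R -> R3 R,
    {within `[0, 1], continuous g} -> g @` `[0, 1] `<=` A -> g 0 = g 1 ->
  exists H : R * R -> R3 R,
    [/\ {within `[0, 1] `*` `[0, 1], continuous H},
        H @` (`[0, 1] `*` `[0, 1]) `<=` A,
        forall t, `[0, 1]%classic t -> H (0, t) = g t,
        forall t, `[0, 1]%classic t -> H (1, t) = g 0 &
        forall s, `[0, 1]%classic s -> H (s, 0) = g 0 /\ H (s, 1) = g 0].

Definition lipschitz_domain Om : Prop :=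
  forall x, boundary Om x ->
  exists (Q : R3 R -> R3 R) (z : R * R -> R),
    [/\ euclidean_isometry Q, lipschitz z &
        \forall y \near x, Om y <-> (Q y).2 < z (Q y).1].

(* Asking for all directional derivatives v, w is the same as asking for the
   coordinate ones: the second derivatives are continuous since Lipschitz. *)
Definition C21 (z : R * R -> R) : Prop :=
  [/\ forall a v, derivable z a v,
      forall a v w, derivable ('D_v z) a w &
      forall v w, lipschitz ('D_w ('D_v z))].

(* The pre-measure of size d for the 2-dimensional Hausdorff measure; the value
   +oo on large sets restricts the coverings to sets of diameter at most d. *)
Definition ediam A : \bar R :=
  ereal_sup (0%E |` [set (enorm (x.1 - x.2))%:E | x in A `*` A]).

Definition hausdorff2_gauge (d : R) A : \bar R :=
  if (ediam A <= d%:E)%E then ((pi / 4)%:E * (ediam A * ediam A))%E else +oo%E.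

(* In the sigma-algebra generated by all sets every set is measurable, so that
   [mu_ext] below ranges over the countable coverings by arbitrary sets. *)
Definition hausdorff2_size (d : R) A : \bar R :=
  mu_ext (hausdorff2_gauge d
    : set (g_sigma_algebraType [set: set (R3 R)]) -> \bar R) A.

Definition hausdorff2 A : \bar R :=
  ereal_sup [set hausdorff2_size d A | d in [set d : R | 0 < d]].

Lemma ediam_ge0 A : (0 <= ediam A)%E.
Proof. by apply: ereal_sup_ubound; left. Qed.

Lemma ediam0 : ediam set0 = 0%E.
Proof.
rewrite /ediam set0X image_set0 setU0; exact: ereal_sup1.
Qed.

Lemma hausdorff2_gauge_ge0 d A : (0 <= hausdorff2_gauge d A)%E.
Proof.
rewrite /hausdorff2_gauge; case: ifP => // _.
apply: mule_ge0; last by apply: mule_ge0; exact: ediam_ge0.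
by rewrite lee_fin divr_ge0 // pi_ge0.
Qed.

Lemma hausdorff2_gauge0 d : 0 < d -> hausdorff2_gauge d set0 = 0%E.
Proof.
by move=> d0; rewrite /hausdorff2_gauge ediam0 lee_fin (ltW d0) !mule0.
Qed.

Lemma hausdorff2_size_ge0 d A : (0 <= hausdorff2_size d A)%E.
Proof. apply: mu_ext_ge0; exact: hausdorff2_gauge_ge0. Qed.

Lemma hausdorff2_set0 : hausdorff2 set0 = 0%E.
Proof.
apply/eqP; rewrite eq_le; apply/andP; split.
  apply: ge_ereal_sup => _ [d /= d0 <-].
  by rewrite /hausdorff2_size mu_ext0 //;
    [exact: hausdorff2_gauge0 | exact: hausdorff2_gauge_ge0].
apply: le_trans (hausdorff2_size_ge0 1 set0) _.
by apply: ereal_sup_ubound; exists 1 => //=; exact: ltr01.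
Qed.

Lemma hausdorff2_ge0 A : (0 <= hausdorff2 A)%E.
Proof.
apply: le_trans (hausdorff2_size_ge0 1 A) _.
by apply: ereal_sup_ubound; exists 1 => //=; exact: ltr01.
Qed.

Lemma le_hausdorff2 : {homo hausdorff2 : A B / A `<=` B >-> (A <= B)%E}.
Proof.
move=> A B AB; apply: ge_ereal_sup => _ [d /= d0 <-].
apply: (@le_trans _ _ (hausdorff2_size d B)); first exact: le_mu_ext.
by apply: ereal_sup_ubound; exists d.
Qed.

Lemma hausdorff2_sigma_subadditive : sigma_subadditive hausdorff2.
Proof.
move=> G; apply: ge_ereal_sup => _ [d /= d0 <-].
apply: (@le_trans _ _ (\sum_(i <oo) hausdorff2_size d (G i))%E).
  apply: mu_ext_sigma_subadditive; exact: hausdorff2_gauge_ge0.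
apply: lee_nneseries => [i _ _|i _]; first exact: hausdorff2_size_ge0.
by apply: ereal_sup_ubound; exists d.
Qed.

HB.instance Definition _ := isOuterMeasure.Build R (R3 R) hausdorff2
  hausdorff2_set0 hausdorff2_ge0 le_hausdorff2 hausdorff2_sigma_subadditive.

(* Finitely many disjoint relatively open faces, each of class C^{2,1} up to its
   edges, which cover the boundary up to edges of zero area. *)
Definition piecewise_C21_boundary Om : Prop :=
  exists (N : nat) (G : 'I_N -> set (R3 R)),
    [/\ forall j, exists2 O, open O & G j = boundary Om `&` O,
        trivIset setT G,
        boundary Om = \bigcup_j closure (G j),
        hausdorff2 (boundary Om `\` \bigcup_j G j) = 0%E &
        forall j x, closure (G j) x ->
          exists (Q : R3 R -> R3 R) (z : R * R -> R),
            [/\ euclidean_isometry Q, C21 z &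
                \forall y \near x, closure (G j) y -> (Q y).2 = z (Q y).1]].

End Geometry.

(* A scalar field is a subset of R[i], so that real and complex scalars are
   treated at once; functions take their values in R[i] and the spaces below ask
   for the values to lie in the chosen field. *)
Definition scalar_field (R : realType) (F : set R[i]) : Prop :=
  F = [set z | complex.Im z = 0] \/ F = setT.

Section Lebesgue.
Context {R : realType}.
Local Notation mR := (measurableTypeR R).
Local Open Scope ereal_scope.

Lemma product_sigma_finite d1 d2 (T1 : measurableType d1) (T2 : measurableType d2)
    (m1 : {sigma_finite_measure set T1 -> \bar R})
    (m2 : {sigma_finite_measure set T2 -> \bar R}) :
  sigma_finite setT (m1 \x m2).
Proof.
have /sigma_finiteP[A [TA ndA Aoo]] := sigma_finiteT m1.
have /sigma_finiteP[B [TB ndB Boo]] := sigma_finiteT m2.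
exists (fun n => A n `*` B n).
  rewrite -setXTT TA TB predeqE => -[x y]; split.
    move=> [/= [n _ Anx] [k _ Bky]]; exists (maxn n k) => //; split.
    - by move: x Anx; exact/subsetPset/ndA/leq_maxl.
    - by move: y Bky; exact/subsetPset/ndB/leq_maxr.
  by move=> [n _ []/= ? ?]; split; exists n.
move=> k; have [? ?] := Aoo k; have [? ?] := Boo k.
split; first exact: measurableX.
by rewrite product_measure1E// lte_mul_pinfty// ge0_fin_numE.
Qed.

Definition lebesgue2 : set (mR * mR)%type -> \bar R :=
  @lebesgue_measure R \x @lebesgue_measure R.

HB.instance Definition _ := Measure.on lebesgue2.
HB.instance Definition _ := Measure_isSigmaFinite.Build _ _ _ lebesgue2
  (@product_sigma_finite _ _ _ _ (@lebesgue_measure R) (@lebesgue_measure R)).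

Definition lebesgue3 : set (mR * mR * mR)%type -> \bar R :=
  lebesgue2 \x @lebesgue_measure R.

HB.instance Definition _ := Measure.on lebesgue3.
HB.instance Definition _ := Measure_isSigmaFinite.Build _ _ _ lebesgue3
  (@product_sigma_finite _ _ _ _ lebesgue2 (@lebesgue_measure R)).

End Lebesgue.

Section Analysis.
Context {R : realType}.
Local Notation C := R[i].
Local Notation distr := ((R3 R -> R) -> C).

Definition sqmod (z : C) : R := complex.Re z ^+ 2 + complex.Im z ^+ 2.

Definition Cint (A : set (R3 R)) (w : R3 R -> C) : C :=
  (\int[lebesgue3]_(x in A) complex.Re (w x)
   +i* \int[lebesgue3]_(x in A) complex.Im (w x))%C.

Definition evec (i : 'I_3) : R3 R :=
  ((i == 0 :> nat)%:R, (i == 1 :> nat)%:R, (i == 2 :> nat)%:R).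

Definition pderiv (i : 'I_3) (phi : R3 R -> R) : R3 R -> R := 'D_(evec i) phi.

Definition smooth (phi : R3 R -> R) : Prop :=
  forall s : seq 'I_3, continuous (foldr pderiv phi s) /\
    forall i x, derivable (foldr pderiv phi s) x (evec i).

Definition csmooth (w : R3 R -> C) : Prop :=
  smooth (@complex.Re R \o w) /\ smooth (@complex.Im R \o w).

Definition test (Om : set (R3 R)) (phi : R3 R -> R) : Prop :=
  smooth phi /\ exists K : set (R3 R),
    [/\ compact K, K `<=` Om & forall x, ~ K x -> phi x = 0].

(* Distributions on Om are functionals on real test functions, which determine
   the complex ones by linearity; continuity plays no role here, since all
   distributions considered are derivatives of functions. *)
Definition eqD (Om : set (R3 R)) (T S : distr) : Prop :=
  forall phi, test Om phi -> T phi = S phi.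

Definition distr_of (Om : set (R3 R)) (w : R3 R -> C) : distr :=
  fun phi => Cint Om (fun x => w x * (phi x)%:C%C).

Definition scaleD (c : R) (T : distr) : distr := fun phi => c%:C%C * T phi.

Definition partD (i : 'I_3) (T : distr) : distr := fun phi => - T (pderiv i phi).

(* Indices are taken modulo 3: the i-th component of the curl of T is
   d_(i+1) T_(i+2) - d_(i+2) T_(i+1). *)
Definition curlD (T : 'I_3 -> distr) : 'I_3 -> distr :=
  fun i => partD (i + 1) (T (i + 2)) - partD (i + 2) (T (i + 1)).

Definition divD (T : 'I_3 -> distr) : distr := \sum_i partD i (T i).

Definition laplaceD (T : distr) : distr := \sum_i partD i (partD i T).

End Analysis.

Section Spaces.
Context {R : realType} (F : set R[i]) (Om : set (R3 R)).
Local Notation C := R[i].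
Implicit Types (w : R3 R -> C) (v : 'I_3 -> R3 R -> C).

Definition L2 w : Prop :=
  [/\ measurable_fun Om (@complex.Re R \o w), measurable_fun Om (@complex.Im R \o w),
      (\int[lebesgue3]_(x in Om) (sqmod (w x))%:E < +oo)%E &
      forall x, Om x -> F (w x)].

Definition L2v v : Prop := forall j, L2 (v j).

Definition inner (w1 w2 : R3 R -> C) : C := Cint Om (fun x => w1 x * conjc (w2 x)).

Definition innerv (v1 v2 : 'I_3 -> R3 R -> C) : C := \sum_j inner (v1 j) (v2 j).

Definition distrv_of v : 'I_3 -> (R3 R -> R) -> C := fun j => distr_of Om (v j).

Definition Hs (s : nat) w : Prop :=
  L2 w /\ forall a : seq 'I_3, (size a <= s)%N ->
    exists2 g, L2 g & eqD Om (foldr partD (distr_of Om w) a) (distr_of Om g).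

Definition Hsv (s : nat) v : Prop := forall j, Hs s (v j).

Definition is_weak_part (i : 'I_3) w g : Prop :=
  L2 g /\ eqD Om (partD i (distr_of Om w)) (distr_of Om g).

Definition is_weak_curl v (g : 'I_3 -> R3 R -> C) : Prop :=
  L2v g /\ forall j, eqD Om (curlD (distrv_of v) j) (distrv_of g j).

Definition is_weak_div v (g : R3 R -> C) : Prop :=
  L2 g /\ eqD Om (divD (distrv_of v)) (distr_of Om g).

(* Square-integrable representatives of the distributional derivatives, unique
   up to null sets; they are meaningful only if such representatives exist. *)
Definition wpart (i : 'I_3) w : R3 R -> C := xget (fun=> 0) (is_weak_part i w).
Definition wcurl v : 'I_3 -> R3 R -> C := xget (fun=> fun=> 0) (is_weak_curl v).
Definition wdiv v : R3 R -> C := xget (fun=> 0) (is_weak_div v).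

Definition Hcurl v : Prop := L2v v /\ exists g, is_weak_curl v g.

Definition Xspace v : Prop :=
  [/\ L2v v, exists g, is_weak_curl v g & exists g, is_weak_div v g].

(* The tangential trace nu /\ v of v in H(curl) is the functional on the traces
   of H^1 fields defined by Green's formula
     <nu /\ v, phi> = (curl v, phi) - (v, curl phi). *)
Definition ttrace v (phi : 'I_3 -> R3 R -> C) : C :=
  innerv (wcurl v) phi - innerv v (wcurl phi).

Definition XN v : Prop := Xspace v /\ forall phi, Hsv 1 phi -> ttrace v phi = 0.

Definition sqnormH1 w : \bar R :=
  (\int[lebesgue3]_(x in Om) (sqmod (w x))%:E
   + \sum_i \int[lebesgue3]_(x in Om) (sqmod (wpart i w x))%:E)%E.

(* g is the trace of w in H^1: the operator of restriction to the boundary of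
   functions smooth up to the boundary, extended by continuity from H^1(Om) to
   L^2 of the boundary for the surface measure. *)
Definition is_trace w (g : R3 R -> C) : Prop :=
  let bd : set (caratheodory_type (@hausdorff2 R)) := boundary Om in
  [/\ Hs 1 w,
      measurable_fun bd (@complex.Re R \o g),
      measurable_fun bd (@complex.Im R \o g) &
      exists phi : nat -> R3 R -> C,
        [/\ forall n, csmooth (phi n),
            forall n x, F (phi n x),
            sqnormH1 (fun x => phi n x - w x) @[n --> \oo] --> 0%E &
            (\int[@hausdorff2 R]_(x in bd) (sqmod (phi n x - g x))%:E)%E
              @[n --> \oo] --> 0%E]].

End Spaces.

(* Main.v *)
Require Import Defs.
From HB Require Import structures.
From mathcomp Require Import all_boot all_order all_algebra.
From mathcomp Require Import complex.
From mathcomp Require Import all_classical all_reals all_analysis.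
From mathcomp Require Import measurable_realfun ring lra.
Import Order.TTheory GRing.Theory Num.Theory.
Import numFieldNormedType.Exports.
Local Open Scope classical_set_scope.
Local Open Scope ring_scope.
Set Implicit Arguments.
Unset Strict Implicit.
Unset Printing Implicit Defensive.

(** Write [E] for the curl of [u], [K] for the curl of [E], [g] for the divergence
of [u] and [G] for the gradient of [g]; since [u] is in [H^3], all of them are
square-integrable fields. Testing the variational problem with smooth fields of
compact support and integrating by parts gives the field equation
  [f = mu K - (lambda + 2 mu) G - omega^2 u]
almost everywhere, because test functions are dense ([fundamental_lemma]). Its
divergence is the Helmholtz equation and its curl the Maxwell equation, since the
divergence of a curl and the curl of a gradient vanish.

The boundary conditions come from the test fields [v] which do not vanish near the
boundary. As [E] is in [H^1], the vanishing tangential trace of [v] gives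
[(E, curl v) = (K, v)], and subtracting the field equation paired with [v] from the
variational problem leaves
  [(g, div v) + (G, v) = 0] for all [v] in [X_N] ([natural_condition]).
Formally this is the vanishing of the boundary integral of [g] against the normal
component of [v]. It is turned into a statement on traces by Hilbert space geometry
alone, without any trace theorem ([closure_of_gradients]). Let [(p, P)] be the
orthogonal projection of [(g, G)] in [L^2] onto the closure of the pairs
[(phi, grad phi)] with [phi] a test function, that is onto [H^1_0], and let
[r = g - p]. Let [(q, W)] be the projection of [(r, 0)] onto the same space. Then
[div W = q - r], and the field [W], a limit of gradients of test functions, has zero
curl and zero tangential trace ([XN_grad_limit]), so it is an admissible [v]. The
identity above says that [(g, G)] and [(q, W)] have inner product [(g, r)];
computing with the two projections, the same inner product is [(p, r)]. Hence
[(r, r) = 0]: the function [g] equals [p], and it is a limit of test functions in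
[H^1].

This has two consequences. The trace of [g] is zero, the approximating functions
being zero on the boundary ([zero_trace]). And [G] is a limit of gradients of test
functions, hence orthogonal to all curls of [H^1] fields ([grad_curl_orth]), that is,
its tangential trace is zero; as the tangential trace of [u] is zero too, the field
equation leaves the boundary condition [nu x f = mu nu x K].

The analytic ingredients are the completeness of [L^2], the fundamental lemma of the
calculus of variations, for which smooth compactly supported plateau functions are
built on boxes, integration by parts against test functions, from Fubini's theorem
and the fundamental theorem of calculus, and the symmetry of second derivatives. *)

(** * Orthogonal projection for a semidefinite form *)

Section Projection.
Context {R : realType} {V : lmodType R}.

(** The polynomial is evaluated at its minimiser [c / q]. For [q = 0] it is affine in
[t] and takes negative values unless [c = 0]. *)
Lemma discriminant_le (A c q : R) : 0 <= A -> 0 <= q ->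
  (forall t, 0 <= A - 2 * t * c + t ^+ 2 * q) -> c ^+ 2 <= A * q.
Proof.
move=> A0 q0 H; have [q_eq0|q_neq0] := eqVneq q 0.
  suff -> : c = 0 by rewrite q_eq0 expr0n/= mulr0.
  apply/eqP; apply: contraT => c0.
  have := H ((A + 1) / (2 * c)); rewrite q_eq0 mulr0 addr0.
  have -> : 2 * ((A + 1) / (2 * c)) * c = A + 1 by field.
  by lra.
have {}q0 : 0 < q by rewrite lt_neqAle eq_sym q_neq0.
have := H (c / q).
have -> : A - 2 * (c / q) * c + (c / q) ^+ 2 * q = (A * q - c ^+ 2) / q.
  by field.
by rewrite pmulr_lge0 ?invr_gt0// subr_ge0.
Qed.

Context (L S : set V) (b : V -> V -> R).
Hypothesis L_lin : forall a x y, L x -> L y -> L (a *: x + y).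
Hypothesis S_lin : forall a x y, S x -> S y -> S (a *: x + y).
Hypotheses (SL : S `<=` L) (S0 : S 0).
Hypothesis b_sym : forall x y, b x y = b y x.
Hypothesis b_lin : forall a x y z, L x -> L y -> L z ->
  b (a *: x + y) z = a * b x z + b y z.
Hypothesis b_ge0 : forall x, 0 <= b x x.
Hypothesis b_complete : forall s : nat -> V, (forall n, L (s n)) ->
  (forall e : R, 0 < e -> exists N, forall m n, (N <= m)%N -> (N <= n)%N ->
     b (s m - s n) (s m - s n) <= e) ->
  exists2 l, L l & b (s n - l) (s n - l) @[n --> \oo] --> (0 : R).

Let L0 : L 0. Proof. exact: SL. Qed.

Let LB x y : L x -> L y -> L (x - y).
Proof. by move=> Lx Ly; rewrite -scaleN1r addrC; exact: L_lin. Qed.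

Let bB x y z : L x -> L y -> L z -> b (x - y) z = b x z - b y z.
Proof.
by move=> *; rewrite -scaleN1r addrC b_lin// mulN1r addrC.
Qed.

Let b_sqr a x y : L x -> L y ->
  b (x - a *: y) (x - a *: y) = b x x - 2 * a * b x y + a ^+ 2 * b y y.
Proof.
move=> Lx Ly; have Lxy : L (x - a *: y).
  by rewrite -scaleNr addrC; exact: L_lin.
have E z : L z -> b (x - a *: y) z = b x z - a * b y z.
  by move=> Lz; rewrite -scaleNr addrC b_lin// mulNr addrC.
rewrite (E _ Lxy) [b x _]b_sym [b y _]b_sym !E// (b_sym y x); ring.
Qed.

Lemma cauchy_schwarz_form x y : L x -> L y -> b x y ^+ 2 <= b x x * b y y.
Proof.
move=> Lx Ly; apply: discriminant_le => // t; rewrite -b_sqr//.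
Qed.

(** A minimising sequence in [S] is a Cauchy sequence by the parallelogram law. The
form is only semidefinite, because the vectors will be functions and not classes of
functions modulo null sets: the projection [p] is not unique, and it lies in the
closure of [S] in the sense that some sequence of [S] converges to it. *)
Lemma hilbert_projection x : L x -> exists p,
  [/\ L p, exists2 s : nat -> V, (forall n, S (s n)) &
        b (s n - p) (s n - p) @[n --> \oo] --> (0 : R) &
      forall y, S y -> b (x - p) y = 0].
Proof.
move=> Lx.
pose E := [set b (x - s) (x - s) | s in S].
have hE : has_inf E.
  split; first by exists (b (x - 0) (x - 0)); exists 0.
  by exists 0 => _ [s _ <-].
have dE y : S y -> inf E <= b (x - y) (x - y).
  by move=> Sy; apply: ge_inf; [exact: hE.2 | exists y].
have /choice[s sP] : forall n : nat, exists s, S s /\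
    b (x - s) (x - s) < inf E + n.+1%:R^-1.
  move=> n; have [_ [y Sy <-] yE] : exists2 e, E e & e < inf E + n.+1%:R^-1.
    by apply: inf_adherent => //; rewrite invr_gt0.
  by exists y.
have Ss n : S (s n) := (sP n).1.
have Ls n : L (s n) := SL (Ss n).
have SZ a y : S y -> S (a *: y) by move=> Sy; rewrite -[_ *: _]addr0; exact: S_lin.
(* parallelogram law: the midpoint of [s m] and [s n] is not closer than the infimum *)
have b4 m n : b (s m - s n) (s m - s n) <= 2 * m.+1%:R^-1 + 2 * n.+1%:R^-1.
  have h1 := ltW (sP m).2; have h2 := ltW (sP n).2.
  have Smid : S (2^-1 *: (s m + s n)).
    by apply: SZ; rewrite -[s m]scale1r; exact: S_lin.
  have h3 := dE _ Smid.
  have par : b (s m - s n) (s m - s n) = 2 * b (x - s m) (x - s m)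
     + 2 * b (x - s n) (x - s n)
     - 4 * b (x - 2^-1 *: (s m + s n)) (x - 2^-1 *: (s m + s n)).
    have Lmn : L (s m + s n) by rewrite -[s m]scale1r; exact: L_lin.
    rewrite b_sqr// -[s m - s n](scale1r (s m - s n)) !scale1r.
    rewrite -[X in b (_ - X) _]scale1r -[X in b _ (_ - X)]scale1r b_sqr//.
    rewrite -[X in b (x - X) _]scale1r -[X in b _ (x - X)]scale1r b_sqr//.
    rewrite -[s n]scale1r b_sqr// !scale1r.
    have -> : b x (s m + s n) = b x (s m) + b x (s n).
      by rewrite b_sym -[s m]scale1r b_lin// !scale1r mul1r !(b_sym x).
    have -> : b (s m + s n) (s m + s n) = b (s m) (s m) + 2 * b (s m) (s n) + b (s n) (s n).
      rewrite -[X in b (X + _) _](scale1r (s m)) b_lin// mul1r.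
      rewrite ![b _ (s m + s n)]b_sym -[X in b (X + _) _](scale1r (s m)).
      by rewrite -[X in b (X + _) (s n)](scale1r (s m)) !b_lin// (b_sym (s n)); ring.
    by field.
  rewrite par; move: (m.+1%:R^-1) (n.+1%:R^-1) (inf E) h1 h2 h3 => i j k h1 h2 h3; lra.
have inv0 : n.+1%:R^-1 @[n --> \oo] --> (0 : R) by exact: cvg_harmonic.
have [p Lp pP] : exists2 l, L l & b (s n - l) (s n - l) @[n --> \oo] --> (0 : R).
  apply: b_complete => // e e0.
  have e4 : 0 < e / 4 by rewrite divr_gt0.
  have /cvgrPdist_le/(_ _ e4)[N _ NP] := inv0.
  exists N => m n Nm Nn; apply: le_trans (b4 m n) _.
  have := NP _ Nm; have := NP _ Nn; rewrite /= !sub0r !normrN !ger0_norm// => h1 h2.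
  move: (m.+1%:R^-1) (n.+1%:R^-1) h1 h2 => i j h1 h2; lra.
exists p; split => //; first by exists s.
move=> y Sy; have Ly := SL Sy.
(* moving [s n] along [y] does not bring it below the infimum *)
have near_orth n : b (x - s n) y ^+ 2 <= n.+1%:R^-1 * b y y.
  apply: discriminant_le => // t.
  have h1 := ltW (sP n).2.
  have h2 : inf E <= b (x - s n - t *: y) (x - s n - t *: y).
    by rewrite -addrA -opprD; apply: dE; rewrite addrC; exact: S_lin.
  rewrite b_sqr// in h2; last exact: LB.
  move: (inf E) (n.+1%:R^-1) h1 h2 => k j h1 h2; lra.
have bound n : b (x - p) y ^+ 2 <=
    2 * (n.+1%:R^-1 * b y y) + 2 * (b (s n - p) (s n - p) * b y y).
  have -> : b (x - p) y = b (x - s n) y + b (s n - p) y.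
    by rewrite !bB//; ring.
  have h1 := near_orth n.
  have h2 := cauchy_schwarz_form (LB (Ls n) Lp) Ly.
  have := sqr_ge0 (b (x - s n) y - b (s n - p) y).
  move: (b (x - s n) y) (b (s n - p) y) (n.+1%:R^-1 * b y y) h1 (b _ _ * _) h2.
  by move=> b1 b2 c1 h1 c2 h2 h3; nra.
apply/eqP; rewrite -sqrf_eq0 eq_le sqr_ge0 andbT.
have lim : 2 * (n.+1%:R^-1 * b y y) + 2 * (b (s n - p) (s n - p) * b y y)
    @[n --> \oo] --> 2 * (0 * b y y) + 2 * (0 * b y y).
  by apply: cvgD; apply: cvgMl_tmp; apply: cvgMr_tmp.
rewrite -[leRHS](_ : 2 * (0 * b y y) + 2 * (0 * b y y) = 0); last by ring.
apply: (@closed_cvg _ _ _ eventually_filter _ (fun z => b (x - p) y ^+ 2 <= z) _ _ _ lim).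
- exact: closed_ge.
- by apply: nearW => n; exact: bound.
Qed.

End Projection.

(** * Square-integrable functions *)

Section SquareIntegrable.
Context d (T : measurableType d) (R : realType) (mu : {measure set T -> \bar R}).
Context (D : set T).
Hypothesis mD : measurable D.

Definition sq_int (f : T -> R) : Prop :=
  measurable_fun D f /\ (\int[mu]_(x in D) (f x ^+ 2)%:E < +oo)%E.

Definition dot (f g : T -> R) : R := \int[mu]_(x in D) (f x * g x).

Lemma sq_int_integrable f : sq_int f -> mu.-integrable D (EFin \o (fun x => f x ^+ 2)).
Proof.
move=> [mf f2]; apply/integrableP; split.
  by apply/measurable_EFinP; exact: measurable_funX.
under eq_integral do rewrite /= ger0_norm ?sqr_ge0//.
exact: f2.
Qed.

Lemma sq_int_mul f g : sq_int f -> sq_int g ->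
  mu.-integrable D (EFin \o (fun x => f x * g x)).
Proof.
move=> sf sg; have := integrableD mD (sq_int_integrable sf) (sq_int_integrable sg).
apply: le_integrable => //.
  by apply/measurable_EFinP; apply: measurable_funM; [exact: sf.1|exact: sg.1].
move=> x Dx /=; rewrite lee_fin [leRHS]ger0_norm ?addr_ge0 ?sqr_ge0//.
by rewrite ler_norml; have := sqr_ge0 (f x - g x); have := sqr_ge0 (f x + g x); nra.
Qed.

Lemma sq_int_lin a f g : sq_int f -> sq_int g -> sq_int (fun x => a * f x + g x).
Proof.
move=> sf sg; have mfg : measurable_fun D (fun x => a * f x + g x).
  by apply: measurable_funD; [apply: measurable_funM => //; exact: sf.1 | exact: sg.1].
split => //.
have i1 := integrableD mD (integrableZl mD (2 * a ^+ 2) (sq_int_integrable sf))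
  (integrableZl mD 2 (sq_int_integrable sg)).
apply: le_lt_trans (integrable_lty mD i1).
apply: ge0_le_integral => //.
- by move=> x _; rewrite lee_fin sqr_ge0.
- by apply/measurable_EFinP; exact: measurable_funX.
- by case/integrableP : i1.
move=> x _ /=; rewrite -!EFinM -EFinD lee_fin /=.
by have := sqr_ge0 (a * f x - g x); nra.
Qed.

Lemma sq_int0 : sq_int (fun=> 0).
Proof.
split; first exact: measurable_cst.
by under eq_integral do rewrite expr0n /=; rewrite integral0.
Qed.

Lemma sq_int_sub f g : sq_int f -> sq_int g -> sq_int (fun x => f x - g x).
Proof.
move=> sf sg; have := sq_int_lin (-1) sg sf.
by congr sq_int; apply/funext => x /=; rewrite mulN1r addrC.
Qed.

Lemma dotC f g : dot f g = dot g f.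
Proof. by apply: eq_Rintegral => x _; rewrite mulrC. Qed.

Lemma dot_lin a f g h : sq_int f -> sq_int g -> sq_int h ->
  dot (fun x => a * f x + g x) h = a * dot f h + dot g h.
Proof.
move=> sf sg sh; rewrite /dot -RintegralZl//; last exact: sq_int_mul.
rewrite -RintegralD//; [|exact: (integrableZl mD a (sq_int_mul sf sh))|exact: sq_int_mul].
by apply: eq_Rintegral => x _ /=; rewrite mulrDl mulrA.
Qed.

Lemma dot_ge0 f : 0 <= dot f f.
Proof. by apply: Rintegral_ge0 => x _; rewrite -expr2 sqr_ge0. Qed.

Lemma dotE f : sq_int f -> (dot f f)%:E = (\int[mu]_(x in D) (f x ^+ 2)%:E)%E.
Proof.
move=> sf; rewrite /dot /Rintegral fineK.
  by apply: eq_integral => x _; rewrite expr2.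
exact/integrable_fin_num/sq_int_mul.
Qed.

(** The weights turn square summability into absolute summability: each increment [z]
satisfies [2 |z| <= 2^-k + 2^k z^2]. *)
Lemma cvg_fast_increments (M : R) (a : nat -> R) :
  (forall n, \sum_(0 <= k < n) 2 ^+ k * (a k.+1 - a k) ^+ 2 <= M) -> cvgn a.
Proof.
move=> aM.
have /normed_cvg h : cvgn [normed series (telescope a)].
  apply: nondecreasing_is_cvgn.
    by apply: nondecreasing_series => n _ _ /=; exact: normr_ge0.
  exists (2 + M) => _ [n _ <-] /=.
  apply: le_trans (_ : \sum_(0 <= k < n) (2^-1 ^+ k + 2 ^+ k * (a k.+1 - a k) ^+ 2) <= _).
    apply: ler_sum => k _; rewrite /telescope /=.
    have p : 0 < 2^-1 ^+ k :> R by rewrite exprn_gt0.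
    have q : 2 ^+ k * 2^-1 ^+ k = 1 :> R by rewrite -exprMn divff ?expr1n.
    have q0 : 0 < 2 ^+ k :> R by rewrite exprn_gt0.
    move: (a k.+1 - a k) => z; rewrite ler_norml.
    have e1 : 0 <= 2 ^+ k * (2^-1 ^+ k - z) ^+ 2 by rewrite mulr_ge0 ?sqr_ge0 ?ltW.
    have e2 : 0 <= 2 ^+ k * (2^-1 ^+ k + z) ^+ 2 by rewrite mulr_ge0 ?sqr_ge0 ?ltW.
    move: (2 ^+ k : R) (2^-1 ^+ k : R) p q q0 e1 e2 => t i p q q0 e1 e2.
    have e3 : t * (i - z) ^+ 2 = i + t * z ^+ 2 - 2 * z by rewrite -(mulr1 i) -q; ring: q.
    have e4 : t * (i + z) ^+ 2 = i + t * z ^+ 2 + 2 * z by ring: q.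
    by apply/andP; split; nra.
  rewrite big_split /= lerD//.
  suff -> : \sum_(0 <= k < n) 2^-1 ^+ k = 2 - 2 * 2^-1 ^+ n :> R.
    by rewrite gerBl mulr_ge0// exprn_ge0.
  elim: n => [|n IH]; first by rewrite big_geq// expr0; ring.
  by rewrite big_nat_recr//= IH exprS; field.
have -> : a = (fun n => a 0%N + series (telescope a) n).
  by apply/funext => n; exact: eq_sum_telescope.
by apply: is_cvgD => //; exact: is_cvg_cst.
Qed.

Lemma limn_einf_le (u : nat -> \bar R) (e : \bar R) N :
  (forall n, (N <= n)%N -> (u n <= e)%E) -> (limn_einf u <= e)%E.
Proof.
move=> ue; rewrite limn_einf_lim; apply: lime_le; first exact: is_cvg_einfs.
apply: nearW => k; apply: le_trans (ue (maxn k N) (leq_maxr _ _)).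
by apply: ereal_inf_lbound; exists (maxn k N) => //=; exact: leq_maxl.
Qed.

(** The squared increments with weights [2^k] have integrals of finite total, so their
sum is finite almost everywhere and [cvg_fast_increments] applies pointwise. The first
factor of the tolerance absorbs the weight, the second one is summable. *)
Lemma sq_int_fast_subseq (f : nat -> T -> R) : (forall n, sq_int (f n)) ->
  (forall k, dot (fun x => f k.+1 x - f k x) (fun x => f k.+1 x - f k x)
     <= (2 ^+ k)^-1 * (1 / (2 ^ k.+1)%:R)) ->
  {ae mu, forall x, D x -> cvgn (f^~ x)}.
Proof.
move=> sf df.
pose g k x := (2 ^+ k * (f k.+1 x - f k x) ^+ 2)%:E.
have g0 k x : (0 <= g k x)%E.
  by rewrite lee_fin; apply: mulr_ge0; [exact: exprn_ge0 | exact: sqr_ge0].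
have sd k : sq_int (fun x => f k.+1 x - f k x) by exact: sq_int_sub.
have mg k : measurable_fun D (g k).
  by apply/measurable_EFinP/measurable_funM => //; apply: measurable_funX; exact: (sd k).1.
have G : mu.-integrable D (fun x => \sum_(0 <= k <oo) g k x)%E.
  apply/integrableP; split.
    by apply: ge0_emeasurable_sum => // k x _ _; exact: g0.
  under eq_integral do rewrite gee0_abs ?nneseries_ge0//.
  rewrite integral_nneseries//.
  apply: (@le_lt_trans _ _ 1%E); last exact: ltry.
  apply: le_trans (@epsilon_trick0 R 1 xpredT ler01).
  apply: lee_nneseries => [k _ _|k _]; first exact: integral_ge0.
  under eq_integral do rewrite /g EFinM.
  rewrite ge0_integralZl_EFin ?exprn_ge0//; last 2 first.
  - by move=> x _; rewrite lee_fin sqr_ge0.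
  - by apply/measurable_EFinP/measurable_funX; exact: (sd k).1.
  rewrite -dotE// -EFinM lee_fin -ler_pdivlMl ?exprn_gt0//.
have := integrable_ae mD G; apply: filterS => x Gx Dx.
have /fineK Gfin := Gx Dx.
apply: (@cvg_fast_increments (fine (\sum_(0 <= k <oo) g k x)%E)) => n.
rewrite -lee_fin Gfin -sumEFin.
by apply: nneseries_lim_ge => k _ _; exact: g0.
Qed.

(** The Riesz-Fischer theorem: a fast subsequence converges almost everywhere, and
Fatou's lemma bounds the distance to its limit. *)
Lemma sq_int_complete (f : nat -> T -> R) : (forall n, sq_int (f n)) ->
  (forall e : R, 0 < e -> exists N, forall m n, (N <= m)%N -> (N <= n)%N ->
     dot (fun x => f m x - f n x) (fun x => f m x - f n x) <= e) ->
  exists2 l, sq_int l &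
    dot (fun x => f n x - l x) (fun x => f n x - l x) @[n --> \oo] --> (0 : R).
Proof.
move=> sf cf.
pose tol k : R := (2 ^+ k)^-1 * (1 / (2 ^ k.+1)%:R).
have tol0 k : 0 < tol k by rewrite mulr_gt0 ?divr_gt0 ?invr_gt0 ?exprn_gt0 ?ltr0n ?expn_gt0.
have /choice[N NP] := fun k => cf (tol k) (tol0 k).
(* partial sums, so that the indices increase *)
pose n_ k := (\sum_(i < k.+1) N i + k)%N.
have n_N k : (N k <= n_ k)%N by rewrite /n_ big_ord_recr/= addnAC leq_addl.
have n_S k : (n_ k <= n_ k.+1)%N.
  by rewrite /n_ [in leqRHS]big_ord_recr/= -addnA leq_add2l addnS ltnW// ltnS leq_addl.
have n_k k : (k <= n_ k)%N by rewrite leq_addl.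
have cv : {ae mu, forall x, D x -> cvgn (fun k => f (n_ k) x)}.
  apply: (sq_int_fast_subseq (f := fun k => f (n_ k))) => [k|k]; first exact: sf.
  by apply: NP; [exact: leq_trans (n_N k) (n_S k) | exact: n_N].
(* an upper limit is measurable whether or not the sequence converges *)
pose l x := fine (limn_esup (fun k => (f (n_ k) x)%:E)).
have ml : measurable_fun D l.
  apply: measurableT_comp => //.
  apply: measurable_fun_limn_esup => k.
  by apply/measurable_EFinP; exact: (sf _).1.
have cvl : {ae mu, forall x, D x -> f (n_ k) x @[k --> \oo] --> l x}.
  apply: filterS cv => x cx Dx; have /cvg_ex[y fy] := cx Dx.
  have fyE : (f (n_ k) x)%:E @[k --> \oo] --> y%:E.
    by apply: cvg_EFin => //; exact: nearW.
  by rewrite /l (cvg_limn_einf_sup fyE).2.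
have main (e : R) M : (forall m n, (M <= m)%N -> (M <= n)%N ->
     dot (fun x => f m x - f n x) (fun x => f m x - f n x) <= e) ->
   forall n, (M <= n)%N -> (\int[mu]_(x in D) ((f n x - l x) ^+ 2)%:E <= e%:E)%E.
  move=> Me n Mn.
  pose h k x := ((f n x - f (n_ k) x) ^+ 2)%:E.
  have mh k : measurable_fun D (h k).
    by apply/measurable_EFinP/measurable_funX; apply: measurable_funB; exact: (sf _).1.
  have -> : (\int[mu]_(x in D) ((f n x - l x) ^+ 2)%:E =
             \int[mu]_(x in D) limn_einf (h^~ x))%E.
    apply: ge0_ae_eq_integral => //.
    - by apply/measurable_EFinP/measurable_funX; apply: measurable_funB => //; exact: (sf _).1.
    - have -> : (fun x => limn_einf (h^~ x)) = (fun x => - limn_esup (fun k => - h k x))%E.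
        by apply/funext => x; rewrite limn_esupN oppeK.
      apply: measurableT_comp => //; apply: measurable_fun_limn_esup => k.
      exact: measurableT_comp.
    - by move=> x _; rewrite lee_fin sqr_ge0.
    - move=> x _; rewrite limn_einf_lim; apply: lime_ge; first exact: is_cvg_einfs.
      apply: nearW => k; apply: le_ereal_inf_tmp => _ [j _ <-].
      by rewrite lee_fin sqr_ge0.
    apply: filterS cvl => x cx Dx; have {}cx := cx Dx.
    have c2 : h k x @[k --> \oo] --> ((f n x - l x) ^+ 2)%:E.
      apply: cvg_EFin; first exact: nearW.
      rewrite /comp /=.
      by rewrite expr2; under eq_fun do rewrite expr2; apply: cvgM; apply: cvgB => //; exact: cvg_cst.
    by rewrite (cvg_limn_einf_sup c2).1.
  apply: le_trans (fatou mu mD mh _) _; first by move=> k x _; rewrite lee_fin sqr_ge0.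
  apply: (limn_einf_le (N := M)) => k Mk.
  rewrite -dotE ?lee_fin; last exact: sq_int_sub.
  by apply: Me => //; exact: leq_trans Mk (n_k k).
have sl : sq_int l.
  have [M MP] := cf 1 ltr01.
  have : sq_int (fun x => f M x - l x).
    split; first by apply: measurable_funB => //; exact: (sf M).1.
    exact: le_lt_trans (main _ _ MP _ (leqnn M)) (ltry _).
  move=> h; have := sq_int_sub (sf M) h.
  by congr sq_int; apply/funext => x; ring.
exists l => //; apply/cvgrPdist_le => e e0.
have [M MP] := cf e e0; exists M => // n Mn /=.
rewrite sub0r normrN ger0_norm ?dot_ge0// -lee_fin dotE; last exact: sq_int_sub.
exact: main MP _ Mn.
Qed.

End SquareIntegrable.

(** * Boxes and open sets of three-space *)

Section Boxes.
Context {R : realType}.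
Local Notation mR := (measurableTypeR R).
Local Notation mR3 := (mR * mR * mR)%type.
Implicit Types a b x : R3 R.

Definition box a b : set (R3 R) :=
  `]a.1.1, b.1.1[ `*` `]a.1.2, b.1.2[ `*` `]a.2, b.2[.

Definition cbox a b : set (R3 R) :=
  `[a.1.1, b.1.1] `*` `[a.1.2, b.1.2] `*` `[a.2, b.2].

Lemma boxP a b x : box a b x <->
  [/\ a.1.1 < x.1.1 < b.1.1, a.1.2 < x.1.2 < b.1.2 & a.2 < x.2 < b.2].
Proof.
rewrite /box /setX /=; split.
  by move=> [[]]; rewrite !in_itv.
by move=> [h1 h2 h3]; rewrite !in_itv.
Qed.

Lemma cboxP a b x : cbox a b x <->
  [/\ a.1.1 <= x.1.1 <= b.1.1, a.1.2 <= x.1.2 <= b.1.2 & a.2 <= x.2 <= b.2].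
Proof.
rewrite /cbox /setX /=; split.
  by move=> [[]]; rewrite !in_itv.
by move=> [h1 h2 h3]; rewrite !in_itv.
Qed.

Lemma box_sub_cbox a b : box a b `<=` cbox a b.
Proof.
move=> x /boxP[/andP[h1 h2] /andP[h3 h4] /andP[h5 h6]]; apply/cboxP.
by split; apply/andP; split; exact: ltW.
Qed.

Lemma compact_cbox a b : compact (cbox a b).
Proof. by apply: compact_setX; [apply: compact_setX|]; exact: segment_compact. Qed.

Lemma measurable_box a b : @measurable _ mR3 (box a b).
Proof. by apply: measurableX => //; apply: measurableX. Qed.

Lemma measurable_cbox a b : @measurable _ mR3 (cbox a b).
Proof. by apply: measurableX => //; apply: measurableX. Qed.

Lemma lebesgue3_cbox_lty a b : (lebesgue3 (cbox a b) < +oo)%E.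
Proof.
have -> : (lebesgue3 (cbox a b) = lebesgue2 (`[a.1.1, b.1.1] `*` `[a.1.2, b.1.2])
    * lebesgue_measure (`[a.2, b.2] : set R))%E.
  by apply: product_measure1E => //; exact: measurableX.
have -> : (lebesgue2 (`[a.1.1, b.1.1] `*` `[a.1.2, b.1.2]) =
    lebesgue_measure (`[a.1.1, b.1.1] : set R) * lebesgue_measure (`[a.1.2, b.1.2] : set R))%E.
  exact: product_measure1E.
by rewrite !lebesgue_measure_itv /=; do !case: ifP => _; rewrite ?mule0 ?mul0e// -?EFinB -?EFinM ltry.
Qed.

(** Rational corners leave only countably many boxes to choose from. *)
Lemma open_box_nbhs (Om : set (R3 R)) x : open Om -> Om x ->
  exists p q : rat * rat * rat,
    let a := (ratr p.1.1, ratr p.1.2, ratr p.2) in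
    let b := (ratr q.1.1, ratr q.1.2, ratr q.2) in
    cbox a b `<=` Om /\ box a b x.
Proof.
move=> oOm Omx; have /nbhs_ballP[e /= e0 eOm] := open_nbhs_nbhs (conj oOm Omx).
have rl (t : R) : exists q : rat, t - e < ratr q < t.
  have [|q] := @rat_in_itvoo R (t - e) t; first by lra.
  by rewrite in_itv; exists q.
have rr (t : R) : exists q : rat, t < ratr q < t + e.
  have [|q] := @rat_in_itvoo R t (t + e); first by lra.
  by rewrite in_itv; exists q.
have [p1 h1] := rl x.1.1; have [p2 h2] := rl x.1.2; have [p3 h3] := rl x.2.
have [q1 k1] := rr x.1.1; have [q2 k2] := rr x.1.2; have [q3 k3] := rr x.2.
exists (p1, p2, p3), (q1, q2, q3); split; last by apply/boxP; split => /=; lra.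
have near_ball (t s : R) : t - e < s < t + e -> ball t e s.
  by move=> h; rewrite -ball_normE /ball_ /= ltr_norml; lra.
move=> y /cboxP[/= l1 l2 l3]; apply: eOm.
have d1 : x.1.1 - e < y.1.1 < x.1.1 + e by lra.
have d2 : x.1.2 - e < y.1.2 < x.1.2 + e by lra.
have d3 : x.2 - e < y.2 < x.2 + e by lra.
by split; [split; exact: near_ball | exact: near_ball].
Qed.

(** The inclusion of the closed boxes makes every box of the union the support of a
test function on [Om]. *)
Lemma open_bigcup_box (Om : set (R3 R)) : open Om ->
  exists a b : nat -> R3 R, (forall n, cbox (a n) (b n) `<=` Om) /\
    Om = \bigcup_n box (a n) (b n).
Proof.
move=> oOm.
pose toR (p : rat * rat * rat) : R3 R := (ratr p.1.1, ratr p.1.2, ratr p.2).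
pose good (pq : (rat * rat * rat) * (rat * rat * rat)) :=
  `[< cbox (toR pq.1) (toR pq.2) `<=` Om >].
(* numbers that encode no box inside [Om] are sent to an empty box *)
pose c n := if unpickle n is Some pq then
  if good pq then (toR pq.1, toR pq.2) else ((1, 1, 1), 0) else ((1, 1, 1), 0 : R3 R).
exists (fst \o c), (snd \o c).
have empty : cbox (1, 1, 1) (0 : R3 R) `<=` Om.
  by move=> x /cboxP[/= /andP[h1 h2]]; have := le_trans h1 h2; rewrite ler10.
have cOm n : cbox (c n).1 (c n).2 `<=` Om.
  rewrite /c; case: unpickle => [pq|//]; case: ifPn => [/asboolP|] //.
split=> //; apply/seteqP; split => [x Omx|x [n _] /box_sub_cbox]; last exact: cOm.
have [p [q /= [pqOm pqx]]] := open_box_nbhs oOm Omx.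
have [n cn] : exists n, c n = (toR p, toR q).
  exists (pickle (p, q)); rewrite /c pickleK.
  by rewrite (_ : good (p, q) = true)//; apply/asboolP.
by exists n => //; rewrite /= cn.
Qed.

(** Openness refers to the product topology and measurability to the product
sigma-algebra: a countable union of boxes relates the two. *)
Lemma open_measurable3 (Om : set (R3 R)) : open Om -> @measurable _ mR3 Om.
Proof.
move=> /open_bigcup_box[a [b [_ ->]]].
by apply: bigcupT_measurable => n; exact: measurable_box.
Qed.

Lemma continuous_measurable3 (f : R3 R -> R) (D : set (R3 R)) :
  @measurable _ mR3 D -> continuous f -> @measurable_fun _ _ mR3 R D f.
Proof.
move=> mD cf; apply: measurable_funTS.
apply: (measurability _ (RGenOInfty.measurableE R)) => _ [_ [r ->] <-].
rewrite setTI; apply: open_measurable3.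
by apply: open_comp; [move=> + _; exact: cf | exact: rray_open].
Qed.

End Boxes.

(** * Integration by parts against test functions *)

Section PartialDerivatives.
Context {R : realType}.
Local Notation mR := (measurableTypeR R).
Local Notation mR3 := (mR * mR * mR)%type.
Implicit Types (p x : R3 R) (phi psi : R3 R -> R).

Lemma is_derive_line phi (i : 'I_3) p (t : R) :
  derivable phi (p + t *: evec i) (evec i) ->
  is_derive t (1 : R) (fun s : R => phi (p + s *: evec i))
    (pderiv i phi (p + t *: evec i)).
Proof.
have E : (fun h : R => h^-1 *: (((fun s : R => phi (p + s *: evec i)) \o shift t) (h *: 1)
     - phi (p + t *: evec i))) =
  (fun h : R => h^-1 *: ((phi \o shift (p + t *: evec i)) (h *: evec i)
     - phi (p + t *: evec i))).
  apply/funext => h /=; congr (_ *: (phi _ - _)).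
  by rewrite [h *: 1]mulr1 scalerDl addrCA.
move=> d; apply: DeriveDef.
  by rewrite /derivable E.
by rewrite /pderiv /derive E.
Qed.

Definition cube (M : R) : set (R3 R) := cbox (- M, - M, - M) (M, M, M).

(** Supports in cubes rather than in compact sets, for Fubini's theorem. *)
Definition Cc phi : Prop :=
  continuous phi /\ exists M, forall x, ~ cube M x -> phi x = 0.

Lemma cubeP (M : R) x : cube M x <-> [/\ `|x.1.1| <= M, `|x.1.2| <= M & `|x.2| <= M].
Proof.
split; first by case/cboxP => /= h1 h2 h3; rewrite !ler_norml.
by rewrite !ler_norml => -[h1 h2 h3]; apply/cboxP.
Qed.

Lemma Cc_compact_support phi (K : set (R3 R)) : continuous phi -> compact K ->
  (forall x, ~ K x -> phi x = 0) -> Cc phi.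
Proof.
move=> cphi cK phiK; split=> //.
have [M [_ MK]] := compact_bounded cK.
exists (M + 1) => x xM; apply: phiK; apply: contra_not xM => Kx.
have M1 : M < M + 1 by rewrite ltrDl.
have : `|x| <= M + 1 by exact: (MK _ M1 _ Kx).
have -> : `|x| = Num.max (Num.max `|x.1.1| `|x.1.2|) `|x.2| by [].
by rewrite !ge_max => /andP[/andP[h1 h2] h3]; apply/cubeP.
Qed.

Lemma Cc_bounded phi : Cc phi -> exists B, forall x, `|phi x| <= B.
Proof.
move=> [cphi [M phiM]].
have cK : compact (phi @` cube M).
  apply: continuous_compact; last exact: compact_cbox.
  exact: continuous_subspaceT.
have [B [_ BK]] := compact_bounded cK.
have M1 : B < `|B| + 1 by rewrite ltr_pwDr// ler_norm.
exists (`|B| + 1) => x; have [xM|xM] := pselect (cube M x).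
  by apply: (BK _ M1); exists x.
by rewrite phiM// normr0 addr_ge0.
Qed.

Lemma CcM phi psi : Cc phi -> continuous psi -> Cc (fun x => phi x * psi x).
Proof.
move=> [cphi [M phiM]] cpsi; split; last by exists M => x /phiM ->; rewrite mul0r.
by move=> x; apply: continuousM; [exact: cphi | exact: cpsi].
Qed.

Lemma Cc_pderiv phi i : Cc phi -> continuous (pderiv i phi) -> Cc (pderiv i phi).
Proof.
move=> [cphi [M phiM]] cd; split=> //; exists M => x xM.
rewrite /pderiv (@near_eq_derive _ _ _ _ (cst 0)) ?derive_cst//.
have oM : open (~` cube M).
  by apply: closed_openC; apply: compact_closed; [exact: norm_hausdorff|exact: compact_cbox].
by apply: filterS (open_nbhs_nbhs (conj oM xM)) => y; exact: phiM.
Qed.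

End PartialDerivatives.

Section BoundedSupport.
Context d (T : measurableType d) (R : realType) (mu : {measure set T -> \bar R}).

Lemma integrable_bounded_support (A : set T) (f : T -> R) (B : R) : measurable A ->
  (mu A < +oo)%E -> measurable_fun setT f -> (forall x, `|f x| <= B) ->
  (forall x, ~ A x -> f x = 0) -> mu.-integrable setT (EFin \o f).
Proof.
move=> mA Aoo mf fB fA.
have -> : EFin \o f = (EFin \o f) \_ A.
  by apply/funext => x; rewrite patchE; case: ifPn => //; rewrite notin_setE => xA /=; rewrite fA.
apply/(integrable_mkcond _ mA); apply: measurable_bounded_integrable => //.
  exact: measurable_funTS.
exists `|B|; split; first exact: num_real.
by move=> M BM x _ /=; apply: le_trans (fB x) _; apply: ltW; apply: le_lt_trans BM; exact: ler_norm.
Qed.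

End BoundedSupport.

Section IntegralOfDerivative.
Context {R : realType}.
Local Notation mR := (measurableTypeR R).
Local Notation mR2 := (mR * mR)%type.
Local Notation mR3 := (mR * mR * mR)%type.
Implicit Types (p x : R3 R) (phi psi : R3 R -> R).

Lemma Cc_integrable phi : Cc phi -> lebesgue3.-integrable setT (EFin \o phi).
Proof.
move=> cphi; have [B phiB] := Cc_bounded cphi; have [cont [M phiM]] := cphi.
apply: (@integrable_bounded_support _ mR3 R lebesgue3 (cube M) phi B) => //.
- exact: measurable_cbox.
- exact: lebesgue3_cbox_lty.
- exact: (@continuous_measurable3 _ phi setT measurableT cont).
Qed.

(** The fundamental theorem of calculus between [- N] and [N], where [F] vanishes. *)
Lemma integral_derivative_eq0 (F dF : R -> R) (N : R) : 0 < N ->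
  (forall t, is_derive t (1 : R) F (dF t)) -> continuous dF ->
  (forall t, N <= `|t| -> F t = 0) -> (forall t, N < `|t| -> dF t = 0) ->
  (\int[lebesgue_measure]_t (dF t)%:E = 0)%E.
Proof.
move=> N0 FdF cdF F0 dF0.
have Fc : continuous F.
  by move=> t; apply: differentiable_continuous; apply/derivable1_diffP; exact: ex_derive.
have -> : (\int[lebesgue_measure]_t (dF t)%:E = \int[lebesgue_measure]_(t in [set` `[- N, N]%R]) (dF t)%:E)%E.
  rewrite [RHS]integral_mkcond; apply: eq_integral => t _; rewrite patchE.
  case: ifPn => // /negP; rewrite inE /= in_itv /= => /negP.
  by rewrite -ler_norml -ltNge => /dF0 ->.
rewrite (@continuous_FTC2 _ dF F).
- by rewrite F0 ?ger0_norm ?(ltW N0)// F0 ?normrN ?ger0_norm ?(ltW N0)// subee.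
- by rewrite gtrN.
- exact: continuous_subspaceT.
- split=> [t _||]; first exact: ex_derive.
  + by apply: cvg_at_right_filter; exact: Fc.
  + by apply: cvg_at_left_filter; exact: Fc.
- by move=> t _; rewrite derive1E derive_val.
Qed.

Lemma continuous_line (i : 'I_3) p : continuous (fun t : R => p + t *: evec i).
Proof.
move=> t; apply: cvgD; first exact: cvg_cst.
by apply: cvgZr_tmp; exact: cvg_id.
Qed.

Section Partial.
Variables (i : 'I_3) (phi : R3 R -> R).
Hypotheses (Cphi : Cc phi) (dphi : forall x, derivable phi x (evec i)).
Hypothesis cdphi : continuous (pderiv i phi).

Let Cd : Cc (pderiv i phi). Proof. exact: Cc_pderiv. Qed.

Lemma integral_pderiv_line p :
  (\int[lebesgue_measure]_t (pderiv i phi (p + (t : R) *: evec i)%R)%:E = 0)%E.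
Proof.
have [_ [M1 phi0]] := Cphi; have [_ [M2 d0]] := Cd.
(* beyond [N] the line has left the supports of [phi] and of its derivative *)
pose N := `|M1| + `|M2| + `|p.1.1| + `|p.1.2| + `|p.2| + 1.
have far t : N <= `|t| ->
    ~ cube M1 (p + t *: evec i) /\ ~ cube M2 (p + t *: evec i).
  move=> Nt.
  have big (a b : R) M : `|a| + `|M| + 1 <= `|t| -> b = a + t -> ~ (`|b| <= M).
    move=> h -> h1; have := ler_normB (a + t) a; rewrite addrAC subrr add0r.
    by have := ler_norm M; lra.
  have p1 := normr_ge0 p.1.1; have p2 := normr_ge0 p.1.2; have p3 := normr_ge0 p.2.
  have m1 := normr_ge0 M1; have m2 := normr_ge0 M2.
  have gen M : `|M| <= `|M1| + `|M2| -> ~ cube M (p + t *: evec i).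
    move=> hM /cubeP[]; case: i => [[|[|[|//]]] hi] /= h1 h2 h3.
    - by apply: (big p.1.1 _ M _ _ h1); [rewrite /N in Nt; lra | rewrite [_ *: _]mulr1].
    - by apply: (big p.1.2 _ M _ _ h2); [rewrite /N in Nt; lra | rewrite [_ *: _]mulr1].
    - by apply: (big p.2 _ M _ _ h3); [rewrite /N in Nt; lra | rewrite [_ *: _]mulr1].
  by split; apply: gen; lra.
apply: (@integral_derivative_eq0 (fun t => phi (p + t *: evec i)) _ N).
- by rewrite /N; have := normr_ge0 p.1.1; have := normr_ge0 p.1.2;
    have := normr_ge0 p.2; have := normr_ge0 M1; have := normr_ge0 M2; lra.
- by move=> t; exact: is_derive_line.
- move=> t; apply: (@continuous_comp _ _ _ (fun s : R => p + s *: evec i) (pderiv i phi)).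
    exact: continuous_line.
  exact: cdphi.
- by move=> t /far[h _]; exact: phi0.
- by move=> t /ltW/far[_ h]; exact: d0.
Qed.

(** Fubini's theorem, integrating first along the line of the derivative. *)
Lemma integral_pderiv_eq0 : (\int[lebesgue3]_x (pderiv i phi x)%:E = 0)%E.
Proof.
have int3 := Cc_integrable Cd.
have ev (a b c t : R) : (a, b, c) + t *: evec i =
    (a + t * (i == 0 :> nat)%:R, b + t * (i == 1 :> nat)%:R, c + t * (i == 2 :> nat)%:R) :> R3 R.
  by [].
have [z2|i2] := eqVneq (i : nat) 2%N.
  rewrite -(fubini1 int3) /fubini_F integral0_eq// => -[x y] _.
  rewrite -[RHS](integral_pderiv_line (x, y, 0)); apply: eq_integral => z _ /=.
  by rewrite ev z2 /= !mulr0 !addr0 mulr1 add0r.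
rewrite -(fubini2 int3) /fubini_G integral0_eq// => z _.
have int2 : lebesgue2.-integrable setT (fun xy : mR2 => (pderiv i phi (xy, z))%:E).
  have [B dB] := Cc_bounded Cd; have [cd [M dM]] := Cd.
  apply: (@integrable_bounded_support _ mR2 R lebesgue2 (`[-M, M] `*` `[-M, M]) (fun xy => pderiv i phi (xy, z)) B) => //.
  - exact: measurableX.
  - have e : (lebesgue2 (`[(- M)%R, M] `*` `[(- M)%R, M]) =
        lebesgue_measure (`[(- M)%R, M] : set R) * lebesgue_measure (`[(- M)%R, M] : set R))%E.
      exact: product_measure1E.
    suff : (lebesgue2 (`[(- M)%R, M] `*` `[(- M)%R, M]) < +oo)%E by [].
    by rewrite e lebesgue_measure_itv /=; case: ifP => _; rewrite ?mule0// -?EFinB -?EFinM ltry.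
  - apply: (@measurable_fun_pair1 _ _ _ mR2 mR _ (pderiv i phi)).
    exact: (@continuous_measurable3 _ _ setT measurableT cd).
  - move=> [x y] xyM; apply: dM; apply: contra_not xyM => -[h _].
    exact: h.
have [z1|i1] := eqVneq (i : nat) 1%N.
  rewrite -(fubini1 int2) /fubini_F integral0_eq// => x _.
  rewrite -[RHS](integral_pderiv_line (x, 0, z)); apply: eq_integral => y _ /=.
  by rewrite ev z1 /= !mulr0 !addr0 mulr1 add0r.
have z0 : i = 0%N :> nat by move: i2 i1; case: (i) => [[|[|[|//]]] ?].
rewrite -(fubini2 int2) /fubini_G integral0_eq// => y _.
rewrite -[RHS](integral_pderiv_line (0, y, z)); apply: eq_integral => x _ /=.
by rewrite ev z0 /= !mulr0 !addr0 mulr1 add0r.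
Qed.

End Partial.

Section TestFunctions.
Variable Om : set (R3 R).

Lemma test_continuous phi : test Om phi -> continuous phi.
Proof. by case=> /(_ [::])[]. Qed.

Lemma smooth_pderiv i phi : smooth phi -> smooth (pderiv i phi).
Proof. by move=> sphi s; have := sphi (rcons s i); rewrite foldr_rcons. Qed.

Lemma pderiv_outside i phi (K : set (R3 R)) : closed K ->
  (forall x, ~ K x -> phi x = 0) -> forall x, ~ K x -> pderiv i phi x = 0.
Proof.
move=> cK phiK x Kx.
rewrite /pderiv (@near_eq_derive _ _ _ _ (cst 0)) ?derive_cst//.
by apply: filterS (open_nbhs_nbhs (conj (closed_openC cK) Kx)) => y; exact: phiK.
Qed.

Lemma test_pderiv i phi : test Om phi -> test Om (pderiv i phi).
Proof.
move=> [sphi [K [cK KOm phiK]]]; split; first exact: smooth_pderiv.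
exists K; split => //; apply: pderiv_outside => //.
by apply: compact_closed => //; exact: norm_hausdorff.
Qed.

Lemma test_Cc phi : test Om phi -> Cc phi.
Proof.
move=> tphi; have [_ [K [cK _ phiK]]] := tphi.
exact: Cc_compact_support (test_continuous tphi) cK phiK.
Qed.

Lemma test_outside phi x : test Om phi -> ~ Om x -> phi x = 0.
Proof. by move=> [_ [K [_ KOm phiK]]] xOm; apply: phiK; apply: contra_not xOm; exact: KOm. Qed.

Lemma integral_test_setT phi psi : test Om phi ->
  \int[lebesgue3]_(x in Om) (phi x * psi x) = \int[lebesgue3]_x (phi x * psi x).
Proof.
move=> tphi; rewrite Rintegral_mkcond; apply: eq_Rintegral => x _.
by rewrite patchE; case: ifPn => //; rewrite notin_setE => /(test_outside tphi) ->; rewrite mul0r.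
Qed.

(** The product [phi * psi] has compact support, so the integral of its derivative
vanishes. *)
Lemma test_parts i phi psi : test Om phi -> smooth psi ->
  \int[lebesgue3]_(x in Om) (pderiv i phi x * psi x) =
  - \int[lebesgue3]_(x in Om) (phi x * pderiv i psi x).
Proof.
move=> tphi spsi; rewrite !integral_test_setT//; last exact: test_pderiv.
have [sphi _] := tphi.
have cphi := test_continuous tphi.
have [cpsi dpsi] : continuous psi /\ forall i x, derivable psi x (evec i) := spsi [::].
have [cdphi _] : continuous (pderiv i phi) /\ _ := sphi [:: i].
have [cdpsi _] : continuous (pderiv i psi) /\ _ := spsi [:: i].
have dphi x : derivable phi x (evec i) by have [_] := sphi [::]; exact.
have E : pderiv i (fun x => phi x * psi x) =
    fun x => pderiv i phi x * psi x + phi x * pderiv i psi x.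
  by apply/funext => x; rewrite /pderiv deriveM//= addrC /GRing.scale/= [psi x * _]mulrC.
have C1 : Cc (fun x => phi x * psi x) by apply: CcM => //; exact: test_Cc.
have C2 : Cc (fun x => pderiv i phi x * psi x).
  by apply: CcM => //; apply: test_Cc; exact: test_pderiv.
have C3 : Cc (fun x => phi x * pderiv i psi x) by apply: CcM => //; exact: test_Cc.
have := @integral_pderiv_eq0 i (fun x => phi x * psi x) C1.
rewrite E => H; apply/eqP; rewrite -subr_eq0 opprK; apply/eqP.
rewrite -RintegralD//; [|exact: Cc_integrable|exact: Cc_integrable].
have dprod x : derivable (fun y => phi y * psi y) x (evec i) by apply: derivableM.
have cprod : continuous (fun x => pderiv i phi x * psi x + phi x * pderiv i psi x).
  by move=> x; apply: cvgD; [exact: C2.1 | exact: C3.1].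
exact: (congr1 fine (H dprod cprod)).
Qed.

End TestFunctions.

End IntegralOfDerivative.

(** * Smooth plateau functions on the line *)

Section Smooth1.
Context {R : realType}.
Implicit Types f g h : R -> R.

(** Recursion on the derivative makes the closure under sums, products and affine
substitutions immediate by induction. *)
Fixpoint diff_n n f : Prop :=
  if n is m.+1 then (forall x, derivable f x 1) /\ diff_n m (derive1 f) else True.

Definition smooth1 f := forall n, diff_n n f.

Lemma diff_nS n f : diff_n n.+1 f -> diff_n n f.
Proof. by elim: n f => [//|n IH] f [h1 h2]; split => //; apply: IH. Qed.

Lemma diff_nD n f g : diff_n n f -> diff_n n g -> diff_n n (fun x => f x + g x).
Proof.
elim: n f g => [//|n IH] f g [df sf] [dg sg]; split; first by move=> x; apply: derivableD.
have -> : derive1 (fun x => f x + g x) = fun x => derive1 f x + derive1 g x.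
  by apply/funext => x; rewrite !derive1E deriveD.
exact: IH.
Qed.

Lemma diff_nZ n c f : diff_n n f -> diff_n n (fun x => c * f x).
Proof.
elim: n f => [//|n IH] f [df sf]; split; first by move=> x; apply: derivableZ.
have -> : derive1 (fun x => c * f x) = fun x => c * derive1 f x.
  by apply/funext => x; rewrite !derive1E deriveZ.
exact: IH.
Qed.

Lemma diff_nM n f g : diff_n n f -> diff_n n g -> diff_n n (fun x => f x * g x).
Proof.
elim: n f g => [//|n IH] f g [df sf] [dg sg]; split; first by move=> x; apply: derivableM.
have -> : derive1 (fun x => f x * g x) = fun x => f x * derive1 g x + derive1 f x * g x.
  apply/funext => x; rewrite !derive1E deriveM//.
  by rewrite /GRing.scale/= [g x * _]mulrC.
by apply: diff_nD; apply: IH => //; exact: diff_nS.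
Qed.

Lemma is_derive_affine f (c d x : R) : derivable f (c * x + d) 1 ->
  is_derive x (1 : R) (fun y => f (c * y + d)) (c * derive1 f (c * x + d)).
Proof.
move=> df.
have h1 : is_derive x (1 : R) (fun y : R => c * y + d) c.
  by apply: is_derive_eq; rewrite ?addr0 /GRing.scale /= mulr1.
have h2 : is_derive (c * x + d) (1 : R) f (derive1 f (c * x + d)).
  by apply: DeriveDef => //; rewrite derive1E.
by have := @is_derive1_comp _ f (fun y : R => c * y + d) x _ _ h2 h1; rewrite mulrC.
Qed.

Lemma diff_n_affine n c d f : diff_n n f -> diff_n n (fun x => f (c * x + d)).
Proof.
elim: n f => [//|n IH] f [df sf].
have D x := is_derive_affine (df (c * x + d)).
split; first by move=> x; have [] := D x.
have -> : derive1 (fun x => f (c * x + d)) = fun x => c * derive1 f (c * x + d).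
  by apply/funext => x; rewrite derive1E derive_val.
by apply: diff_nZ; exact: IH.
Qed.

(** Up to linear combinations, the functions [x^-k exp (- 1 / x)] extended by zero are
closed under differentiation. The one with [k = 0] is the classical smooth function
which is flat at the origin. *)
Definition flat (k : nat) (x : R) : R :=
  if 0 < x then x ^- k * expR (- x^-1) else 0.

(** The exponential of [y] is the [m]-th power of that of [y / m], which is at least
[1 + y / m]. *)
Lemma exprn_le_expR (m : nat) (y : R) : 0 <= y -> (0 < m)%N -> (y / m%:R) ^+ m <= expR y.
Proof.
move=> y0 m0.
have -> : expR y = expR (y / m%:R) ^+ m.
  by rewrite -expRM_natl mulrC divfK// pnatr_eq0 -lt0n.
apply: lerXn2r; rewrite ?nnegrE ?expR_ge0 ?divr_ge0//.
by apply: le_trans (expR_ge1Dx _); rewrite lerDr.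
Qed.

(** The exponential of [- 1 / x] beats every power of [1 / x]. A bound linear in [x] is
what the derivative at the origin needs. *)
Lemma flat_le (k : nat) : exists C, forall x, `|flat k x| <= C * `|x|.
Proof.
exists (k.+1%:R ^+ k.+1) => x; rewrite /flat; case: ltP => [x0|_]; last first.
  by rewrite normr0 mulr_ge0 ?exprn_ge0.
rewrite (ger0_norm (ltW x0)) ger0_norm ?mulr_ge0 ?expR_ge0 ?invr_ge0 ?exprn_ge0 ?(ltW x0)//.
have := @exprn_le_expR k.+1 x^-1 (ltW _) isT; rewrite invr_gt0 => /(_ x0).
rewrite expRN => h.
have e0 := expR_gt0 x^-1; have xk : 0 < x ^+ k by rewrite exprn_gt0.
have m0 : 0 < k.+1%:R ^+ k.+1 :> R by rewrite exprn_gt0.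
have -> : x ^- k / expR x^-1 = (x ^+ k * expR x^-1)^-1 by rewrite invfM.
rewrite -[leLHS]mul1r ler_pdivrMr ?mulr_gt0//.
have : (x^-1 / k.+1%:R) ^+ k.+1 * (x * x ^+ k * k.+1%:R ^+ k.+1) <=
    expR x^-1 * (x * x ^+ k * k.+1%:R ^+ k.+1).
  by rewrite ler_pM2r// !mulr_gt0.
have -> : (x^-1 / k.+1%:R) ^+ k.+1 * (x * x ^+ k * k.+1%:R ^+ k.+1) = 1.
  have : k.+1%:R != 0 :> R by rewrite pnatr_eq0.
  rewrite -exprS; move: (k.+1%:R) => m m1; rewrite -!exprMn.
  rewrite [X in X ^+ _](_ : _ = 1) ?expr1n//.
  by field; rewrite m1 gt_eqF.
by move=> h2; apply: le_trans h2 _; rewrite le_eqVlt; apply/orP; left; apply/eqP; ring.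
Qed.

(** At the origin the difference quotient of [flat k] is [flat k.+1], which tends to
zero by [flat_le]. *)
Lemma is_derive_flat k x :
  is_derive x (1 : R) (flat k) (flat k.+2 x - k%:R * flat k.+1 x).
Proof.
have [x0|x0|->] := ltgtP x 0.
- have -> : flat k.+2 x - k%:R * flat k.+1 x = 0.
    by rewrite /flat ltNge (ltW x0)/= mulr0 subr0.
  apply: (@near_eq_is_derive _ _ _ (cst 0)).
  near=> y; rewrite /flat ltNge; suff -> : y <= 0 by [].
  by near: y; apply: filterS (lt_nbhsl x0) => y; exact: ltW.
- have xn0 : x != 0 by rewrite gt_eqF.
  have D : is_derive x (1 : R) (fun y : R => y^-1 ^+ k * expR (- y^-1))
      (flat k.+2 x - k%:R * flat k.+1 x).
    have Dinv : is_derive x (1 : R) (fun y : R => y^-1) (- x ^- 2).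
      have := @is_deriveV R id x 1 1 xn0 (is_derive_id x 1).
      by rewrite /GRing.scale /= mulr1.
    have Dexp : is_derive x (1 : R) (fun y : R => expR (- y^-1)) (expR (- x^-1) * x ^- 2).
      have := @is_derive1_comp _ expR (fun y : R => - y^-1) x _ _ (is_derive_expR _) (is_deriveN Dinv).
      by rewrite opprK.
    have Dpow := @is_deriveX _ _ (fun y : R => y^-1) k x (1 : R) _ Dinv.
    have -> : (fun y : R => y^-1 ^+ k * expR (- y^-1)) =
        (fun y : R => y^-1) ^+ k * (fun y : R => expR (- y^-1)).
      by apply/funext => y; rewrite fctE exprfctE.
    apply: (is_derive_eq (is_deriveM Dpow Dexp)).
    rewrite /flat x0 /GRing.scale /= ?fctE ?exprfctE; move: (expR _) => e.
    case: k {Dpow} => [|k] /=.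
      by rewrite !exprS !expr0; field.
    rewrite !exprS exprVn; have xk0 : x ^+ k != 0 by rewrite expf_neq0.
    move: (x ^+ k) xk0 => z z0.
    rewrite expr0 !mulr1; move: (k.+1%:R) => c.
    by field; rewrite z0 xn0.
  apply: (@near_eq_is_derive _ _ _ _ _ _ _ _ _ D).
  near=> y; rewrite /flat exprVn; suff -> : 0 < y by [].
  near: y; have := @Nlt_nbhsl _ x 0; rewrite oppr_lt0 => /(_ x0).
  by apply: filterS => y; rewrite oppr_lt0.
- have lim : (fun h : R => h^-1 *: ((flat k \o shift 0) (h *: 1) - flat k 0)) h @[h --> 0^'] --> (0 : R).
    have -> : (fun h : R => h^-1 *: ((flat k \o shift 0) (h *: 1) - flat k 0)) = flat k.+1.
      apply/funext => h /=; rewrite [h *: 1]mulr1 addr0 /flat ltxx subr0 /GRing.scale /=.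
      by case: ifP => _; rewrite ?mulr0// mulrA exprS invfM.
    have [C HC] := flat_le k.+1.
    apply: cvg_within_filter; apply/cvgr0Pnorm_le => e e0.
    have C0 : 0 < `|C| + 1 by rewrite ltr_wpDl.
    near=> y; apply: le_trans (HC y) _.
    apply: (@le_trans _ _ ((`|C| + 1) * `|y|)).
      by apply: ler_wpM2r => //; apply: le_trans (ler_norm _) _; rewrite lerDl.
    rewrite -ler_pdivlMl//; near: y; exists ((`|C| + 1)^-1 * e).
      by rewrite /= mulr_gt0// invr_gt0.
    by move=> y /=; rewrite sub0r normrN => /ltW.
  apply: DeriveDef; first by apply/cvg_ex; exists 0.
  by rewrite /derive (cvg_lim _ lim)// /flat ltxx mulr0 subr0.
Unshelve. all: by end_near.
Qed.

Lemma smooth1_flat k : smooth1 (flat k).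
Proof.
move=> n; elim: n k => [//|n IH] k; split; first by move=> x; have [] := is_derive_flat k x.
have -> : derive1 (flat k) = fun x => flat k.+2 x + (- k%:R) * flat k.+1 x.
  by apply/funext => x; rewrite derive1E (derive_val (is_derive := is_derive_flat k x)) mulNr.
by apply: diff_nD => //; exact: diff_nZ.
Qed.

(** As [n] grows the two factors tend to the indicators of two half-lines, so that the
product tends to the indicator of the interval between [a] and [b]. *)
Definition plateau (a b : R) (n : nat) (x : R) : R :=
  flat 0 (n.+1%:R * x + - (n.+1%:R * a)) * flat 0 (- n.+1%:R * x + n.+1%:R * b).

Lemma plateauE a b n x :
  plateau a b n x = flat 0 (n.+1%:R * (x - a)) * flat 0 (n.+1%:R * (b - x)).
Proof. by rewrite /plateau; congr (flat _ _ * flat _ _); ring. Qed.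

Lemma smooth1_plateau a b n : smooth1 (plateau a b n).
Proof.
move=> m; apply: diff_nM; exact: diff_n_affine (smooth1_flat 0 m).
Qed.

Lemma flat_ge0_le1 x : 0 <= flat 0 x <= 1.
Proof.
rewrite /flat; case: ltP => x0; last by rewrite lexx ler01.
rewrite expr0 invr1 mul1r expR_ge0/= -[leRHS]expR0 ler_expR oppr_le0 invr_ge0.
exact: ltW.
Qed.

Lemma plateau_ge0_le1 a b n x : 0 <= plateau a b n x <= 1.
Proof.
rewrite plateauE.
have /andP[h1 h2] := flat_ge0_le1 (n.+1%:R * (x - a)).
have /andP[h3 h4] := flat_ge0_le1 (n.+1%:R * (b - x)).
by rewrite mulr_ge0//= mulr_ile1.
Qed.

Lemma plateau_outside a b n x : ~~ (a < x < b) -> plateau a b n x = 0.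
Proof.
rewrite negb_and -!leNgt plateauE /flat => h.
rewrite !pmulr_rgt0// !subr_gt0.
by move: h => /orP[h|h]; rewrite !ltNge h/= ?mulr0 ?mul0r.
Qed.

Lemma cvg_plateau a b x : a < x < b -> plateau a b n x @[n --> \oo] --> (1 : R).
Proof.
move=> /andP[ax xb].
have key t : 0 < t -> flat 0 (n.+1%:R * t) @[n --> \oo] --> (1 : R).
  move=> t0; have -> : (fun n => flat 0 (n.+1%:R * t)) = fun n => expR (- (n.+1%:R^-1 * t^-1)).
    by apply/funext => n; rewrite /flat mulr_gt0// expr0 invr1 mul1r invfM.
  have : - (n.+1%:R^-1 * t^-1) @[n --> \oo] --> - (0 * t^-1).
    by apply: cvgN; apply: cvgMr_tmp; exact: cvg_harmonic.
  rewrite mul0r oppr0 => h; rewrite -[X in _ --> X]expR0.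
  by apply: continuous_cvg; [exact: continuous_expR | exact: h].
have -> : (fun n => plateau a b n x) =
    fun n => flat 0 (n.+1%:R * (x - a)) * flat 0 (n.+1%:R * (b - x)).
  by apply/funext => n; rewrite plateauE.
rewrite -subr_gt0 in ax; rewrite -subr_gt0 in xb.
have := cvgM (key _ ax) (key _ xb); rewrite mulr1 => h. exact: h.
Qed.

Lemma smooth1_derivable f x : smooth1 f -> derivable f x 1.
Proof. by move=> /(_ 1%N)[]. Qed.

Lemma smooth1_derive1 f : smooth1 f -> smooth1 (derive1 f).
Proof. by move=> sf n; have [] := sf n.+1. Qed.

Lemma smooth1_continuous f : smooth1 f -> continuous f.
Proof.
by move=> sf x; apply: differentiable_continuous; apply/derivable1_diffP; exact: smooth1_derivable.
Qed.

End Smooth1.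

(** * The fundamental lemma of the calculus of variations *)

Section Tensor.
Context {R : realType}.
Implicit Types (f g h : R -> R) (x : R3 R).

Definition tensor f g h : R3 R -> R := fun x => f x.1.1 * g x.1.2 * h x.2.

Lemma cvg_quotient f a : derivable f a (1 : R) ->
  k^-1 *: (f (k + a) - f a) @[k --> (0 : R)^'] --> derive1 f a.
Proof.
move=> df; rewrite derive1E /derive.
have -> : (fun k : R => k^-1 *: (f (k + a) - f a)) =
    (fun k : R => k^-1 *: ((f \o shift a) (k *: 1) - f a)).
  by apply/funext => k /=; rewrite [k *: 1]mulr1.
exact: df.
Qed.

Lemma is_derive_tensor0 f g h x (i : 'I_3) : i = 0%N :> nat -> derivable f x.1.1 1 ->
  is_derive x (evec i) (tensor f g h) (tensor (derive1 f) g h x).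
Proof.
move=> i0 df.
have H : k^-1 *: ((tensor f g h \o shift x) (k *: evec i) - tensor f g h x)
    @[k --> (0 : R)^'] --> tensor (derive1 f) g h x.
  have -> : (fun k : R => k^-1 *: ((tensor f g h \o shift x) (k *: evec i) - tensor f g h x))
     = (fun k : R => (k^-1 *: (f (k + x.1.1) - f x.1.1)) * (g x.1.2 * h x.2)).
    apply/funext => k; rewrite /tensor /= /evec i0 /=.
    by rewrite [k *: 1]mulr1 [k *: 0]mulr0 !add0r /GRing.scale /=; ring.
  rewrite /tensor -mulrA; apply: cvgMr_tmp; exact: cvg_quotient.
by apply: DeriveDef; [apply/cvg_ex; eexists; exact: H | rewrite /derive (cvg_lim _ H)].
Qed.

Lemma is_derive_tensor1 f g h x (i : 'I_3) : i = 1%N :> nat -> derivable g x.1.2 1 ->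
  is_derive x (evec i) (tensor f g h) (tensor f (derive1 g) h x).
Proof.
move=> i1 dg.
have H : k^-1 *: ((tensor f g h \o shift x) (k *: evec i) - tensor f g h x)
    @[k --> (0 : R)^'] --> tensor f (derive1 g) h x.
  have -> : (fun k : R => k^-1 *: ((tensor f g h \o shift x) (k *: evec i) - tensor f g h x))
     = (fun k : R => (k^-1 *: (g (k + x.1.2) - g x.1.2)) * (f x.1.1 * h x.2)).
    apply/funext => k; rewrite /tensor /= /evec i1 /=.
    by rewrite [k *: 1]mulr1 [k *: 0]mulr0 !add0r /GRing.scale /=; ring.
  have -> : tensor f (derive1 g) h x = derive1 g x.1.2 * (f x.1.1 * h x.2).
    by rewrite /tensor; ring.
  by apply: cvgMr_tmp; exact: cvg_quotient.
by apply: DeriveDef; [apply/cvg_ex; eexists; exact: H | rewrite /derive (cvg_lim _ H)].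
Qed.

Lemma is_derive_tensor2 f g h x (i : 'I_3) : i = 2%N :> nat -> derivable h x.2 1 ->
  is_derive x (evec i) (tensor f g h) (tensor f g (derive1 h) x).
Proof.
move=> i2 dh.
have H : k^-1 *: ((tensor f g h \o shift x) (k *: evec i) - tensor f g h x)
    @[k --> (0 : R)^'] --> tensor f g (derive1 h) x.
  have -> : (fun k : R => k^-1 *: ((tensor f g h \o shift x) (k *: evec i) - tensor f g h x))
     = (fun k : R => (k^-1 *: (h (k + x.2) - h x.2)) * (f x.1.1 * g x.1.2)).
    apply/funext => k; rewrite /tensor /= /evec i2 /=.
    by rewrite [k *: 1]mulr1 [k *: 0]mulr0 !add0r /GRing.scale /=; ring.
  have -> : tensor f g (derive1 h) x = derive1 h x.2 * (f x.1.1 * g x.1.2).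
    by rewrite /tensor; ring.
  by apply: cvgMr_tmp; exact: cvg_quotient.
by apply: DeriveDef; [apply/cvg_ex; eexists; exact: H | rewrite /derive (cvg_lim _ H)].
Qed.

Lemma tensor_pderiv f g h (i : 'I_3) : smooth1 f -> smooth1 g -> smooth1 h ->
  (forall x, derivable (tensor f g h) x (evec i)) /\
  exists f' g' h', [/\ smooth1 f', smooth1 g', smooth1 h' &
    pderiv i (tensor f g h) = tensor f' g' h'].
Proof.
move=> sf sg sh; case: i => [[|[|[|//]]] hi]; set i := Ordinal hi.
- have D x := @is_derive_tensor0 f g h x i erefl (smooth1_derivable sf).
  split; first by move=> x; have [] := D x.
  exists (derive1 f), g, h; split => //; first exact: smooth1_derive1.
  by apply/funext => x; rewrite /pderiv derive_val.
- have D x := @is_derive_tensor1 f g h x i erefl (smooth1_derivable sg).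
  split; first by move=> x; have [] := D x.
  exists f, (derive1 g), h; split => //; first exact: smooth1_derive1.
  by apply/funext => x; rewrite /pderiv derive_val.
- have D x := @is_derive_tensor2 f g h x i erefl (smooth1_derivable sh).
  split; first by move=> x; have [] := D x.
  exists f, g, (derive1 h); split => //; first exact: smooth1_derive1.
  by apply/funext => x; rewrite /pderiv derive_val.
Qed.

Lemma continuous_tensor f g h : smooth1 f -> smooth1 g -> smooth1 h -> continuous (tensor f g h).
Proof.
move=> sf sg sh x.
have c11 : (fun y : R3 R => y.1.1) y @[y --> x] --> x.1.1.
  by apply: (cvg_comp fst fst); exact: cvg_fst.
have c12 : (fun y : R3 R => y.1.2) y @[y --> x] --> x.1.2.
  by apply: (cvg_comp fst snd); [exact: cvg_fst | exact: cvg_snd].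
have c2 : (fun y : R3 R => y.2) y @[y --> x] --> x.2 by exact: cvg_snd.
apply: cvgM; first apply: cvgM.
- by apply: continuous_cvg => //; exact: smooth1_continuous.
- by apply: continuous_cvg => //; exact: smooth1_continuous.
- by apply: continuous_cvg => //; exact: smooth1_continuous.
Qed.

Lemma smooth_tensor f g h : smooth1 f -> smooth1 g -> smooth1 h -> smooth (tensor f g h).
Proof.
move=> sf sg sh s.
have : exists f' g' h', [/\ smooth1 f', smooth1 g', smooth1 h' &
    foldr pderiv (tensor f g h) s = tensor f' g' h'].
  elim: s => [|i s [f' [g' [h' [sf' sg' sh' E]]]]] /=; first by exists f, g, h.
  by rewrite E; have [_] := tensor_pderiv i sf' sg' sh'.
move=> [f' [g' [h' [sf' sg' sh' ->]]]]; split; first exact: continuous_tensor.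
by move=> i; have [] := tensor_pderiv i sf' sg' sh'.
Qed.

Definition plateau3 (a b : R3 R) n : R3 R -> R :=
  tensor (plateau a.1.1 b.1.1 n) (plateau a.1.2 b.1.2 n) (plateau a.2 b.2 n).

Lemma plateau3_outside a b n x : ~ box a b x -> plateau3 a b n x = 0.
Proof.
move=> /boxP h; rewrite /plateau3 /tensor.
have [h1|h1] := boolP (a.1.1 < x.1.1 < b.1.1); last by rewrite plateau_outside// !mul0r.
have [h2|h2] := boolP (a.1.2 < x.1.2 < b.1.2).
  have [h3|h3] := boolP (a.2 < x.2 < b.2); first by case: h.
  by rewrite [X in _ * X]plateau_outside// mulr0.
by rewrite [X in _ * X * _]plateau_outside// mulr0 mul0r.
Qed.

Lemma test_plateau3 (Om : set (R3 R)) a b n : cbox a b `<=` Om -> test Om (plateau3 a b n).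
Proof.
move=> abOm; split; first by apply: smooth_tensor; exact: smooth1_plateau.
exists (cbox a b); split => //; first exact: compact_cbox.
by move=> x xab; apply: plateau3_outside; apply: contra_not xab; exact: box_sub_cbox.
Qed.

Lemma plateau3_ge0_le1 a b n x : 0 <= plateau3 a b n x <= 1.
Proof.
rewrite /plateau3 /tensor.
have /andP[h1 h2] := plateau_ge0_le1 a.1.1 b.1.1 n x.1.1.
have /andP[h3 h4] := plateau_ge0_le1 a.1.2 b.1.2 n x.1.2.
have /andP[h5 h6] := plateau_ge0_le1 a.2 b.2 n x.2.
apply/andP; split; first exact: mulr_ge0 (mulr_ge0 h1 h3) h5.
exact: mulr_ile1 (mulr_ge0 h1 h3) h5 (mulr_ile1 h1 h3 h2 h4) h6.
Qed.

Lemma cvg_plateau3 a b x : box a b x -> plateau3 a b n x @[n --> \oo] --> (1 : R).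
Proof.
move=> /boxP[h1 h2 h3].
have := cvgM (cvgM (cvg_plateau h1) (cvg_plateau h2)) (cvg_plateau h3).
by rewrite !mulr1 => h; exact: h.
Qed.

End Tensor.

Section FundamentalLemma.
Context {R : realType}.
Local Notation mR := (measurableTypeR R).
Local Notation mR3 := (mR * mR * mR)%type.
Local Notation m3 := (@lebesgue3 R).

Definition boxes : set (set mR3) := [set B | exists a b, B = box a b].

(** The boxes form a pi-system. The inclusion keeps the closed box of the intersection
inside any open set containing that of the first box. *)
Lemma boxI (a b c d : R3 R) : exists p q, box a b `&` box c d = box p q /\
  cbox p q `<=` cbox a b.
Proof.
exists (Num.max a.1.1 c.1.1, Num.max a.1.2 c.1.2, Num.max a.2 c.2).
exists (Num.min b.1.1 d.1.1, Num.min b.1.2 d.1.2, Num.min b.2 d.2).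
split; last first.
  move=> x /cboxP[] /=; rewrite !ge_max !le_min.
  by move=> /andP[/andP[? _] /andP[? _]] /andP[/andP[? _] /andP[? _]]
    /andP[/andP[? _] /andP[? _]]; apply/cboxP; split; apply/andP.
apply/seteqP; split => x.
  move=> [/boxP[/andP[? ?] /andP[? ?] /andP[? ?]] /boxP[/andP[? ?] /andP[? ?] /andP[? ?]]].
  by apply/boxP => /=; rewrite !gt_max !lt_min; split; apply/andP; split; apply/andP.
move=> /boxP[] /=; rewrite !gt_max !lt_min.
move=> /andP[/andP[? ?] /andP[? ?]] /andP[/andP[? ?] /andP[? ?]]
    /andP[/andP[? ?] /andP[? ?]].
by split; apply/boxP; split; apply/andP.
Qed.

(** The coordinates are measurable for the sigma-algebra generated by the boxes, and
they generate the product sigma-algebra. *)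
Lemma measurable_boxes : @measurable _ mR3 `<=` <<s boxes >>.
Proof.
have op (A : set (R3 R)) : open A -> <<s boxes >> A.
  move=> /open_bigcup_box[a [b [_ ->]]].
  have [_ _] := smallest_sigma_algebra [set: mR3] boxes; apply => n.
  by apply: sub_sigma_algebra; exists (a n), (b n).
have coord (p : R3 R -> R) : continuous p ->
    @measurable_fun _ _ (g_sigma_algebraType boxes) mR setT p.
  move=> cp; apply: (measurability _ (RGenOInfty.measurableE R)) => _ [_ [r ->] <-].
  rewrite setTI; apply: op.
  by apply: open_comp; [move=> + _; exact: cp | exact: rray_open].
have c11 : continuous (fun y : R3 R => y.1.1).
  by move=> x; apply: (cvg_comp fst fst); exact: cvg_fst.
have c12 : continuous (fun y : R3 R => y.1.2).
  by move=> x; apply: (cvg_comp fst snd); [exact: cvg_fst | exact: cvg_snd].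
have c2 : continuous (fun y : R3 R => y.2) by move=> x; exact: cvg_snd.
have mid : @measurable_fun _ _ (g_sigma_algebraType boxes) mR3 setT
    (fun y => ((y.1.1, y.1.2), y.2)).
  apply: measurable_fun_pair; last exact: (coord _ c2).
  by apply: measurable_fun_pair; [exact: (coord _ c11) | exact: (coord _ c12)].
move=> A mA; have := mid measurableT _ mA; rewrite setTI.
by rewrite (_ : _ @^-1` A = A)//; apply/seteqP; split => -[[]].
Qed.

(** The sets over which the integral vanishes form a Dynkin system containing the
pi-system of boxes. *)
Lemma integral_boxes_eq0 (B : set mR3) (w : mR3 -> R) : measurable B ->
  m3.-integrable B (EFin \o w) ->
  (\int[m3]_(x in B) (w x)%:E = 0)%E ->
  (forall a b, \int[m3]_(x in box a b `&` B) (w x)%:E = 0)%E ->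
  {ae m3, forall x, B x -> w x = 0}.
Proof.
move=> mB iw w0 wbox.
pose H := [set E : set mR3 | measurable E /\ (\int[m3]_(x in E `&` B) (w x)%:E = 0)%E].
have dH : dynkin H.
  split.
  - by split => //; rewrite setTI.
  - move=> E [mE E0]; split; first exact: measurableC.
    have := w0; rewrite -{1}[B](setIT) -(setUv E) setIUr.
    have sub : B `&` E `|` B `&` ~` E `<=` B by move=> x [[]|[]].
    rewrite integral_setU//.
    - by rewrite [B `&` E]setIC E0 add0e setIC.
    - exact: measurableI.
    - by apply: measurableI => //; exact: measurableC.
    - by apply: measurable_funS sub _ => //; case/integrableP : iw.
    - by apply/eqP; rewrite setIACA setICr setI0.
  - move=> F tF HF; split; first by apply: bigcup_measurable => n _; exact: (HF n).1.
    rewrite setI_bigcupl integral_bigcup//.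
    + by rewrite eseries0// => n _ _; exact: (HF n).2.
    + exact: trivIset_setIr.
    + by move=> n; apply: measurableI => //; exact: (HF n).1.
    + apply: integrableS iw => //; last by apply: bigcup_sub => n _ x [].
      by apply: bigcupT_measurable => n; apply: measurableI => //; exact: (HF n).1.
have all_meas (E : set mR3) : measurable E -> H E.
  move=> /measurable_boxes; rewrite -setI_closed_g_dynkin_g_sigma_algebra; last first.
    by move=> _ _ [a [b ->]] [c [d ->]]; have [p [q [-> _]]] := boxI a b c d; exists p, q.
  by apply: smallest_sub => // _ [a [b ->]]; split; [exact: measurable_box | exact: wbox].
have : ae_eq m3 B (EFin \o w) (cst 0%E).
  apply: integral_ae_eq => //.
  move=> E EB mE; rewrite integral0.
  by have [_] := all_meas E mE; rewrite (setIidl EB).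
by apply: filterS => x + Bx => /(_ Bx)[].
Qed.

Lemma sq_int_box_integrable (Om : set (R3 R)) (w : R3 R -> R) a b :
  @measurable _ mR3 Om -> cbox a b `<=` Om -> sq_int m3 Om w ->
  m3.-integrable (box a b) (EFin \o w).
Proof.
move=> mOm abOm [mw w2].
have bOm : box a b `<=` Om by apply: subset_trans abOm; exact: box_sub_cbox.
have mB := measurable_box a b.
have sw : sq_int m3 (box a b) w.
  split; first exact: measurable_funS bOm mw.
  apply: le_lt_trans w2; apply: ge0_subset_integral => //.
    by apply/measurable_EFinP/measurable_funX.
  by move=> x _; rewrite lee_fin sqr_ge0.
have s1 : sq_int m3 (box a b) (fun=> 1).
  split => //; rewrite integral_cst// expr1n mul1e.
  apply: le_lt_trans (lebesgue3_cbox_lty a b).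
  by apply: le_measure; rewrite ?inE//; [exact: measurable_cbox | exact: box_sub_cbox].
have := sq_int_mul mB sw s1.
by under [X in _.-integrable _ (EFin \o X)]eq_fun do rewrite mulr1.
Qed.

(** Plateau functions tend boundedly to the indicator of the box. *)
Lemma integral_box_eq0 (Om : set (R3 R)) (w : R3 R -> R) a b :
  @measurable _ mR3 Om -> cbox a b `<=` Om -> sq_int m3 Om w ->
  (forall phi, test Om phi -> \int[m3]_(x in Om) (w x * phi x) = 0) ->
  (\int[m3]_(x in box a b) (w x)%:E = 0)%E.
Proof.
move=> mOm abOm sw w0.
have iw := sq_int_box_integrable mOm abOm sw.
have mB := measurable_box a b.
have bOm : box a b `<=` Om by apply: subset_trans abOm; exact: box_sub_cbox.
pose f n x := (w x * plateau3 a b n x)%:E.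
have mw : measurable_fun (box a b : set mR3) w by exact: measurable_funS bOm sw.1.
have mf n : measurable_fun (box a b : set mR3) (f n).
  apply/measurable_EFinP/measurable_funM => //.
  apply: continuous_measurable3 => //; apply: test_continuous.
  exact: (test_plateau3 n abOm).
have [_ _ cv] : [/\ m3.-integrable (box a b) (EFin \o w),
    (\int[m3]_(x in box a b) `|f n x - (w x)%:E| @[n --> \oo] --> 0)%E &
    (\int[m3]_(x in box a b) f n x @[n --> \oo] --> \int[m3]_(x in box a b) (w x)%:E)%E].
  apply: (@dominated_convergence _ mR3 R m3 _ mB f _ (abse \o (EFin \o w))) => //.
  - exact/measurable_EFinP.
  - apply: aeW => x xab; apply: cvg_EFin; first exact: nearW.
    have : w x * plateau3 a b n x @[n --> \oo] --> w x * 1.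
      by apply: cvgMl_tmp; exact: cvg_plateau3.
    by rewrite mulr1 => h; exact: h.
  - exact: integrable_abse.
  - apply: aeW => x n _; rewrite lee_fin normrM.
    have /andP[h1 h2] := plateau3_ge0_le1 a b n x.
    by rewrite (ger0_norm h1) ler_piMr.
have f0 n : (\int[m3]_(x in box a b) f n x = 0)%E.
  have tp := test_plateau3 n abOm.
  have : \int[m3]_(x in box a b) (w x * plateau3 a b n x) = 0.
    rewrite -(w0 _ tp) [LHS]Rintegral_mkcond [RHS]Rintegral_mkcond.
    apply: eq_Rintegral => x _; rewrite !patchE.
    case: ifPn => [/set_mem/bOm xOm|]; first by rewrite mem_set.
    by rewrite notin_setE => xb; rewrite plateau3_outside// mulr0 if_same.
  have fin : (\int[m3]_(x in box a b) f n x)%E \is a fin_num.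
    apply: integrable_fin_num => //.
    apply: le_integrable iw => // x _; rewrite lee_fin normrM.
    have /andP[h1 h2] := plateau3_ge0_le1 a b n x.
    by rewrite (ger0_norm h1) ler_piMr.
  by move=> h; rewrite -(fineK fin) -[RHS]/(0%:E); congr EFin; exact: h.
move: cv; under eq_fun do rewrite f0.
by move=> cv; have := cvg_unique _ cv (cvg_cst _) => ->.
Qed.

(** A function orthogonal to the test functions has zero integral over every box inside
[Om]; hence it vanishes almost everywhere on each of the countably many boxes covering
[Om]. *)
Lemma fundamental_lemma (Om : set (R3 R)) (w : R3 R -> R) : open Om ->
  sq_int m3 Om w ->
  (forall phi, test Om phi -> \int[m3]_(x in Om) (w x * phi x) = 0) ->
  {ae m3, forall x, Om x -> w x = 0}.
Proof.
move=> oOm sw w0; have mOm := open_measurable3 oOm.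
have [a [b [abOm Omab]]] := open_bigcup_box oOm.
have : {ae m3, forall x, forall n, box (a n) (b n) x -> w x = 0}.
  apply: ae_foralln => n; apply: integral_boxes_eq0.
  - exact: measurable_box.
  - exact: sq_int_box_integrable (abOm n) sw.
  - exact: integral_box_eq0 (abOm n) sw w0.
  - move=> c d; rewrite setIC; have [p [q [-> pq]]] := boxI (a n) (b n) c d.
    by apply: integral_box_eq0 sw w0 => //; exact: subset_trans pq (abOm n).
apply: filterS; first exact: (ae_filter_ringOfSetsType m3).
by move=> x h; rewrite [X in X x -> _]Omab => -[n _]; exact: h.
Qed.

End FundamentalLemma.

(** * Symmetry of second derivatives *)

Section MixedPartials.
Context {R : realType}.
Implicit Types (phi : R3 R -> R) (x : R3 R).

Lemma smooth_continuous phi : smooth phi -> continuous phi.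
Proof. by move=> /(_ [::])[]. Qed.

Lemma smooth_derivable phi i x : smooth phi -> derivable phi x (evec i).
Proof. by move=> /(_ [::])[_]; apply. Qed.

Lemma mean_value_line phi (i : 'I_3) x (h : R) : smooth phi -> 0 < h ->
  exists2 c, 0 < c < h &
    phi (x + h *: evec i) - phi x = h * pderiv i phi (x + c *: evec i).
Proof.
move=> sphi h0.
have D t := @is_derive_line _ phi i x t (smooth_derivable sphi).
have [|c] := @MVT R (fun t => phi (x + t *: evec i)) _ 0 h h0 (fun t _ => D t).
  apply: continuous_subspaceT => t.
  by apply: continuous_comp; [exact: continuous_line | exact: smooth_continuous].
rewrite in_itv /= => c0h; rewrite scale0r addr0 subr0 mulrC => E.
by exists c.
Qed.

(** The mean value theorem along [i], applied to the increment in the direction [j],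
and then along [j], applied to the derivative. *)
Lemma mixed_difference phi (i j : 'I_3) x (h : R) : smooth phi -> 0 < h ->
  exists c d, [/\ 0 < c < h, 0 < d < h &
    phi (x + h *: evec j + h *: evec i) - phi (x + h *: evec i)
      - phi (x + h *: evec j) + phi x
    = h * h * pderiv j (pderiv i phi) (x + c *: evec i + d *: evec j)].
Proof.
move=> sphi h0.
pose g t := phi (x + h *: evec j + t *: evec i) - phi (x + t *: evec i).
have D t : is_derive t (1 : R) g (pderiv i phi (x + h *: evec j + t *: evec i)
     - pderiv i phi (x + t *: evec i)).
  by apply: is_deriveB; apply: is_derive_line; exact: smooth_derivable.
have [|c] := @MVT R g _ 0 h h0 (fun t _ => D t).
  apply: continuous_subspaceT => t; apply: cvgB.
    by apply: continuous_comp; [exact: continuous_line | exact: smooth_continuous].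
  by apply: continuous_comp; [exact: continuous_line | exact: smooth_continuous].
rewrite in_itv /= => c0h; rewrite subr0 => E.
have [d d0h E2] := mean_value_line j (x + c *: evec i) (smooth_pderiv i sphi) h0.
exists c, d; split => //.
rewrite -mulrA -E2 mulrC [x + h *: evec j + c *: _]addrAC in E *.
by rewrite -E /g !scale0r !addr0; ring.
Qed.

(** Schwarz's theorem. The mixed difference is symmetric in [i] and [j]; divided by
[h * h] it is a value, near [x], of either mixed derivative. *)
Lemma pderiv_comm phi (i j : 'I_3) : smooth phi ->
  pderiv i (pderiv j phi) = pderiv j (pderiv i phi).
Proof.
move=> sphi; apply/funext => x; apply/eqP; rewrite -subr_eq0 -normr_eq0.
rewrite eq_le normr_ge0 andbT; apply/ler_addgt0Pr => e e0; rewrite add0r.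
have near_c k l : \forall y \near x, `|pderiv k (pderiv l phi) x - pderiv k (pderiv l phi) y| < e / 2.
  have c : continuous (pderiv k (pderiv l phi)).
    by apply: smooth_continuous; do 2 apply: smooth_pderiv.
  by have /cvgrPdist_lt := c x; apply; rewrite divr_gt0.
have [r /= r0 rP] : nbhs_ball x (fun y =>
    `|pderiv i (pderiv j phi) x - pderiv i (pderiv j phi) y| < e / 2 /\
    `|pderiv j (pderiv i phi) x - pderiv j (pderiv i phi) y| < e / 2).
  apply/nbhs_ballP; exact: filterI (near_c i j) (near_c j i).
pose h := r / 3.
have h0 : 0 < h by rewrite divr_gt0.
have close k l c d : 0 < c < h -> 0 < d < h -> ball x r (x + c *: evec k + d *: evec l).
  move=> c0h d0h; rewrite -ball_normE /ball_ /=.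
  rewrite opprD opprD !addrA subrr sub0r -opprD normrN.
  have ev m : `|evec m : R3 R| <= 1.
    have -> : `|evec m : R3 R| = Num.max (Num.max `|(evec m : R3 R).1.1| `|(evec m : R3 R).1.2|) `|(evec m : R3 R).2| by [].
    by rewrite !ge_max !normr_nat !lern1 !leq_b1.
  apply: le_lt_trans (ler_normD _ _) _; rewrite !normrZ.
  have n1 : `|c| * `|evec k : R3 R| <= h.
    by rewrite -[h]mulr1 ler_pM// ger0_norm; lra.
  have n2 : `|d| * `|evec l : R3 R| <= h.
    by rewrite -[h]mulr1 ler_pM// ger0_norm; lra.
  by have : r = 3 * h; [rewrite /h; field | lra].
have [c [d [c0 d0 E1]]] := mixed_difference i j x sphi h0.
have [c' [d' [c0' d0' E2]]] := mixed_difference j i x sphi h0.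
have E : pderiv j (pderiv i phi) (x + c *: evec i + d *: evec j) =
         pderiv i (pderiv j phi) (x + c' *: evec j + d' *: evec i).
  have hh : h * h != 0 by rewrite mulf_neq0 ?gt_eqF.
  apply: (@mulfI _ (h * h) hh); apply: etrans (esym E1) _; apply: etrans E2.
  rewrite [X in phi X - _ - _](addrAC x (h *: evec j) (h *: evec i)).
  by rewrite [X in X + _ = _]addrAC.
have [h1 _] := rP _ (close j i _ _ c0' d0').
have [_ h2] := rP _ (close i j _ _ c0 d0).
rewrite -E in h1; move: h1 h2.
move: (pderiv i _ x) (pderiv j _ x) (pderiv j _ _) => A B C {E1 E2 E rP close near_c}.
by rewrite !ltr_norml ler_norml => /andP[? ?] /andP[? ?]; apply/andP; split; lra.
Qed.

End MixedPartials.

(** * Density of the test functions *)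

Section RealPairing.
Context {R : realType} (Om : set (R3 R)).
Hypothesis oOm : open Om.
Local Notation mR := (measurableTypeR R).
Local Notation mR3 := (mR * mR * mR)%type.
Local Notation sq := (sq_int (@lebesgue3 R) Om).
Local Notation ip := (dot (@lebesgue3 R) Om).
Implicit Types (a b c : R3 R -> R).

Let mOm : @measurable _ mR3 Om. Proof. exact: open_measurable3. Qed.

Lemma test_sq_int phi : test Om phi -> sq phi.
Proof.
move=> tphi; have cphi := test_continuous tphi.
split; first exact: continuous_measurable3.
have := Cc_integrable (CcM (test_Cc tphi) cphi) => /integrableP[_].
apply: le_lt_trans; rewrite integral_mkcond; apply: ge0_le_integral => //.
- by move=> x _; rewrite patchE; case: ifP => // _; rewrite lee_fin sqr_ge0.
- apply/(measurable_restrictT _ _).1 => //.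
  by apply/measurable_EFinP/measurable_funX; exact: continuous_measurable3.
- apply: measurableT_comp => //; apply/measurable_EFinP.
  by apply: measurable_funM; exact: continuous_measurable3.
- move=> x _; rewrite patchE; case: ifP => _; last exact: abse_ge0.
  by rewrite /= lee_fin -expr2 ger0_norm ?sqr_ge0.
Qed.

Lemma dot_ae_eq0 a b : sq a -> sq b ->
  {ae @lebesgue3 R, forall x, Om x -> a x = 0} -> ip a b = 0.
Proof.
move=> sa sb a0; rewrite /dot /Rintegral.
rewrite (@ae_eq_integral _ mR3 R (@lebesgue3 R) Om (cst 0%E)) ?integral0//.
- by apply/measurable_EFinP/measurable_funM; [exact: sa.1 | exact: sb.1].
- apply: filterS a0; first exact: (ae_filter_ringOfSetsType (@lebesgue3 R)).
  by move=> x ax Omx; rewrite /= ax// mul0r.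
Qed.

(** Density of the test functions, in the form of a trivial orthogonal complement. *)
Lemma dot_test_eq0 a b : sq a -> sq b ->
  (forall phi, test Om phi -> ip a phi = 0) -> ip a b = 0.
Proof. by move=> sa sb a0; apply: dot_ae_eq0 => //; exact: fundamental_lemma. Qed.

Lemma dotDl a b c : sq a -> sq b -> sq c -> ip (fun x => a x + b x) c = ip a c + ip b c.
Proof.
move=> sa sb sc; rewrite -[ip a c]mul1r -(dot_lin mOm)//.
by congr dot; apply/funext => x; rewrite mul1r.
Qed.

Lemma dotZl k a c : sq a -> sq c -> ip (fun x => k * a x) c = k * ip a c.
Proof.
move=> sa sc; have := dot_lin mOm k sa (sq_int0 _ _) sc.
under [X in dot _ _ X]eq_fun do rewrite addr0.
move=> ->; rewrite [X in _ + X](_ : _ = 0) ?addr0//.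
by rewrite /dot; under eq_Rintegral do rewrite mul0r; rewrite /Rintegral integral0.
Qed.

Lemma dotNl a c : sq a -> sq c -> ip (fun x => - a x) c = - ip a c.
Proof.
move=> sa sc; rewrite -mulN1r -dotZl//.
by congr dot; apply/funext => x; rewrite mulN1r.
Qed.

Lemma dotBl a b c : sq a -> sq b -> sq c -> ip (fun x => a x - b x) c = ip a c - ip b c.
Proof.
move=> sa sb sc; rewrite dotDl// ?dotNl//.
by have := sq_int_sub mOm (sq_int0 _ _) sb; congr sq_int; apply/funext => x; rewrite sub0r.
Qed.

End RealPairing.

(** * The inner product of complex-valued functions *)

Section ComplexPairing.
Context {R : realType} (Om : set (R3 R)).
Hypothesis oOm : open Om.
Local Notation C := R[i].
Local Notation mR := (measurableTypeR R).
Local Notation mR3 := (mR * mR * mR)%type.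
Local Notation sq := (sq_int (@lebesgue3 R) Om).
Local Notation ip := (dot (@lebesgue3 R) Om).
Local Notation re := (@complex.Re R).
Local Notation im := (@complex.Im R).
Implicit Types (w z : R3 R -> C) (a b phi : R3 R -> R).

Let mOm : @measurable _ mR3 Om. Proof. exact: open_measurable3. Qed.

Definition sqC w := sq (re \o w) /\ sq (im \o w).

Definition ofR a : R3 R -> C := fun x => (a x)%:C%C.

(** Separates integrability, which concerns the real and imaginary parts, from the
condition that the values lie in [F]. *)
Lemma L2P (F : set C) w : L2 F Om w <-> sqC w /\ forall x, Om x -> F (w x).
Proof.
have mX (f : R3 R -> R) : @measurable_fun _ _ mR3 mR Om f ->
    @measurable_fun _ _ mR3 _ Om (fun x => (f x ^+ 2)%:E).
  by move=> mf; apply/measurable_EFinP/measurable_funX.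
split.
  move=> [mr mi s2 wF]; split => //.
  have ms : @measurable_fun _ _ mR3 _ Om (fun x => (sqmod (w x))%:E).
    by apply/measurable_EFinP; apply: measurable_funD; apply: measurable_funX.
  split; split => //; apply: le_lt_trans s2; apply: ge0_le_integral => //.
  - by move=> x _; rewrite lee_fin sqr_ge0.
  - exact: mX.
  - by move=> x _; rewrite lee_fin lerDl sqr_ge0.
  - by move=> x _; rewrite lee_fin sqr_ge0.
  - exact: mX.
  - by move=> x _; rewrite lee_fin lerDr sqr_ge0.
move=> [[[mr r2] [mi i2]] wF]; split => //.
under eq_integral do rewrite /sqmod EFinD.
rewrite ge0_integralD//; first exact: lte_add_pinfty.
- by move=> x _; rewrite lee_fin sqr_ge0.
- exact: mX.
- by move=> x _; rewrite lee_fin sqr_ge0.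
- exact: mX.
Qed.

Lemma innerE w z : sqC w -> sqC z -> inner Om w z =
  ((ip (re \o w) (re \o z) + ip (im \o w) (im \o z))
   +i* (ip (im \o w) (re \o z) - ip (re \o w) (im \o z)))%C.
Proof.
move=> [wr wi] [zr zi]; rewrite /inner /Cint; congr (_ +i* _)%C.
  rewrite /dot -RintegralD//; [|exact: sq_int_mul|exact: sq_int_mul].
  apply: eq_Rintegral => x _ /=; case: (w x) => a b; case: (z x) => c d /=; ring.
rewrite /dot -RintegralB//; [|exact: sq_int_mul|exact: sq_int_mul].
apply: eq_Rintegral => x _ /=; case: (w x) => a b; case: (z x) => c d /=; ring.
Qed.

Lemma distr_ofE w phi : distr_of Om w phi = (ip (re \o w) phi +i* ip (im \o w) phi)%C.
Proof.
rewrite /distr_of /Cint; congr (_ +i* _)%C.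
  apply: eq_Rintegral => x _ /=; case: (w x) => a b /=; ring.
apply: eq_Rintegral => x _ /=; case: (w x) => a b /=; ring.
Qed.

Lemma inner_ofR w phi : inner Om w (ofR phi) = distr_of Om w phi.
Proof.
rewrite /inner /distr_of /Cint; congr (_ +i* _)%C.
  by apply: eq_Rintegral => x _ /=; rewrite /ofR /= oppr0.
by apply: eq_Rintegral => x _ /=; rewrite /ofR /= oppr0.
Qed.

Lemma inner_conj w z : sqC w -> sqC z -> inner Om w z = conjc (inner Om z w).
Proof.
move=> sw sz; rewrite !innerE//=; congr (_ +i* _)%C.
  by rewrite (dotC (@lebesgue3 R) Om (re \o w)) (dotC (@lebesgue3 R) Om (im \o w)).
by rewrite opprB (dotC (@lebesgue3 R) Om (im \o w)) (dotC (@lebesgue3 R) Om (re \o w)).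
Qed.

Lemma sqCD w z : sqC w -> sqC z -> sqC (fun x => w x + z x).
Proof.
move=> [wr wi] [zr zi]; split.
  have := sq_int_lin mOm 1 wr zr; congr sq_int; apply/funext => x /=.
  by rewrite mul1r; case: (w x); case: (z x).
have := sq_int_lin mOm 1 wi zi; congr sq_int; apply/funext => x /=.
by rewrite mul1r; case: (w x); case: (z x).
Qed.

Lemma sqCZ (c : R) w : sqC w -> sqC (fun x => c%:C%C * w x).
Proof.
move=> [wr wi]; split.
  have := sq_int_lin mOm c wr (sq_int0 _ _); congr sq_int; apply/funext => x /=.
  by case: (w x) => a b /=; ring.
have := sq_int_lin mOm c wi (sq_int0 _ _); congr sq_int; apply/funext => x /=.
by case: (w x) => a b /=; ring.
Qed.

Lemma sqCN w : sqC w -> sqC (fun x => - w x).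
Proof.
move=> /(sqCZ (-1)); congr sqC; apply/funext => x.
by case: (w x) => a b; apply/eqP; rewrite eq_complex /=; apply/andP; split; apply/eqP; ring.
Qed.

Lemma sqCB w z : sqC w -> sqC z -> sqC (fun x => w x - z x).
Proof. by move=> sw sz; apply: sqCD => //; exact: sqCN. Qed.

Lemma sqC_ofR a : sq a -> sqC (ofR a).
Proof. by move=> sa; split => //; exact: sq_int0. Qed.

Lemma innerDl w1 w2 z : sqC w1 -> sqC w2 -> sqC z ->
  inner Om (fun x => w1 x + w2 x) z = inner Om w1 z + inner Om w2 z.
Proof.
move=> s1 s2 sz; rewrite !innerE//; last exact: sqCD.
have -> : re \o (fun x => w1 x + w2 x) = fun x => (re \o w1) x + (re \o w2) x.
  by apply/funext => x /=; case: (w1 x); case: (w2 x).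
have -> : im \o (fun x => w1 x + w2 x) = fun x => (im \o w1) x + (im \o w2) x.
  by apply/funext => x /=; case: (w1 x); case: (w2 x).
case: s1 s2 sz => [r1 i1] [r2 i2] [rz iz]; rewrite !dotDl//.
by apply/eqP; rewrite eq_complex /=; apply/andP; split; apply/eqP; ring.
Qed.

Lemma innerZl (c : R) w z : sqC w -> sqC z ->
  inner Om (fun x => c%:C%C * w x) z = c%:C%C * inner Om w z.
Proof.
move=> sw sz; rewrite !innerE//; last exact: sqCZ.
have -> : re \o (fun x => c%:C%C * w x) = fun x => c * (re \o w) x.
  by apply/funext => x /=; case: (w x) => a b /=; ring.
have -> : im \o (fun x => c%:C%C * w x) = fun x => c * (im \o w) x.
  by apply/funext => x /=; case: (w x) => a b /=; ring.
case: sw sz => [rw iw] [rz iz]; rewrite !dotZl//.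
by apply/eqP; rewrite eq_complex /=; apply/andP; split; apply/eqP; ring.
Qed.

Lemma innerNl w z : sqC w -> sqC z -> inner Om (fun x => - w x) z = - inner Om w z.
Proof.
move=> sw sz; have := innerZl (-1) sw sz.
have e (y : C) : (-1)%:C%C * y = - y.
  by case: y => a b; apply/eqP; rewrite eq_complex /=; apply/andP; split; apply/eqP; ring.
by rewrite e => <-; congr inner; apply/funext => x; rewrite e.
Qed.

Lemma innerBl w1 w2 z : sqC w1 -> sqC w2 -> sqC z ->
  inner Om (fun x => w1 x - w2 x) z = inner Om w1 z - inner Om w2 z.
Proof. by move=> s1 s2 sz; rewrite innerDl ?innerNl//; exact: sqCN. Qed.

(** Real test functions suffice, since the pairing with them determines the real and
the imaginary part separately. *)
Lemma inner_eq0l w z : sqC w -> sqC z -> (forall phi, test Om phi -> distr_of Om w phi = 0) ->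
  inner Om w z = 0.
Proof.
move=> [wr wi] [zr zi] w0; rewrite innerE//.
have r0 phi : test Om phi -> ip (re \o w) phi = 0.
  by move=> /w0; rewrite distr_ofE => /eqP; rewrite eq_complex => /andP[/eqP].
have i0 phi : test Om phi -> ip (im \o w) phi = 0.
  by move=> /w0; rewrite distr_ofE => /eqP; rewrite eq_complex => /andP[_ /eqP].
by rewrite !(dot_test_eq0 oOm wr _ r0)// !(dot_test_eq0 oOm wi _ i0)// addr0 subr0.
Qed.

Lemma inner_congl w1 w2 z : sqC w1 -> sqC w2 -> sqC z ->
  eqD Om (distr_of Om w1) (distr_of Om w2) -> inner Om w1 z = inner Om w2 z.
Proof.
move=> s1 s2 sz E; apply/eqP; rewrite -subr_eq0 -innerBl//; apply/eqP.
apply: inner_eq0l => // [|phi tphi]; first exact: sqCB.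
have tz : sqC (ofR phi) by apply: sqC_ofR; exact: test_sq_int.
by rewrite -inner_ofR innerBl// !inner_ofR E// subrr.
Qed.

Lemma inner_congr w z1 z2 : sqC w -> sqC z1 -> sqC z2 ->
  eqD Om (distr_of Om z1) (distr_of Om z2) -> inner Om w z1 = inner Om w z2.
Proof.
by move=> sw s1 s2 E; rewrite inner_conj// [RHS]inner_conj// (inner_congl s1 s2).
Qed.

(** Carries statements on real fields over to complex ones. *)
Lemma inner_split w z : sqC w -> sqC z ->
  inner Om w z = inner Om (ofR (re \o w)) z + 'i%C * inner Om (ofR (im \o w)) z.
Proof.
move=> sw sz; have [rw iw] := sw; rewrite !innerE//; [|exact: sqC_ofR|exact: sqC_ofR].
have zero c : ip (im \o ofR (re \o w)) c = 0 /\ ip (im \o ofR (im \o w)) c = 0.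
  by split; rewrite /dot /=; under eq_Rintegral do rewrite mul0r;
     rewrite /Rintegral integral0.
rewrite !(zero _).1 ?(zero _).2.
by apply/eqP; rewrite eq_complex /=; apply/andP; split; apply/eqP; ring.
Qed.

End ComplexPairing.

(** * The closure of the test functions in the first Sobolev space *)

Section TestSpace.
Context {R : realType} (Om : set (R3 R)).
Implicit Types phi psi : R3 R -> R.

Lemma pderiv_lin (k : R) phi psi i : smooth phi -> smooth psi ->
  pderiv i (fun x => k * phi x + psi x) = fun x => k * pderiv i phi x + pderiv i psi x.
Proof.
move=> sphi spsi; apply/funext => x; rewrite /pderiv deriveD; last 2 first.
- by apply: derivableZ; exact: smooth_derivable.
- exact: smooth_derivable.
by rewrite deriveZ//; exact: smooth_derivable.
Qed.

Lemma smooth_lin (k : R) phi psi : smooth phi -> smooth psi ->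
  smooth (fun x => k * phi x + psi x).
Proof.
move=> sphi spsi s.
have foldr_smooth (chi : R3 R -> R) t : smooth chi -> smooth (foldr pderiv chi t).
  by move=> schi; elim: t => [//|i t IH] /=; exact: smooth_pderiv.
have -> : foldr pderiv (fun x => k * phi x + psi x) s =
    fun x => k * foldr pderiv phi s x + foldr pderiv psi s x.
  elim: s => [//|i s /= ->].
  exact: pderiv_lin (foldr_smooth _ _ sphi) (foldr_smooth _ _ spsi).
split; last first.
  move=> i x.
  have d1 : derivable (foldr pderiv phi s) x (evec i) := smooth_derivable (foldr_smooth _ s sphi).
  have d2 : derivable (foldr pderiv psi s) x (evec i) := smooth_derivable (foldr_smooth _ s spsi).
  exact: derivableD (derivableZ d1) d2.
move=> x; apply: cvgD; last exact: smooth_continuous (foldr_smooth _ _ spsi) x.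
apply: cvgMl_tmp; exact: smooth_continuous (foldr_smooth _ _ sphi) x.
Qed.

Lemma test_lin (k : R) phi psi : test Om phi -> test Om psi ->
  test Om (fun x => k * phi x + psi x).
Proof.
move=> [sphi [K [cK KOm K0]]] [spsi [L [cL LOm L0]]]; split; first exact: smooth_lin.
exists (K `|` L); split; first exact: compactU.
  by move=> x [/KOm|/LOm].
by move=> x /not_orP[/K0 -> /L0 ->]; rewrite mulr0 addr0.
Qed.

Lemma test0 : test Om (fun=> 0 : R).
Proof.
split; last by exists set0; split => //; exact: compact0.
move=> s; have -> : foldr pderiv (fun=> 0 : R) s = (fun=> 0).
  by elim: s => [//|i s /= ->]; apply/funext => x; rewrite /pderiv derive_cst.
by split; [move=> x; exact: cvg_cst | move=> i x; exact: derivable_cst].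
Qed.

End TestSpace.

Section VectorFields.
Context {R : realType} (Om : set (R3 R)).
Hypothesis oOm : open Om.
Local Notation mR := (measurableTypeR R).
Local Notation mR3 := (mR * mR * mR)%type.
Local Notation sq := (sq_int (@lebesgue3 R) Om).
Local Notation ip := (dot (@lebesgue3 R) Om).
Implicit Types (a b c : R3 R -> R).

Let mOm : @measurable _ mR3 Om. Proof. exact: open_measurable3. Qed.

Let ipC a b : ip a b = ip b a. Proof. exact: dotC. Qed.

Lemma dot_cauchy_schwarz a b : sq a -> sq b -> ip a b ^+ 2 <= ip a a * ip b b.
Proof.
apply: (@cauchy_schwarz_form R (R3 R -> R^o) [set f | sq f] ip) => /=.
- by move=> k f g; exact: sq_int_lin.
- by move=> f g; exact: dotC.
- by move=> k f g h; exact: dot_lin.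
- by move=> f; exact: dot_ge0.
Qed.

Lemma cvg_sum_ord n (f : 'I_n -> nat -> R) (l : 'I_n -> R) :
  (forall k, f k m @[m --> \oo] --> l k) ->
  \sum_k f k m @[m --> \oo] --> \sum_k l k.
Proof.
move=> fl; have -> : (fun m => \sum_k f k m) = \sum_k f k.
  by apply/funext => m; rewrite fct_sumE.
elim/big_ind2: _ => [|f1 l1 f2 l2 h1 h2|k _]; [exact: cvg_cst | exact: cvgD | exact: fl].
Qed.

Lemma sqr_cvg0 (t : nat -> R) : t n ^+ 2 @[n --> \oo] --> (0 : R) -> t n @[n --> \oo] --> (0 : R).
Proof.
move=> /cvgr0Pnorm_lt t0; apply/cvgr0Pnorm_lt => e e0.
have := t0 (e ^+ 2) (exprn_gt0 _ e0); apply: filterS => n.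
rewrite ger0_norm ?sqr_ge0// -real_normK ?num_real//.
by rewrite ltr_pXn2r// nnegrE ltW.
Qed.

Definition cvgL2 (s : nat -> R3 R -> R) a : Prop :=
  ip (fun x => s n x - a x) (fun x => s n x - a x) @[n --> \oo] --> (0 : R).

(** By the Cauchy-Schwarz inequality, convergence in mean square is weak convergence
too. *)
Lemma cvgL2_dot (s : nat -> R3 R -> R) a c : (forall n, sq (s n)) -> sq a -> sq c ->
  cvgL2 s a -> ip (s n) c @[n --> \oo] --> ip a c.
Proof.
move=> ss sa sc sl.
apply: cvg_zero; rewrite -[X in X @ _ --> _]/(fun n => ip (s n) c - ip a c).
have B : ip (fun x => s n x - a x) (fun x => s n x - a x) * ip c c @[n --> \oo] --> (0 : R).
  by rewrite -[X in _ --> X](mul0r (ip c c)); apply: cvgMr_tmp.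
apply: sqr_cvg0; apply: (squeeze_cvgr _ (cvg_cst 0) B).
apply: nearW => n; rewrite sqr_ge0/= -dotBl//.
by apply: dot_cauchy_schwarz => //; exact: sq_int_sub.
Qed.

(** A function together with a vector field. The pair of [phi] and its gradient turns the
[H^1] inner product into the [L^2] one of four components. *)
Definition field4 a (A : 'I_3 -> R3 R -> R) : 'I_4 -> R3 R -> R^o :=
  fun k => if unlift ord0 k is Some i then A i else a.

Definition sq4 (x : 'I_4 -> R3 R -> R^o) := forall k, sq (x k).
Definition dot4 (x y : 'I_4 -> R3 R -> R^o) : R := \sum_k ip (x k) (y k).
Definition grad4 (x : 'I_4 -> R3 R -> R^o) : Prop :=
  exists2 phi, test Om phi & x = field4 phi (fun i => pderiv i phi).

Lemma field40 a A : field4 a A ord0 = a.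
Proof. by rewrite /field4 unlift_none. Qed.

Lemma field4S a A i : field4 a A (lift ord0 i) = A i.
Proof. by rewrite /field4 liftK. Qed.

Lemma dot4E a A y : dot4 (field4 a A) y = ip a (y ord0) + \sum_i ip (A i) (y (lift ord0 i)).
Proof.
rewrite /dot4 big_ord_recl field40; congr (_ + _).
by apply: eq_bigr => i _; rewrite field4S.
Qed.

Lemma dot4Er a A y : dot4 y (field4 a A) = ip (y ord0) a + \sum_i ip (y (lift ord0 i)) (A i).
Proof.
rewrite /dot4 big_ord_recl field40; congr (_ + _).
by apply: eq_bigr => i _; rewrite field4S.
Qed.

Lemma dot4_lin k x y z : sq4 x -> sq4 y -> sq4 z ->
  dot4 (k *: x + y) z = k * dot4 x z + dot4 y z.
Proof.
move=> sx sy sz; rewrite /dot4 mulr_sumr -big_split; apply: eq_bigr => i _ /=.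
exact: dot_lin.
Qed.

Lemma sq4_lin k x y : sq4 x -> sq4 y -> sq4 (k *: x + y).
Proof. by move=> sx sy i; exact: sq_int_lin. Qed.

Lemma dot4C x y : dot4 x y = dot4 y x.
Proof. by apply: eq_bigr => i _; exact: dotC. Qed.

Lemma dot4_ge0 x : 0 <= dot4 x x.
Proof. by apply: sumr_ge0 => i _; exact: dot_ge0. Qed.

Lemma dot_le_dot4 x k : ip (x k) (x k) <= dot4 x x.
Proof.
rewrite /dot4 (bigD1 k)//= lerDl; apply: sumr_ge0 => i _; exact: dot_ge0.
Qed.

Lemma dot4_complete (s : nat -> 'I_4 -> R3 R -> R^o) : (forall n, sq4 (s n)) ->
  (forall e : R, 0 < e -> exists N, forall m n, (N <= m)%N -> (N <= n)%N ->
     dot4 (s m - s n) (s m - s n) <= e) ->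
  exists2 l, sq4 l & dot4 (s n - l) (s n - l) @[n --> \oo] --> (0 : R).
Proof.
move=> ss sc.
have /choice[l lP] : forall k, exists l, sq l /\ cvgL2 (fun n => s n k) l.
  move=> k; have [||l sl cl] := @sq_int_complete _ mR3 R (@lebesgue3 R) Om mOm (fun n => s n k).
  - by move=> n; exact: ss.
  - move=> e /sc[N NP]; exists N => m n Nm Nn.
    by apply: le_trans (NP m n Nm Nn); exact: (dot_le_dot4 (s m - s n) k).
  by exists l.
exists l; first by move=> k; exact: (lP k).1.
have := @cvg_sum_ord 4 _ (fun=> 0) (fun k => (lP k).2).
by rewrite big1// => h; exact: h.
Qed.

Lemma grad4_lin k x y : grad4 x -> grad4 y -> grad4 (k *: x + y).
Proof.
move=> [phi tphi ->] [psi tpsi ->]; exists (fun x => k * phi x + psi x).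
  exact: test_lin.
apply/funext => j; rewrite /field4 /= [(_ + _) j]/(_ j + _ j) [(k *: _) j]/(k *: _ j).
case: unliftP => [i _|_]; last by [].
by rewrite pderiv_lin//; [case: tphi|case: tpsi].
Qed.

Lemma grad4_sq4 : grad4 `<=` sq4.
Proof.
move=> _ [phi tphi ->] k; rewrite /field4; case: unlift => [i|]; last exact: test_sq_int.
by apply: test_sq_int => //; exact: test_pderiv.
Qed.

Lemma grad4_projection x : sq4 x -> exists p,
  [/\ sq4 p, exists2 s : nat -> _, (forall n, grad4 (s n)) &
        dot4 (s n - p) (s n - p) @[n --> \oo] --> (0 : R) &
      forall y, grad4 y -> dot4 (x - p) y = 0].
Proof.
apply: (@hilbert_projection R _ sq4 grad4 dot4).
- exact: sq4_lin.
- exact: grad4_lin.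
- exact: grad4_sq4.
- exists (fun=> 0); first exact: test0.
  apply/funext => k; rewrite /field4; case: unlift => [i|]//.
  by apply/funext => t; rewrite /pderiv derive_cst.
- exact: dot4C.
- exact: dot4_lin.
- exact: dot4_ge0.
- exact: dot4_complete.
Qed.

Lemma dot4_orth_limit z q (s : nat -> 'I_4 -> R3 R -> R^o) : sq4 z -> sq4 q ->
  (forall n, grad4 (s n)) -> dot4 (s n - q) (s n - q) @[n --> \oo] --> (0 : R) ->
  (forall y, grad4 y -> dot4 z y = 0) -> dot4 z q = 0.
Proof.
move=> sz sq_q gs sl zy.
have ss n : sq4 (s n) := grad4_sq4 (gs n).
have cv : dot4 (s n) z @[n --> \oo] --> dot4 q z.
  apply: cvg_sum_ord => k; apply: cvgL2_dot => //; first by move=> n; exact: ss.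
  apply: (squeeze_cvgr _ (cvg_cst 0) sl); apply: nearW => n.
  by rewrite dot_ge0; exact: (dot_le_dot4 (s n - q) k).
have s0 : (fun n => dot4 (s n) z) = fun=> 0 by apply/funext => n; rewrite dot4C zy.
by rewrite dot4C; apply/esym; apply: cvg_unique cv; rewrite // s0; exact: cvg_cst.
Qed.

Lemma dot4Bl x y z : sq4 x -> sq4 y -> sq4 z -> dot4 (x - y) z = dot4 x z - dot4 y z.
Proof.
move=> sx sy sz; rewrite -scaleN1r addrC dot4_lin// mulN1r addrC//.
Qed.

Lemma sq4_field a A : sq a -> (forall i, sq (A i)) -> sq4 (field4 a A).
Proof. by move=> sa sA k; rewrite /field4; case: unlift => [i|]. Qed.

Lemma cvgL2_component (s : nat -> 'I_4 -> R3 R -> R^o) q k :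
  dot4 (s n - q) (s n - q) @[n --> \oo] --> (0 : R) -> cvgL2 (fun n => s n k) (q k).
Proof.
move=> sl; apply: (squeeze_cvgr _ (cvg_cst 0) sl); apply: nearW => n.
by rewrite dot_ge0; exact: (dot_le_dot4 (s n - q) k).
Qed.

(** Limits in mean square are unique only up to functions of zero norm. *)
Lemma cvgL2_shift (s : nat -> R3 R -> R) a b : (forall n, sq (s n)) -> sq a -> sq b ->
  ip (fun x => a x - b x) (fun x => a x - b x) = 0 -> cvgL2 s a -> cvgL2 s b.
Proof.
move=> ss sa sb ab sl.
have sl2 : 2 * ip (fun x => s n x - a x) (fun x => s n x - a x) @[n --> \oo] --> (0 : R).
  by rewrite -[X in _ --> X](mulr0 (2 : R)); apply: cvgMl_tmp.
apply: (squeeze_cvgr _ (cvg_cst 0) sl2); apply: nearW => n; rewrite dot_ge0/=.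
set e := fun x => s n x - a x; set d := fun x => a x - b x.
have se : sq e by exact: sq_int_sub.
have sd : sq d by exact: sq_int_sub.
have -> : (fun x => s n x - b x) = fun x => 1 * e x + d x.
  by apply/funext => x; rewrite /e /d; ring.
have sed : sq (fun x => 1 * e x + d x) by exact: sq_int_lin.
have := dot_cauchy_schwarz se sd; rewrite ab mulr0 => h.
have ed0 : ip e d = 0 by apply/eqP; rewrite -sqrf_eq0 eq_le h sqr_ge0.
rewrite (dot_lin mOm)// ![ip _ (fun x => 1 * _ + _)]ipC !(dot_lin mOm)//.
rewrite (ipC d e) ed0 ab; have := dot_ge0 (@lebesgue3 R) Om e; lra.
Qed.

(** A natural boundary condition characterises the closure [H^1_0] of the test functions.
Let [p] be the projection of [(a, A)] onto the closure of the pairs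
[(phi, grad phi)], let [r] be the function component of [(a, A) - p], and let [q] be
the projection of [(r, 0)]. The orthogonality of [(r, 0) - q] to the test functions
says that the vector part [W] of [q] has divergence [w], the function part of [q] minus
[r], so the hypothesis applies and reads [<(a, A), q> = <a, r>]. On the other hand
[<(a, A), q> = <p, q> = <p, (r, 0)>], since both residuals are orthogonal to the
closure. The difference of the two identities is [<r, r> = 0], and once the functions
agree so do their gradients. *)
Lemma closure_of_gradients a (A : 'I_3 -> R3 R -> R) : sq a -> (forall i, sq (A i)) ->
  (forall i phi, test Om phi -> ip (A i) phi = - ip a (pderiv i phi)) ->
  (forall w W, sq w -> (forall i, sq (W i)) ->
     (exists2 phi : nat -> R3 R -> R, forall n, test Om (phi n) &
        forall i, cvgL2 (fun n => pderiv i (phi n)) (W i)) ->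
     (forall phi, test Om phi -> \sum_i ip (W i) (pderiv i phi) = - ip w phi) ->
     ip a w + \sum_i ip (A i) (W i) = 0) ->
  exists phi : nat -> R3 R -> R, [/\ forall n, test Om (phi n), cvgL2 phi a &
    forall i, cvgL2 (fun n => pderiv i (phi n)) (A i)].
Proof.
move=> sa sA grad_a natural.
have tsq i phi : test Om phi -> sq (pderiv i phi).
  by move=> tphi; apply: test_sq_int => //; exact: test_pderiv.
set x := field4 a A; have sx : sq4 x by exact: sq4_field.
have [p [sp [s gs sl] px]] := grad4_projection sx.
pose r := fun t => a t - p ord0 t.
have sr : sq r by exact: sq_int_sub.
set y := field4 r (fun=> fun=> 0).
have sy : sq4 y by apply: sq4_field => // i; exact: sq_int0.
have [q [sq_q [t gt tl] qy]] := grad4_projection sy.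
have sxp : sq4 (x - p) by move=> k; exact: sq_int_sub.
have syq : sq4 (y - q) by move=> k; exact: sq_int_sub.
have zero4 c : ip (fun=> 0) c = 0.
  by rewrite /dot; under eq_Rintegral do rewrite mul0r; rewrite /Rintegral integral0.
(* the hypothesis, applied to the components of [q] *)
have nat_q : dot4 x q = ip a r.
  have /choice[psi psiP] : forall n, exists phi, test Om phi /\ t n = field4 phi (fun i => pderiv i phi).
    by move=> n; have [phi tphi ->] := gt n; exists phi.
  have sw : sq (fun z => q ord0 z - r z) by exact: sq_int_sub.
  have := natural (fun z => q ord0 z - r z) (fun i => q (lift ord0 i)) sw (fun i => sq_q _).
  have -> : ip a (fun z => q ord0 z - r z) = ip a (q ord0) - ip a r.
    by rewrite ipC dotBl// (ipC (q ord0)) (ipC r).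
  rewrite dot4E => H.
  suff : ip a (q ord0) - ip a r + \sum_i ip (A i) (q (lift ord0 i)) = 0 by lra.
  apply: H.
    exists psi; first by move=> n; have [] := psiP n.
    move=> i; have := cvgL2_component (lift ord0 i) tl; rewrite /cvgL2.
    by under eq_fun do rewrite (psiP _).2 field4S.
  move=> phi tphi; have := qy _ (ex_intro2 _ _ phi tphi erefl).
  rewrite dot4Bl//; last by apply: grad4_sq4; exists phi.
  rewrite !dot4Er /y field40 dotBl//; last exact: test_sq_int.
  rewrite (eq_bigr (fun=> 0)); last by move=> i _; rewrite field4S zero4.
  have sphi := test_sq_int oOm tphi.
  by rewrite big1// addr0 dotBl// => E; rewrite [ip r phi]dotBl//; lra.
have xpq : dot4 (x - p) q = 0 by exact: dot4_orth_limit sxp sq_q gt tl px.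
have yqp : dot4 (y - q) p = 0 by exact: dot4_orth_limit syq sp gs sl qy.
have xyE z : dot4 y z = ip r (z ord0).
  by rewrite dot4E big1 ?addr0// => i _; exact: zero4.
have rr : ip r r = 0.
  move: xpq yqp; rewrite !dot4Bl// xyE nat_q (dot4C q p) => h1 h2.
  by rewrite {1}/r dotBl// (ipC (p ord0)); lra.
have /choice[phi phiP] : forall n, exists phi, test Om phi /\ s n = field4 phi (fun i => pderiv i phi).
  by move=> n; have [phi tphi ->] := gs n; exists phi.
have tphi n : test Om (phi n) := (phiP n).1.
have lim0 : cvgL2 phi (p ord0).
  have := cvgL2_component (ord0) sl; rewrite /cvgL2.
  by under eq_fun do rewrite (phiP _).2 field40.
have limS i : cvgL2 (fun n => pderiv i (phi n)) (p (lift ord0 i)).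
  have := cvgL2_component (lift ord0 i) sl; rewrite /cvgL2.
  by under eq_fun do rewrite (phiP _).2 field4S.
exists phi; split => //.
  apply: (cvgL2_shift _ _ _ _ lim0) => //; first by move=> n; exact: test_sq_int.
  by rewrite -rr /r /dot; apply: eq_Rintegral => z _; ring.
move=> i; apply: (cvgL2_shift _ _ _ _ (limS i)) => //; first by move=> n; exact: tsq.
pose d z := p (lift ord0 i) z - A i z; have sd : sq d by exact: sq_int_sub.
suff dphi psi : test Om psi -> ip d psi = 0 by exact: dot_test_eq0.
move=> tpsi; have spsi := test_sq_int oOm tpsi.
have weak_p : ip (p (lift ord0 i)) psi = - ip (p ord0) (pderiv i psi).
  have l1 := cvgL2_dot (fun n => tsq i _ (tphi n)) (sp _) spsi (limS i).
  have l2 := cvgL2_dot (fun n => test_sq_int oOm (tphi n)) (sp _) (tsq i _ tpsi) lim0.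
  have E : (fun n => ip (pderiv i (phi n)) psi) = (fun n => - ip (phi n) (pderiv i psi)).
    by apply/funext => n; apply: test_parts => //; case: tpsi.
  by rewrite E in l1; apply: cvg_unique l1 _ => //; exact: cvgN.
rewrite /d dotBl// weak_p grad_a//.
have : ip r (pderiv i psi) = 0.
  have := dot_cauchy_schwarz sr (tsq i _ tpsi); rewrite rr mul0r => h.
  by apply/eqP; rewrite -sqrf_eq0 eq_le h sqr_ge0.
by rewrite /r dotBl//; [lra | exact: tsq].
Qed.

End VectorFields.

(** * Distributions represented by square-integrable functions *)

Section Distributions.
Context {R : realType} (F : set R[i]) (Om : set (R3 R)).
Hypothesis scF : scalar_field F.
Hypothesis oOm : open Om.
Local Notation C := R[i].
Local Notation mR := (measurableTypeR R).
Local Notation mR3 := (mR * mR * mR)%type.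
Local Notation sq := (sq_int (@lebesgue3 R) Om).
Local Notation ip := (dot (@lebesgue3 R) Om).
Local Notation distr := ((R3 R -> R) -> C).
Implicit Types (w z : R3 R -> C) (a b phi psi : R3 R -> R) (T S : distr).

Let mOm : @measurable _ mR3 Om. Proof. exact: open_measurable3. Qed.

Let sq0 : sq (fun=> 0). Proof. exact: sq_int0. Qed.
Let ipC a b : ip a b = ip b a. Proof. exact: dotC. Qed.

Let ip0l a : ip (fun=> 0) a = 0.
Proof. by rewrite /dot; under eq_Rintegral do rewrite mul0r; rewrite /Rintegral integral0. Qed.
Let ip0r a : ip a (fun=> 0) = 0. Proof. by rewrite ipC ip0l. Qed.

Lemma distr_of0 phi : distr_of Om (fun=> 0) phi = 0.
Proof. by rewrite distr_ofE !ip0l. Qed.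

Lemma scalar_field_real (r : R) : F r%:C%C.
Proof. by case: scF => ->. Qed.

Lemma scalar_fieldD (x y : C) : F x -> F y -> F (x + y).
Proof. by case: scF => ->//=; case: x => a b; case: y => c d /= -> ->; rewrite addr0. Qed.

Lemma scalar_fieldZ (r : R) (x : C) : F x -> F (r%:C%C * x).
Proof. by case: scF => ->//=; case: x => a b /= ->; rewrite mulr0 mul0r addr0. Qed.

Lemma scalar_fieldN (x : C) : F x -> F (- x).
Proof. by case: scF => ->//=; case: x => a b /= ->; rewrite oppr0. Qed.

Lemma L2_sqC w : L2 F Om w -> sqC Om w.
Proof. by move=> /L2P[]. Qed.

Lemma L2D w z : L2 F Om w -> L2 F Om z -> L2 F Om (fun x => w x + z x).
Proof.
move=> /(L2P oOm)[sw wF] /(L2P oOm)[sz zF]; apply/(L2P oOm); split; first exact: sqCD.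
by move=> x Omx; apply: scalar_fieldD; [exact: wF | exact: zF].
Qed.

Lemma L2Z (r : R) w : L2 F Om w -> L2 F Om (fun x => r%:C%C * w x).
Proof.
move=> /(L2P oOm)[sw wF]; apply/(L2P oOm); split; first exact: sqCZ.
by move=> x Omx; apply: scalar_fieldZ; exact: wF.
Qed.

Lemma L2N w : L2 F Om w -> L2 F Om (fun x => - w x).
Proof.
move=> /(L2P oOm)[sw wF]; apply/(L2P oOm); split; first exact: sqCN.
by move=> x Omx; apply: scalar_fieldN; exact: wF.
Qed.

Lemma L2B w z : L2 F Om w -> L2 F Om z -> L2 F Om (fun x => w x - z x).
Proof. by move=> sw sz; apply: L2D => //; exact: L2N. Qed.

Lemma L2_ofR a : sq a -> L2 F Om (ofR a).
Proof.
move=> sa; apply/(L2P oOm); split; first exact: sqC_ofR.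
by move=> x _; exact: scalar_field_real.
Qed.

Section DistrOf.
Variable phi : R3 R -> R.
Hypothesis tphi : test Om phi.

Let sphi : sqC Om (ofR phi).
Proof. by apply: sqC_ofR; exact: test_sq_int. Qed.

Lemma distr_ofD w z : L2 F Om w -> L2 F Om z ->
  distr_of Om (fun x => w x + z x) phi = distr_of Om w phi + distr_of Om z phi.
Proof.
by move=> /L2_sqC sw /L2_sqC sz; rewrite -!inner_ofR innerDl.
Qed.

Lemma distr_ofZ (r : R) w : L2 F Om w ->
  distr_of Om (fun x => r%:C%C * w x) phi = r%:C%C * distr_of Om w phi.
Proof. by move=> /L2_sqC sw; rewrite -!inner_ofR innerZl. Qed.

Lemma distr_ofN w : L2 F Om w ->
  distr_of Om (fun x => - w x) phi = - distr_of Om w phi.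
Proof. by move=> /L2_sqC sw; rewrite -!inner_ofR innerNl. Qed.

Lemma distr_ofB w z : L2 F Om w -> L2 F Om z ->
  distr_of Om (fun x => w x - z x) phi = distr_of Om w phi - distr_of Om z phi.
Proof. by move=> sw sz; rewrite distr_ofD ?distr_ofN//; exact: L2N. Qed.

End DistrOf.

Lemma distr_of_testB w phi psi : L2 F Om w -> test Om phi -> test Om psi ->
  distr_of Om w (fun x => phi x - psi x) = distr_of Om w phi - distr_of Om w psi.
Proof.
move=> /L2_sqC sw tphi tpsi; rewrite !distr_ofE; have [rw iw] := sw.
have s1 := test_sq_int oOm tphi; have s2 := test_sq_int oOm tpsi.
by rewrite ![ip _ (fun x => phi x - psi x)]ipC !dotBl// ![ip phi _]ipC ![ip psi _]ipC.
Qed.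

Lemma distr_of_testD w phi psi : L2 F Om w -> test Om phi -> test Om psi ->
  distr_of Om w (fun x => phi x + psi x) = distr_of Om w phi + distr_of Om w psi.
Proof.
move=> /L2_sqC sw tphi tpsi; rewrite !distr_ofE; have [rw iw] := sw.
have s1 := test_sq_int oOm tphi; have s2 := test_sq_int oOm tpsi.
by rewrite ![ip _ (fun x => phi x + psi x)]ipC !dotDl// ![ip phi _]ipC ![ip psi _]ipC.
Qed.

Lemma distr_of_test0 w : distr_of Om w (fun=> 0) = 0.
Proof.
by rewrite distr_ofE !ip0r.
Qed.

Lemma distr_of_ofR a phi : distr_of Om (ofR a) phi = (ip a phi)%:C%C.
Proof.
by rewrite distr_ofE ip0l.
Qed.

Lemma testB phi psi : test Om phi -> test Om psi -> test Om (fun x => phi x - psi x).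
Proof.
move=> tphi tpsi; have := test_lin (-1) tpsi tphi.
by congr test; apply/funext => x; rewrite mulN1r addrC.
Qed.

Lemma testD phi psi : test Om phi -> test Om psi -> test Om (fun x => phi x + psi x).
Proof.
move=> tphi tpsi; have := test_lin 1 tphi tpsi.
by congr test; apply/funext => x; rewrite mul1r.
Qed.

Lemma eqD_partD i T S : eqD Om T S -> eqD Om (partD i T) (partD i S).
Proof. by move=> TS phi tphi; rewrite /partD TS//; exact: test_pderiv. Qed.

Definition repD T : Prop := exists2 g, L2 F Om g & eqD Om T (distr_of Om g).

Lemma repDD T S : repD T -> repD S -> repD (T + S).
Proof.
move=> [g Lg Tg] [h Lh Sh]; exists (fun x => g x + h x); first exact: L2D.
by move=> phi tphi; rewrite distr_ofD// -Tg// -Sh.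
Qed.

Lemma repDN T : repD T -> repD (- T).
Proof.
move=> [g Lg Tg]; exists (fun x => - g x); first exact: L2N.
by move=> phi tphi; rewrite distr_ofN// -Tg.
Qed.

Lemma repDB T S : repD T -> repD S -> repD (T - S).
Proof. by move=> rT rS; apply: repDD => //; exact: repDN. Qed.

Lemma repD_sum (I : finType) (T : I -> distr) : (forall i, repD (T i)) -> repD (\sum_i T i).
Proof.
move=> rT; elim/big_ind: _ => [|S1 S2|i _]; [|exact: repDD|exact: rT].
exists (fun=> 0); first by have := L2_ofR sq0; congr L2.
by move=> phi tphi; rewrite distr_of0.
Qed.

Lemma eqD_repD T S : eqD Om T S -> repD S -> repD T.
Proof. by move=> TS [g Lg Sg]; exists g => // phi tphi; rewrite TS// Sg. Qed.

Lemma partDB i T S : partD i (T - S) = partD i T - partD i S.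
Proof. by apply/funext => phi; rewrite /partD /= opprD. Qed.

Lemma partD_sum (I : finType) i (T : I -> distr) :
  partD i (\sum_k T k) = \sum_k partD i (T k).
Proof.
apply/funext => phi; rewrite /partD !fct_sumE -sumrN.
by apply: eq_bigr.
Qed.

End Distributions.

(** * Curls and gradients *)

Section Curl.
Context {R : realType} (F : set R[i]) (Om : set (R3 R)).
Hypothesis scF : scalar_field F.
Hypothesis oOm : open Om.
Local Notation C := R[i].
Local Notation mR := (measurableTypeR R).
Local Notation mR3 := (mR * mR * mR)%type.
Local Notation sq := (sq_int (@lebesgue3 R) Om).
Local Notation ip := (dot (@lebesgue3 R) Om).
Local Notation re := (@complex.Re R).
Local Notation im := (@complex.Im R).
Local Notation distr := ((R3 R -> R) -> C).
Implicit Types (w z : 'I_3 -> R3 R -> C) (a b phi psi : R3 R -> R) (T S : distr).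
Implicit Types (V : 'I_3 -> R3 R -> R).

Let mOm : @measurable _ mR3 Om. Proof. exact: open_measurable3. Qed.
Let ipC a b : ip a b = ip b a. Proof. exact: dotC. Qed.

Lemma sum3 (M : zmodType) (f : 'I_3 -> M) : \sum_i f i = f 0 + f 1 + f 2.
Proof.
rewrite !big_ord_recl big_ord0 addr0 addrA.
by congr (f _ + f _ + f _); apply: val_inj.
Qed.

(** Shifts of the index modulo three: the exchange of the factors in the curl. *)
Lemma sum_cyclic (M : zmodType) (G : 'I_3 -> 'I_3 -> 'I_3 -> M) :
  \sum_k (- G (k + 2) (k + 1) k + G (k + 1) (k + 2) k) =
  \sum_k (G k (k + 1) (k + 2) - G k (k + 2) (k + 1)).
Proof.
have e12 (k : 'I_3) : k + 1 + 2 = k by case: k => [[|[|[|//]]] ?]; exact: val_inj.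
have e11 (k : 'I_3) : k + 1 + 1 = k + 2 by case: k => [[|[|[|//]]] ?]; exact: val_inj.
have e21 (k : 'I_3) : k + 2 + 1 = k by case: k => [[|[|[|//]]] ?]; exact: val_inj.
have e22 (k : 'I_3) : k + 2 + 2 = k + 1 by case: k => [[|[|[|//]]] ?]; exact: val_inj.
rewrite !big_split /= addrC; congr (_ + _).
  rewrite [LHS](reindex_inj (addIr (2 : 'I_3))); apply: eq_bigr => k _ /=.
  by rewrite e21 e22.
rewrite [LHS](reindex_inj (addIr (1 : 'I_3))); apply: eq_bigr => k _ /=.
by rewrite e12 e11.
Qed.

(** The classical curl of a smooth real field. *)
Definition rcurl V : 'I_3 -> R3 R -> R :=
  fun k x => pderiv (k + 1) (V (k + 2)) x - pderiv (k + 2) (V (k + 1)) x.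

Lemma test_rcurl V : (forall k, test Om (V k)) -> forall k, test Om (rcurl V k).
Proof. by move=> tV k; apply: testB; exact: test_pderiv. Qed.

Lemma rcurl_grad phi k : smooth phi -> rcurl (fun i => pderiv i phi) k = fun=> 0.
Proof. by move=> sphi; apply/funext => x; rewrite /rcurl pderiv_comm// subrr. Qed.

Lemma curlDE (T : 'I_3 -> distr) k phi :
  curlD T k phi = - T (k + 2) (pderiv (k + 1) phi) + T (k + 1) (pderiv (k + 2) phi).
Proof. by rewrite /curlD /partD /= opprK. Qed.

(** The curl is its own formal adjoint: the sign of the integration by parts is
compensated by the antisymmetry in the two indices. *)
Lemma curlD_adjoint z V : L2v F Om z -> (forall k, test Om (V k)) ->
  \sum_k curlD (distrv_of Om z) k (V k) = \sum_k distr_of Om (z k) (rcurl V k).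
Proof.
move=> Lz tV.
pose G i j k := distr_of Om (z i) (pderiv j (V k)).
rewrite (eq_bigr (fun k => - G (k + 2) (k + 1) k + G (k + 1) (k + 2) k)); last first.
  by move=> k _; rewrite curlDE.
rewrite sum_cyclic; apply: eq_bigr => k _; rewrite /rcurl.
by rewrite (distr_of_testB oOm (Lz k))//; exact: test_pderiv.
Qed.

Lemma innerv_ofR z V : innerv Om z (fun k => ofR (V k)) = \sum_k distr_of Om (z k) (V k).
Proof. by apply: eq_bigr => k _; rewrite inner_ofR. Qed.

Lemma L2v_test V : (forall k, test Om (V k)) -> L2v F Om (fun k => ofR (V k)).
Proof. by move=> tV k; apply: L2_ofR => //; exact: test_sq_int. Qed.

Lemma complex_subN (x y : R) : - (- x)%:C%C + (- y)%:C%C = (x - y)%:C%C.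
Proof. by apply/eqP; rewrite eq_complex /=; apply/andP; split; apply/eqP; ring. Qed.

Lemma complex_realD3 (x y z : R) : x%:C%C + y%:C%C + z%:C%C = (x + y + z)%:C%C.
Proof. by apply/eqP; rewrite eq_complex /=; apply/andP; split; apply/eqP; ring. Qed.

Lemma complex_oppN (x : R) : - (- x)%:C%C = x%:C%C.
Proof. by apply/eqP; rewrite eq_complex /=; apply/andP; split; apply/eqP; ring. Qed.

Lemma weak_curl_test V : (forall k, test Om (V k)) ->
  is_weak_curl F Om (fun k => ofR (V k)) (fun k => ofR (rcurl V k)).
Proof.
move=> tV; split; first exact: L2v_test (test_rcurl tV).
move=> k phi tphi; rewrite curlDE /distrv_of !distr_of_ofR.
have tp i j : ip (V i) (pderiv j phi) = - ip (pderiv j (V i)) phi.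
  by rewrite /dot test_parts ?opprK//; case: tphi.
rewrite !tp /rcurl dotBl//; [|by apply: test_sq_int => //; exact: test_pderiv..|exact: test_sq_int].
exact: complex_subN.
Qed.

Lemma weak_div_test V : (forall k, test Om (V k)) ->
  is_weak_div F Om (fun k => ofR (V k)) (ofR (fun x => \sum_k pderiv k (V k) x)).
Proof.
move=> tV; have tdV k : test Om (pderiv k (V k)) by exact: test_pderiv.
have E : (fun x => \sum_k pderiv k (V k) x) =
    fun x => pderiv 0 (V 0) x + pderiv 1 (V 1) x + pderiv 2 (V 2) x.
  by apply/funext => x; rewrite sum3.
have t2 := testD (tdV 0) (tdV 1).
split; first by apply: L2_ofR => //; rewrite E; apply: test_sq_int => //; exact: testD.
move=> phi tphi.
have Lphi := test_sq_int oOm tphi.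
have sdV k := test_sq_int oOm (tdV k).
rewrite distr_of_ofR E dotDl//; last exact: test_sq_int.
rewrite dotDl// -complex_realD3 /divD fct_sumE -(sum3 (fun i => (ip (pderiv i (V i)) phi)%:C%C)).
apply: eq_bigr => i _; rewrite /partD /distrv_of distr_of_ofR.
have -> : ip (V i) (pderiv i phi) = - ip (pderiv i (V i)) phi.
  by rewrite /dot test_parts ?opprK//; case: tphi.
exact: complex_oppN.
Qed.

Lemma wcurlP w : (exists g, is_weak_curl F Om w g) -> is_weak_curl F Om w (wcurl F Om w).
Proof. by move=> h; exact: xgetPex. Qed.

Lemma wdivP w : (exists g, is_weak_div F Om w g) -> is_weak_div F Om w (wdiv F Om w).
Proof. by move=> h; exact: xgetPex. Qed.

Lemma wpartP i (f : R3 R -> C) : (exists g, is_weak_part F Om i f g) ->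
  is_weak_part F Om i f (wpart F Om i f).
Proof. by move=> h; exact: xgetPex. Qed.

Lemma innerv_congl w1 w2 z : L2v F Om w1 -> L2v F Om w2 -> L2v F Om z ->
  (forall k, eqD Om (distr_of Om (w1 k)) (distr_of Om (w2 k))) ->
  innerv Om w1 z = innerv Om w2 z.
Proof.
move=> L1 L2 Lz E; apply: eq_bigr => k _.
by apply: inner_congl => //; apply: (@L2_sqC _ F).
Qed.

Lemma innerv_conj w z : L2v F Om w -> L2v F Om z -> innerv Om w z = conjc (innerv Om z w).
Proof.
move=> Lw Lz; rewrite /innerv raddf_sum; apply: eq_bigr => k _.
by apply: inner_conj => //; apply: (@L2_sqC _ F).
Qed.

Lemma innerv_congr w z1 z2 : L2v F Om w -> L2v F Om z1 -> L2v F Om z2 ->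
  (forall k, eqD Om (distr_of Om (z1 k)) (distr_of Om (z2 k))) ->
  innerv Om w z1 = innerv Om w z2.
Proof.
by move=> Lw L1 L2 E; rewrite innerv_conj// [RHS]innerv_conj// (innerv_congl L1 L2).
Qed.

Lemma curl_test_adjoint z g V : L2v F Om z -> is_weak_curl F Om z g ->
  (forall k, test Om (V k)) ->
  innerv Om z (fun k => ofR (rcurl V k)) = innerv Om g (fun k => ofR (V k)).
Proof.
move=> Lz [Lg zg] tV; rewrite !innerv_ofR -curlD_adjoint//.
by apply: eq_bigr => k _; exact: zg.
Qed.

Lemma repD_weak_curl w : (forall i j, repD F Om (partD i (distr_of Om (w j)))) ->
  exists g, is_weak_curl F Om w g.
Proof.
move=> rw; have /choice[g gP] : forall k, exists g, L2 F Om g /\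
    eqD Om (curlD (distrv_of Om w) k) (distr_of Om g).
  by move=> k; have [g Lg wg] := repDB scF oOm (rw (k + 1) (k + 2)) (rw (k + 2) (k + 1)); exists g.
by exists g; split => k; [exact: (gP k).1 | exact: (gP k).2].
Qed.

Lemma Hsv_repD s w (a : seq 'I_3) j : Hsv F Om s w -> (size a <= s)%N ->
  repD F Om (foldr partD (distr_of Om (w j)) a).
Proof. by move=> /(_ j)[_ /(_ a)] h /h. Qed.

Lemma Hsv1_weak_curl w : Hsv F Om 1 w -> exists g, is_weak_curl F Om w g.
Proof. by move=> Hw; apply: repD_weak_curl => i j; exact: (@Hsv_repD 1 _ [:: i]). Qed.

(** For a test field there is no boundary term in Green's formula. *)
Lemma XN_test V : (forall k, test Om (V k)) -> XN F Om (fun k => ofR (V k)).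
Proof.
move=> tV; have wc := weak_curl_test tV; have wd := weak_div_test tV.
have LV := L2v_test tV.
split; first by split; [exact: LV | eexists; exact: wc | eexists; exact: wd].
move=> phi Hphi; have [Lg phig] := wcurlP (Hsv1_weak_curl Hphi).
have [Lc Vc] := wcurlP (ex_intro _ _ wc).
have Lphi k := (Hphi k).1.
have Lrc := L2v_test (test_rcurl tV).
apply/eqP; rewrite /ttrace subr_eq0; apply/eqP.
rewrite (innerv_congl Lc Lrc Lphi); last by move=> k psi tpsi; exact: etrans (esym (Vc k psi tpsi)) (wc.2 k psi tpsi).
by rewrite innerv_conj// (curl_test_adjoint Lphi (conj Lg phig) tV) -innerv_conj.
Qed.

(** Reduces identities on components to identities on vector fields. *)
Definition single (j : 'I_3) phi : 'I_3 -> R3 R -> R :=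
  fun k => if k == j then phi else fun=> 0.

Lemma test_single j phi : test Om phi -> forall k, test Om (single j phi k).
Proof. by move=> tphi k; rewrite /single; case: eqP => // _; exact: test0. Qed.

Lemma pderiv0 i : pderiv i (fun=> 0 : R) = fun=> 0.
Proof. by apply/funext => x; rewrite /pderiv derive_cst. Qed.

Lemma sum_single (M : nmodType) (j : 'I_3) phi (G : 'I_3 -> (R3 R -> R) -> M) :
  (forall k, G k (fun=> 0) = 0) -> \sum_k G k (single j phi k) = G j phi.
Proof.
move=> G0; rewrite (bigD1 j)//= /single eqxx big1 ?addr0// => k kj.
by rewrite (negbTE kj).
Qed.

Lemma curlD_distr0 w k : curlD (distrv_of Om w) k (fun=> 0) = 0.
Proof. by rewrite curlDE !pderiv0 /distrv_of !distr_of_test0 oppr0 addr0. Qed.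

Lemma curlD_single w j phi :
  \sum_k curlD (distrv_of Om w) k (single j phi k) = curlD (distrv_of Om w) j phi.
Proof. by apply: (@sum_single _ j phi (curlD (distrv_of Om w))) => k; exact: curlD_distr0. Qed.

(** Gradients of test functions are orthogonal to curls, the curl of a gradient being
zero. The limit in mean square is taken separately in the real and imaginary parts. *)
Lemma grad_orth_curl (phi : nat -> R3 R -> R) (W : 'I_3 -> R3 R -> R) w g :
  (forall n, test Om (phi n)) -> (forall i, sq (W i)) ->
  (forall i, cvgL2 Om (fun n => pderiv i (phi n)) (W i)) ->
  L2v F Om w -> is_weak_curl F Om w g -> innerv Om (fun k => ofR (W k)) g = 0.
Proof.
move=> tphi sW Wlim Lw [Lg wg].
have LW : L2v F Om (fun k => ofR (W k)) by move=> k; exact: L2_ofR.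
rewrite innerv_conj// innerv_ofR.
have sdphi i n : sq (pderiv i (phi n)) by apply: test_sq_int => //; exact: test_pderiv.
have orth n : \sum_k distr_of Om (g k) (pderiv k (phi n)) = 0.
  have tV k : test Om (pderiv k (phi n)) by exact: test_pderiv.
  have -> : \sum_k distr_of Om (g k) (pderiv k (phi n)) =
      \sum_k curlD (distrv_of Om w) k (pderiv k (phi n)).
    by apply: eq_bigr => k _; exact: esym (wg k _ (tV k)).
  rewrite (curlD_adjoint (V := fun k => pderiv k (phi n)))// big1// => k _.
  by rewrite rcurl_grad ?distr_of_test0//; case: (tphi n).
have sre k : sq (re \o g k) by have [] := L2_sqC (oOm) (Lg k).
have sim k : sq (im \o g k) by have [] := L2_sqC (oOm) (Lg k).
have lim_orth (h : 'I_3 -> R3 R -> R) : (forall k, sq (h k)) ->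
    (forall n, \sum_k ip (h k) (pderiv k (phi n)) = 0) -> \sum_k ip (h k) (W k) = 0.
  move=> sh h0.
  have : \sum_k ip (pderiv k (phi n)) (h k) @[n --> \oo] --> \sum_k ip (W k) (h k).
    by apply: cvg_sum_ord => k; apply: cvgL2_dot => // n; exact: sdphi.
  have -> : (fun n => \sum_k ip (pderiv k (phi n)) (h k)) = fun=> 0.
    by apply/funext => n; apply: etrans (h0 n); apply: eq_bigr => k _; exact: ipC.
  move=> cv; rewrite (eq_bigr (fun k => ip (W k) (h k))); last by move=> k _; exact: ipC.
  by apply: cvg_unique cv (cvg_cst 0).
have orth2 n : \sum_k ip (re \o g k) (pderiv k (phi n)) = 0 /\
    \sum_k ip (im \o g k) (pderiv k (phi n)) = 0.
  have := orth n; under eq_bigr do rewrite distr_ofE.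
  by rewrite !sum3 => /eqP; rewrite eq_complex /= => /andP[/eqP -> /eqP ->].
have r0 := lim_orth _ sre (fun n => (orth2 n).1).
have i0 := lim_orth _ sim (fun n => (orth2 n).2).
under eq_bigr do rewrite distr_ofE.
rewrite sum3 in r0; rewrite sum3 in i0; rewrite sum3.
by apply/eqP; rewrite eq_complex /= r0 i0 oppr0 eqxx.
Qed.

(** By the orthogonality to all curls, such a limit has zero curl and zero tangential
trace. These are the admissible fields from which the boundary condition of the
divergence is read off. *)
Lemma XN_grad_limit (phi : nat -> R3 R -> R) (W : 'I_3 -> R3 R -> R) :
  (forall n, test Om (phi n)) -> (forall i, sq (W i)) ->
  (forall i, cvgL2 Om (fun n => pderiv i (phi n)) (W i)) ->
  (exists g, is_weak_div F Om (fun k => ofR (W k)) g) ->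
  XN F Om (fun k => ofR (W k)) /\
  forall k, eqD Om (distr_of Om (wcurl F Om (fun k => ofR (W k)) k)) (fun=> 0).
Proof.
move=> tphi sW Wlim wd.
have LW : L2v F Om (fun k => ofR (W k)) by move=> k; exact: L2_ofR.
have L0 : L2v F Om (fun=> fun=> 0).
  by move=> k; have := L2_ofR scF oOm (test_sq_int oOm (test0 Om)); congr L2.
have wc : is_weak_curl F Om (fun k => ofR (W k)) (fun=> fun=> 0).
  split=> // j psi tpsi; rewrite [RHS](distr_of0 Om psi) -curlD_single.
  have tV := test_single j tpsi.
  rewrite curlD_adjoint// -innerv_ofR.
  exact: grad_orth_curl tphi sW Wlim (L2v_test tV) (weak_curl_test tV).
have [Lc cE] := wcurlP (ex_intro _ _ wc).
have c0 k : eqD Om (distr_of Om (wcurl F Om (fun k => ofR (W k)) k)) (distr_of Om (fun=> 0)).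
  by move=> psi tpsi; exact: etrans (esym (cE k psi tpsi)) (wc.2 k psi tpsi).
split; last by move=> k psi tpsi; rewrite c0// distr_of0.
split; first by split => //; exists (fun=> fun=> 0).
move=> psi Hpsi; have [Lg psig] := wcurlP (Hsv1_weak_curl Hpsi).
have Lpsi k := (Hpsi k).1.
rewrite /ttrace (innerv_congl Lc L0 Lpsi c0).
rewrite (grad_orth_curl tphi sW Wlim Lpsi (conj Lg psig)) subr0.
rewrite /innerv big1// => k _; rewrite inner_eq0l//.
- exact: L2_sqC (L0 k).
- exact: L2_sqC (Lpsi k).
- by move=> chi _; rewrite distr_of0.
Qed.

End Curl.

(** * Functions of zero trace *)

Section SetFunctionIntegral.
Import HBNNSimple.

(** The surface measure enters the definition of traces as a bare set function, for which
this has to be computed from the definition of the integral: the only simple function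
below zero is zero, and its integral involves only [mu set0] and multiples of zero. *)
Lemma integral_set_function_eq0 d (T : measurableType d) (R : realType)
    (mu : set T -> \bar R) (D : set T) (f : T -> \bar R) : mu set0 = 0%E ->
  (forall x, D x -> f x = 0%E) -> (\int[mu]_(x in D) f x = 0)%E.
Proof.
move=> mu0 f0; rewrite /integral /=.
have -> : (fun x => f x) \_ D = cst 0%E.
  apply/funext => x; rewrite patchE; case: ifPn => // /set_mem; exact: f0.
have -> : funepos (cst 0%E : T -> \bar R) = cst 0%E.
  by apply/funext => x; rewrite funeposE maxxx.
have -> : funeneg (cst 0%E : T -> \bar R) = cst 0%E.
  by apply/funext => x; rewrite funenegE oppe0 maxxx.
have s0 : sintegral mu (cst 0 : T -> R) = 0%E.
  rewrite /sintegral fsbig1// => r _; rewrite preimage_cst.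
  by case: ifPn => [/[!inE] <-|_]; rewrite ?mul0e// mu0 mule0.
set S := [set _ | _ in _].
have SE : S = [set 0%E].
  apply/seteqP; split => [_ [h /= h0 <-]|_ ->].
    rewrite (_ : (h : T -> R) = cst 0) ?s0//; apply/funext => x.
    by apply/eqP; rewrite eq_le; apply/andP; split;
      [rewrite -lee_fin; exact: h0 | exact: fun_ge0].
  by exists (nnsfun0 : {nnsfun T >-> R}) => //=.
by rewrite SE ereal_sup1 subee.
Qed.

End SetFunctionIntegral.

Section ZeroTrace.
Context {R : realType} (F : set R[i]) (Om : set (R3 R)).
Hypothesis scF : scalar_field F.
Hypothesis oOm : open Om.
Local Notation C := R[i].
Local Notation mR := (measurableTypeR R).
Local Notation mR3 := (mR * mR * mR)%type.
Local Notation sq := (sq_int (@lebesgue3 R) Om).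
Local Notation ip := (dot (@lebesgue3 R) Om).
Local Notation re := (@complex.Re R).
Local Notation im := (@complex.Im R).

Let mOm : @measurable _ mR3 Om. Proof. exact: open_measurable3. Qed.
Let ipC a b : ip a b = ip b a. Proof. exact: dotC. Qed.

Lemma wcurl_eq w g : is_weak_curl F Om w g ->
  forall k, eqD Om (distr_of Om (wcurl F Om w k)) (distr_of Om (g k)).
Proof.
move=> wg k phi tphi; have [_ h] := wcurlP (ex_intro _ _ wg).
exact: etrans (esym (h k phi tphi)) (wg.2 k phi tphi).
Qed.

Lemma wdiv_eq w g : is_weak_div F Om w g ->
  eqD Om (distr_of Om (wdiv F Om w)) (distr_of Om g).
Proof.
move=> wg phi tphi; have [_ h] := wdivP (ex_intro _ _ wg).
exact: etrans (esym (h phi tphi)) (wg.2 phi tphi).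
Qed.

Lemma complexP (x y : R) : (x +i* y = 0 :> C)%C -> x = 0 /\ y = 0.
Proof. by move=> /eqP; rewrite eq_complex /= => /andP[/eqP -> /eqP ->]. Qed.

Lemma complexNN (x y : R) : (- ((- x) +i* (- y)) = x +i* y)%C.
Proof. by rewrite -[in RHS](opprK x) -[in RHS](opprK y). Qed.

Lemma complexN (x y : R) : (- (x +i* y) = (- x) +i* (- y))%C.
Proof. by []. Qed.

Lemma complex_real_oppD3 (x y z : R) :
  - x%:C%C + - y%:C%C + - z%:C%C = (- (x + y + z))%:C%C.
Proof. by apply/eqP; rewrite eq_complex /=; apply/andP; split; apply/eqP; ring. Qed.

Lemma complexD4 (x y x1 y1 x2 y2 x3 y3 : R) :
  ((x +i* y) + ((x1 +i* y1) + (x2 +i* y2) + (x3 +i* y3)) = 0 :> C)%C ->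
  x + (x1 + x2 + x3) = 0 /\ y + (y1 + y2 + y3) = 0.
Proof. exact: complexP. Qed.

Lemma weak_part_sub i (p q : R3 R -> R) (g h : R3 R -> C) :
  test Om p -> test Om q -> L2 F Om (fun x => p x +i* q x)%C ->
  L2 F Om g -> L2 F Om h -> L2 F Om (fun x => pderiv i p x +i* pderiv i q x)%C ->
  eqD Om (partD i (distr_of Om g)) (distr_of Om h) ->
  is_weak_part F Om i (fun x => (p x +i* q x)%C - g x)
    (fun x => (pderiv i p x +i* pderiv i q x)%C - h x).
Proof.
move=> tp tq Lpq Lg Lh Ldpq gh; split; first exact: L2B.
move=> psi tpsi; rewrite /partD !(distr_ofB scF oOm)//; last exact: test_pderiv.
rewrite -gh// /partD opprB opprK addrC; congr (_ + _).
have parts f : test Om f -> ip f (pderiv i psi) = - ip (pderiv i f) psi.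
  by have [spsi _] := tpsi; move=> tf; rewrite /dot test_parts ?opprK.
have dE (f h' : R3 R -> R) chi :
    distr_of Om (fun x => f x +i* h' x)%C chi = (ip f chi +i* ip h' chi)%C.
  exact: distr_ofE.
by rewrite !dE (parts p tp) (parts q tq) complexNN.
Qed.

Section Natural.
Variables (g : R3 R -> C) (G : 'I_3 -> R3 R -> C).
Hypotheses (Lg : L2 F Om g) (LG : L2v F Om G).
Hypothesis gG : forall i, eqD Om (partD i (distr_of Om g)) (distr_of Om (G i)).
Hypothesis natural : forall v, XN F Om v ->
  inner Om g (wdiv F Om v) + innerv Om G v = 0.

Let srg : sq (re \o g). Proof. by have [] := L2_sqC oOm Lg. Qed.
Let sig : sq (im \o g). Proof. by have [] := L2_sqC oOm Lg. Qed.
Let srG i : sq (re \o G i). Proof. by have [] := L2_sqC oOm (LG i). Qed.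
Let siG i : sq (im \o G i). Proof. by have [] := L2_sqC oOm (LG i). Qed.

Lemma weak_gradient_parts i phi : test Om phi ->
  ip (re \o G i) phi = - ip (re \o g) (pderiv i phi) /\
  ip (im \o G i) phi = - ip (im \o g) (pderiv i phi).
Proof.
move=> tphi; have := gG i tphi; rewrite /partD !distr_ofE complexN => -[-> ->].
by [].
Qed.

(** For a real field [W] the hypothesis on the complex pair [(g, G)] splits into its real
and imaginary parts. *)
Lemma natural_parts w W : sq w -> (forall i, sq (W i)) ->
  (exists2 phi : nat -> R3 R -> R, forall n, test Om (phi n) &
     forall i, cvgL2 Om (fun n => pderiv i (phi n)) (W i)) ->
  (forall phi, test Om phi -> \sum_i ip (W i) (pderiv i phi) = - ip w phi) ->
  ip (re \o g) w + \sum_i ip (re \o G i) (W i) = 0 /\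
  ip (im \o g) w + \sum_i ip (im \o G i) (W i) = 0.
Proof.
move=> sw sW [phi tphi Wlim] div_w.
have wd : is_weak_div F Om (fun k => ofR (W k)) (ofR w).
  split; first exact: L2_ofR.
  move=> psi tpsi; rewrite distr_of_ofR /divD fct_sumE.
  rewrite -[ip w psi]opprK -div_w// !sum3 /partD /distrv_of !distr_of_ofR.
  exact: complex_real_oppD3.
have [XW _] := XN_grad_limit scF oOm tphi sW Wlim (ex_intro _ _ wd).
have := natural XW.
have [Ldw _] := wdivP (ex_intro _ _ wd).
rewrite (inner_congr oOm (L2_sqC oOm Lg) (L2_sqC oOm Ldw) (sqC_ofR sw) (wdiv_eq wd)).
rewrite inner_ofR innerv_ofR; under eq_bigr do rewrite distr_ofE.
by rewrite distr_ofE !sum3 => /complexD4.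
Qed.

(** For real scalars the imaginary parts vanish on [Om] and the zero sequence is taken
for them, which keeps the values of the approximations in [F]. *)
Lemma approx_parts : exists p q : nat -> R3 R -> R,
  [/\ forall n, test Om (p n) /\ test Om (q n),
      cvgL2 Om p (re \o g) /\ cvgL2 Om q (im \o g),
      forall i, cvgL2 Om (fun n => pderiv i (p n)) (re \o G i) /\
                cvgL2 Om (fun n => pderiv i (q n)) (im \o G i) &
      forall n x, F (p n x +i* q n x)%C].
Proof.
have [p [tp pg pG]] := closure_of_gradients oOm srg srG
  (fun i phi tphi => (weak_gradient_parts i tphi).1)
  (fun w W sw sW h1 h2 => (natural_parts sw sW h1 h2).1).
have [q [tq qg qG]] := closure_of_gradients oOm sig siG
  (fun i phi tphi => (weak_gradient_parts i tphi).2)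
  (fun w W sw sW h1 h2 => (natural_parts sw sW h1 h2).2).
case: scF => FE.
  have real0 w : L2 F Om w -> cvgL2 Om (fun=> fun=> 0) (im \o w).
    move=> /(L2P oOm)[_ wF]; rewrite /cvgL2.
    suff e : ip (fun x => 0 - (im \o w) x) (fun x => 0 - (im \o w) x) = 0.
      by rewrite e; exact: cvg_cst.
    rewrite /dot (@eq_Rintegral _ mR3 R (@lebesgue3 R) Om (fun=> 0)).
      by rewrite /Rintegral integral0.
    by move=> x /set_mem/wF; rewrite FE /= => ->; rewrite subr0 mulr0.
  exists p, (fun=> fun=> 0); split => //.
  - by move=> n; split => //; exact: test0.
  - by split => //; exact: real0.
  - by move=> i; split => //; rewrite pderiv0; exact: real0.
  - by move=> n x; rewrite FE.
by exists p, q; split => // n x; rewrite FE.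
Qed.

Lemma sqmod_integral w : sqC Om w ->
  (\int[lebesgue3]_(x in Om) (sqmod (w x))%:E)%E =
  (ip (re \o w) (re \o w) + ip (im \o w) (im \o w))%:E.
Proof.
move=> [sr si]; rewrite EFinD !dotE//.
rewrite -ge0_integralD//.
- by move=> x _; rewrite lee_fin sqr_ge0.
- by apply/measurable_EFinP/measurable_funX; exact: sr.1.
- by move=> x _; rewrite lee_fin sqr_ge0.
- by apply/measurable_EFinP/measurable_funX; exact: si.1.
Qed.

Lemma sqmod_integral_eqD w1 w2 : L2 F Om w1 -> L2 F Om w2 ->
  eqD Om (distr_of Om w1) (distr_of Om w2) ->
  (\int[lebesgue3]_(x in Om) (sqmod (w1 x))%:E)%E =
  (\int[lebesgue3]_(x in Om) (sqmod (w2 x))%:E)%E.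
Proof.
move=> L1 L2' E; have s1 := L2_sqC oOm L1; have s2 := L2_sqC oOm L2'.
rewrite !sqmod_integral//; congr EFin.
have : inner Om w1 w1 = inner Om w2 w2.
  by rewrite (inner_congl oOm s1 s2 s1 E) (inner_congr oOm s2 s1 s2 E).
by rewrite !innerE// => -[].
Qed.

(** The approximating test functions vanish on the boundary, which is disjoint from the
open set [Om], so the boundary integrals in the definition of the trace are zero. *)
Lemma zero_trace : is_trace F Om g (fun=> 0).
Proof.
have [p [q [tpq pg pG pF]]] := approx_parts.
have Hg : Hs F Om 1 g.
  split => // -[|i [|//]] _; first by exists g.
  by exists (G i) => //; exact: gG.
cbv zeta beta delta [is_trace]; split => //.
  exact: measurable_cst.
  exact: measurable_cst.
pose phi n x := (p n x +i* q n x)%C.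
have Lphi n : L2 F Om (phi n).
  apply/(L2P oOm); split; last by move=> x _; exact: pF.
  by split; apply: test_sq_int => //; have [] := tpq n.
pose dphi n i x := (pderiv i (p n) x +i* pderiv i (q n) x)%C.
pose rp n x := p n x - (re \o g) x; pose rq n x := q n x - (im \o g) x.
pose rdp i n x := pderiv i (p n) x - (re \o G i) x.
pose rdq i n x := pderiv i (q n) x - (im \o G i) x.
have weak n i : is_weak_part F Om i (fun x => phi n x - g x) (fun x => dphi n i x - G i x).
  have [tp tq] := tpq n; apply: weak_part_sub => //; first exact: Lphi.
  apply/(L2P oOm); split; first by split; apply: test_sq_int => //; exact: test_pderiv.
  move=> x _; case: scF => FE; last by rewrite FE.
  have -> : q n = fun=> 0 by apply/funext => y; have := pF n y; rewrite FE.
  by rewrite pderiv0 FE.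
have E n : sqnormH1 F Om (fun x => phi n x - g x) =
    (ip (rp n) (rp n) + ip (rq n) (rq n) +
     \sum_i (ip (rdp i n) (rdp i n) + ip (rdq i n) (rdq i n)))%:E.
  rewrite /sqnormH1 sqmod_integral; last exact: (L2_sqC oOm (L2B scF oOm (Lphi n) Lg)).
  rewrite [RHS]EFinD -sumEFin; congr (_ + _)%E.
    by congr (ip _ _ + ip _ _)%:E; apply/funext => x; rewrite /phi /rp /rq /=; case: (g x).
  apply: eq_bigr => i _; have [Lwp wpE] := wpartP (ex_intro _ _ (weak n i)).
  have [Ld dE] := weak n i.
  rewrite (sqmod_integral_eqD Lwp Ld); last first.
    by move=> psi tpsi; exact: etrans (esym (wpE psi tpsi)) (dE psi tpsi).
  rewrite sqmod_integral; last exact: (L2_sqC oOm Ld).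
  by congr (ip _ _ + ip _ _)%:E; apply/funext => x; rewrite /dphi /rdp /rdq /=; case: (G i x).
exists phi; split.
- by move=> n; split; [have [[]] := tpq n | have [_ []] := tpq n].
- exact: pF.
- have -> : (fun n => sqnormH1 F Om (fun x => phi n x - g x)) =
      EFin \o (fun n => ip (rp n) (rp n) + ip (rq n) (rq n) +
      \sum_i (ip (rdp i n) (rdp i n) + ip (rdq i n) (rdq i n))).
    by apply/funext => n; exact: E.
  apply: cvg_EFin; first exact: nearW.
  have S : \sum_i (ip (rdp i n) (rdp i n) + ip (rdq i n) (rdq i n)) @[n --> \oo] -->
      \sum_(i < 3) (0 + 0 : R).
    by apply: cvg_sum_ord => i; exact: cvgD (pG i).1 (pG i).2.
  have := cvgD (cvgD pg.1 pg.2) S.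
  by rewrite big1 ?addr0// => h; exact: h.
- rewrite [X in X @ _ --> _](_ : _ = cst 0%E); first exact: cvg_cst.
  apply/funext => n; apply: integral_set_function_eq0; first exact: hausdorff2_set0.
  move=> x [_ xOm].
  have nOm : ~ Om x by move: oOm => /interior_id <-.
  have [tp tq] := tpq n.
  by rewrite /phi (test_outside tp nOm) (test_outside tq nOm) /sqmod subr0 /= expr0n addr0.
Qed.

End Natural.
End ZeroTrace.

(** * The elastic field *)

Section Elasticity.
Context {R : realType} (F : set R[i]) (Om : set (R3 R)).
Hypothesis scF : scalar_field F.
Hypothesis oOm : open Om.
Local Notation C := R[i].
Local Notation re := (@complex.Re R).
Local Notation im := (@complex.Im R).

Lemma innervN w z : L2v F Om w -> L2v F Om z ->
  innerv Om (fun k x => - w k x) z = - innerv Om w z.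
Proof.
move=> Lw Lz; rewrite /innerv -sumrN; apply: eq_bigr => k _.
by apply: (innerNl oOm); [exact: (L2_sqC oOm (Lw k)) | exact: (L2_sqC oOm (Lz k))].
Qed.

(** By density, a linear relation between square-integrable fields that holds against test
functions holds against every square-integrable field. *)
Lemma innerv_comb3 f k1 k2 k3 (a b c : R) : L2v F Om f ->
  L2v F Om k1 -> L2v F Om k2 -> L2v F Om k3 ->
  (forall j phi, test Om phi -> distr_of Om (f j) phi =
     a%:C%C * distr_of Om (k1 j) phi + b%:C%C * distr_of Om (k2 j) phi
     + c%:C%C * distr_of Om (k3 j) phi) ->
  forall z, L2v F Om z -> innerv Om f z =
    a%:C%C * innerv Om k1 z + b%:C%C * innerv Om k2 z + c%:C%C * innerv Om k3 z.
Proof.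
move=> Lf L1 L2' L3 fE z Lz.
pose h j x := a%:C%C * k1 j x + b%:C%C * k2 j x + c%:C%C * k3 j x.
have La j := L2Z scF oOm a (L1 j); have Lb j := L2Z scF oOm b (L2' j).
have Lc j := L2Z scF oOm c (L3 j).
have Lab j := L2D scF oOm (La j) (Lb j).
have Lh : L2v F Om h by move=> j; exact: L2D.
rewrite (innerv_congl oOm Lf Lh Lz); last first.
  move=> j phi tphi; rewrite fE// /h (distr_ofD oOm tphi (Lab j) (Lc j)).
  rewrite (distr_ofD oOm tphi (La j) (Lb j)).
  by rewrite (distr_ofZ oOm tphi a (L1 j)) (distr_ofZ oOm tphi b (L2' j)) (distr_ofZ oOm tphi c (L3 j)).
rewrite /innerv !mulr_sumr -!big_split; apply: eq_bigr => j _ /=.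
have S w : L2 F Om w -> sqC Om w by exact: L2_sqC.
rewrite /h (innerDl oOm (S _ (Lab j)) (S _ (Lc j)) (S _ (Lz j))).
rewrite (innerDl oOm (S _ (La j)) (S _ (Lb j)) (S _ (Lz j))).
by rewrite !(innerZl oOm)//; exact: S.
Qed.

Lemma innerv_single w j phi : innerv Om w (fun k => ofR (single j phi k)) = distr_of Om (w j) phi.
Proof.
rewrite innerv_ofR (@sum_single _ _ j phi (fun k => distr_of Om (w k)))//.
by move=> k; exact: distr_of_test0.
Qed.

Lemma innerv_rcurl w V : L2v F Om w -> (forall k, test Om (V k)) ->
  innerv Om w (fun k => ofR (rcurl V k)) = \sum_k curlD (distrv_of Om w) k (V k).
Proof. by move=> Lw tV; rewrite innerv_ofR (curlD_adjoint oOm Lw tV). Qed.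

Lemma innerv_rcurl_single w j phi : L2v F Om w -> test Om phi ->
  innerv Om w (fun k => ofR (rcurl (single j phi) k)) = curlD (distrv_of Om w) j phi.
Proof.
by move=> Lw tphi; rewrite (innerv_rcurl Lw (test_single j tphi)) curlD_single.
Qed.

Lemma innerv_grad w phi : innerv Om w (fun k => ofR (pderiv k phi)) = - divD (distrv_of Om w) phi.
Proof. by rewrite innerv_ofR /divD fct_sumE -sumrN; apply: eq_bigr => k _; rewrite /partD opprK. Qed.

Lemma div_curl_eq0 w phi : L2v F Om w -> test Om phi ->
  \sum_k curlD (distrv_of Om w) k (pderiv k phi) = 0.
Proof.
move=> Lw tphi; have tV k : test Om (pderiv k phi) by exact: test_pderiv.
rewrite (curlD_adjoint oOm Lw (V := fun k => pderiv k phi) tV) big1// => k _.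
by rewrite rcurl_grad ?distr_of_test0//; case: tphi.
Qed.

Section WeakGradient.
Variables (g : R3 R -> C) (G : 'I_3 -> R3 R -> C).
Hypothesis gG : forall i, eqD Om (partD i (distr_of Om g)) (distr_of Om (G i)).

Lemma weak_gradE i phi : test Om phi -> distr_of Om (G i) phi = - distr_of Om g (pderiv i phi).
Proof. by move=> tphi; rewrite -(gG i tphi). Qed.

Lemma curl_grad_eq0 j phi : test Om phi -> curlD (distrv_of Om G) j phi = 0.
Proof.
move=> tphi; have tp i : test Om (pderiv i phi) by exact: test_pderiv.
rewrite curlDE /distrv_of !weak_gradE// opprK (pderiv_comm (j + 1) (j + 2)) ?subrr//.
by case: tphi.
Qed.

Lemma inner_div_test V : L2 F Om g -> (forall k, test Om (V k)) ->
  inner Om g (ofR (fun x => \sum_k pderiv k (V k) x)) = - innerv Om G (fun k => ofR (V k)).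
Proof.
move=> Lg tV; rewrite inner_ofR innerv_ofR -sumrN.
have E : (fun x => \sum_k pderiv k (V k) x) =
    fun x => pderiv 0 (V 0) x + pderiv 1 (V 1) x + pderiv 2 (V 2) x.
  by apply/funext => x; rewrite sum3.
have t k : test Om (pderiv k (V k)) by exact: test_pderiv.
rewrite E (distr_of_testD oOm Lg (testD (t 0) (t 1)) (t 2)) (distr_of_testD oOm Lg (t 0) (t 1)).
rewrite -(sum3 (fun k => distr_of Om g (pderiv k (V k)))); apply: eq_bigr => k _.
by rewrite weak_gradE// opprK.
Qed.

End WeakGradient.

Lemma natural_algebra (c1 c2 c3 : R) (k d n m : C) : 0 < c2 ->
  c1%:C%C * k + c2%:C%C * d - c3%:C%C * m =
  c1%:C%C * k + (- c2)%:C%C * n + (- c3)%:C%C * m -> d + n = 0.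
Proof.
move=> c2_gt0; rewrite !rmorphN !mulNr => /addIr/addrI/eqP.
rewrite -subr_eq0 opprK -mulrDr mulf_eq0 => /orP[|/eqP//].
by rewrite eq_complex /= gt_eqF.
Qed.

Section Solution.
Variables (c1 c2 c3 : R) (f u : 'I_3 -> R3 R -> C).
Hypotheses (c1_gt0 : 0 < c1) (c2_gt0 : 0 < c2).
Hypotheses (Hf : Hsv F Om 1 f) (Xu : XN F Om u) (Hu : Hsv F Om 3 u).
Hypothesis weak : forall v, XN F Om v ->
  c1%:C%C * innerv Om (wcurl F Om u) (wcurl F Om v)
  + c2%:C%C * inner Om (wdiv F Om u) (wdiv F Om v)
  - c3%:C%C * innerv Om u v = innerv Om f v.

Let E := wcurl F Om u.
Let g := wdiv F Om u.
Let K := wcurl F Om E.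

Let Lu : L2v F Om u. Proof. by have [[]] := Xu. Qed.
Let Lf : L2v F Om f. Proof. by move=> j; have [] := Hf j. Qed.

Let uE : is_weak_curl F Om u E.
Proof. by have [[_ h _] _] := Xu; exact: wcurlP. Qed.
Let ug : is_weak_div F Om u g.
Proof. by have [[_ _ h] _] := Xu; exact: wdivP. Qed.
Let LE : L2v F Om E. Proof. by have [] := uE. Qed.
Let Lg : L2 F Om g. Proof. by have [] := ug. Qed.

Let E_rep a j : (size a <= 2)%N -> repD F Om (foldr partD (distr_of Om (E j)) a).
Proof.
move=> a2.
have : eqD Om (foldr partD (distr_of Om (E j)) a) (foldr partD (curlD (distrv_of Om u) j) a).
  elim: (a) => [|i s IH] /=; last exact: eqD_partD.
  by move=> phi tphi; exact: esym (uE.2 j phi tphi).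
move=> h; apply: (eqD_repD h); rewrite /curlD.
have -> : foldr partD (partD (j + 1) (distrv_of Om u (j + 2)) - partD (j + 2) (distrv_of Om u (j + 1))) a
  = foldr partD (distr_of Om (u (j + 2))) (rcons a (j + 1))
    - foldr partD (distr_of Om (u (j + 1))) (rcons a (j + 2)).
  rewrite !foldr_rcons; elim: (a) => [//|i s IH] /=.
  by rewrite IH partDB.
by apply: repDB => //; apply: (Hsv_repD (s := 3)) => //; rewrite size_rcons.
Qed.

Lemma solution_curl_H2 : Hsv F Om 2 E.
Proof.
move=> j; split; first exact: LE.
by move=> a a2; have [h Lh Eh] := E_rep j a2; exists h.
Qed.

Lemma Hsv_le s t w : (t <= s)%N -> Hsv F Om s w -> Hsv F Om t w.
Proof.
move=> ts Hw j; have [Lw h] := Hw j; split => // a at'.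
by apply: h; exact: leq_trans at' ts.
Qed.

Let HE1 : Hsv F Om 1 E. Proof. exact: Hsv_le solution_curl_H2. Qed.

Let EK : is_weak_curl F Om E K.
Proof. by apply: wcurlP; exact: (Hsv1_weak_curl scF oOm). Qed.
Let LK : L2v F Om K. Proof. by have [] := EK. Qed.

(** The third derivatives of [u] enter through the derivatives of [K]. *)
Lemma solution_curl_curl_Hcurl : Hcurl F Om K.
Proof.
split; first exact: LK.
apply: (repD_weak_curl scF oOm) => // i j.
have h : eqD Om (partD i (distr_of Om (K j))) (partD i (curlD (distrv_of Om E) j)).
  by apply: eqD_partD => phi tphi; exact: esym (EK.2 j phi tphi).
apply: (eqD_repD h); rewrite /curlD partDB; apply: repDB => //.
- exact: (@E_rep [:: i; j + 1]).
- exact: (@E_rep [:: i; j + 2]).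
Qed.

(* the gradient of the divergence consists of second derivatives of [u] *)
Let exG : exists G, L2v F Om G /\ forall i, eqD Om (partD i (distr_of Om g)) (distr_of Om (G i)).
Proof.
have /choice[G GP] : forall i, exists h, L2 F Om h /\ eqD Om (partD i (distr_of Om g)) (distr_of Om h).
  move=> i.
  have h : eqD Om (partD i (distr_of Om g)) (partD i (divD (distrv_of Om u))).
    by apply: eqD_partD => phi tphi; exact: esym (ug.2 phi tphi).
  have [|k Lk kE] := eqD_repD (F := F) h; last by exists k.
  rewrite /divD partD_sum; apply: repD_sum => // k.
  exact: (Hsv_repD (a := [:: i; k]) _ Hu).
by exists G; split => i; have [] := GP i.
Qed.

Let G := projT1 (cid exG).
Let LG : L2v F Om G. Proof. by have [] := projT2 (cid exG). Qed.
Let gG i : eqD Om (partD i (distr_of Om g)) (distr_of Om (G i)).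
Proof. by have [_] := projT2 (cid exG); apply. Qed.

(** A test field is admissible, and all its integrations by parts are free of boundary
terms. *)
Lemma interior_equation V : (forall k, test Om (V k)) ->
  innerv Om f (fun k => ofR (V k)) =
  c1%:C%C * innerv Om K (fun k => ofR (V k)) - c2%:C%C * innerv Om G (fun k => ofR (V k))
  - c3%:C%C * innerv Om u (fun k => ofR (V k)).
Proof.
move=> tV; have wc := weak_curl_test scF oOm tV; have wd := weak_div_test scF oOm tV.
rewrite -(weak (XN_test scF oOm tV)).
have [Lc _] := wcurlP (ex_intro _ _ wc); have [Ld _] := wdivP (ex_intro _ _ wd).
rewrite (innerv_congr oOm LE Lc wc.1 (wcurl_eq wc)).
rewrite (inner_congr oOm (L2_sqC oOm Lg) (L2_sqC oOm Ld) (L2_sqC oOm wd.1) (wdiv_eq wd)).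
by rewrite (curl_test_adjoint oOm LE EK tV) (inner_div_test gG Lg tV) mulrN.
Qed.

(** Unlike the variational problem, this relation can be paired with fields that do not
vanish near the boundary, such as the curl of an arbitrary [H^1] field. *)
Lemma field_equation j phi : test Om phi -> distr_of Om (f j) phi =
  c1%:C%C * distr_of Om (K j) phi + (- c2)%:C%C * distr_of Om (G j) phi
  + (- c3)%:C%C * distr_of Om (u j) phi.
Proof.
move=> tphi; have := interior_equation (test_single j tphi).
by rewrite !innerv_single => ->; rewrite !rmorphN !mulNr.
Qed.

(** The difference between the variational problem and the field equation paired with
[v]. The curl terms cancel: the zero tangential trace of [v] is tested with [E], which
is an [H^1] field. *)
Lemma natural_condition v : XN F Om v -> inner Om g (wdiv F Om v) + innerv Om G v = 0.
Proof.
move=> Xv; have := weak Xv.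
have [[Lv hc hd] tv] := Xv; have [Lcv _] := wcurlP hc.
rewrite (innerv_comb3 Lf LK LG Lu field_equation Lv).
have hv : innerv Om (wcurl F Om v) E = innerv Om v K by exact: (subr0_eq (tv E HE1)).
have -> : innerv Om E (wcurl F Om v) = innerv Om K v.
  by rewrite (innerv_conj oOm LE Lcv) hv -(innerv_conj oOm LK Lv).
rewrite -/g; exact: natural_algebra.
Qed.

Let K_div phi : test Om phi -> innerv Om K (fun k => ofR (pderiv k phi)) = 0.
Proof.
move=> tphi; rewrite innerv_ofR -[RHS](div_curl_eq0 LE tphi); apply: eq_bigr => k _.
exact: esym (EK.2 k _ (test_pderiv k tphi)).
Qed.

Let curl_curl j phi : test Om phi ->
  curlD (curlD (distrv_of Om E)) j phi = curlD (distrv_of Om K) j phi.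
Proof.
move=> tphi.
have h k i : curlD (distrv_of Om E) k (pderiv i phi) = distrv_of Om K k (pderiv i phi).
  exact: EK.2 (test_pderiv i tphi).
by rewrite [LHS]curlDE [RHS]curlDE (h (j + 2)) (h (j + 1)).
Qed.

Lemma solution_curl_div phi : test Om phi -> divD (distrv_of Om E) phi = 0.
Proof.
move=> tphi; apply: oppr_inj; rewrite oppr0 -innerv_grad innerv_ofR -[RHS](div_curl_eq0 Lu tphi).
by apply: eq_bigr => k _; exact: esym (uE.2 k _ (test_pderiv k tphi)).
Qed.

(** The interior equation for a gradient, to which the curl of [E] is orthogonal. *)
Lemma solution_helmholtz phi : test Om phi -> divD (distrv_of Om f) phi =
  c2%:C%C * laplaceD (distr_of Om (fun x => - g x)) phi
  + c3%:C%C * distr_of Om (fun x => - g x) phi.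
Proof.
move=> tphi; have tV k : test Om (pderiv k phi) by exact: test_pderiv.
have := interior_equation tV; rewrite (K_div tphi) (innerv_grad f) (innerv_grad u).
have -> : innerv Om G (fun k => ofR (pderiv k phi)) = laplaceD (distr_of Om (fun x => - g x)) phi.
  rewrite innerv_ofR /laplaceD fct_sumE; apply: eq_bigr => k _.
  by rewrite (weak_gradE gG k (tV k)) /partD opprK (distr_ofN oOm (test_pderiv k (tV k)) Lg).
have -> : divD (distrv_of Om u) phi = - distr_of Om (fun x => - g x) phi.
  by rewrite (distr_ofN oOm tphi Lg) opprK; exact: ug.2.
by rewrite mulr0 add0r opprK => /eqP; rewrite -opprD eqr_opp => /eqP.
Qed.

(** The interior equation for a curl, to which the gradient of [g] is orthogonal. *)
Lemma solution_maxwell j phi : test Om phi -> curlD (distrv_of Om f) j phi =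
  c1%:C%C * curlD (curlD (distrv_of Om E)) j phi - c3%:C%C * distr_of Om (E j) phi.
Proof.
move=> tphi; have ts := test_single j tphi.
have := interior_equation (test_rcurl ts).
rewrite (innerv_rcurl_single j Lf tphi) (innerv_rcurl_single j LK tphi) -curl_curl//.
rewrite (innerv_rcurl_single j LG tphi) (curl_grad_eq0 gG j tphi) mulr0 subr0.
rewrite (innerv_rcurl_single j Lu tphi) => ->; congr (_ - _ * _).
exact: uE.2.
Qed.

Lemma solution_div_trace : is_trace F Om (fun x => - g x) (fun=> 0).
Proof.
apply: (zero_trace scF oOm (G := fun k x => - G k x)).
- exact: L2N.
- by move=> k; exact: L2N.
- move=> i phi tphi; rewrite (distr_ofN oOm tphi (LG i)) -gG// /partD.
  by rewrite (distr_ofN oOm (test_pderiv i tphi) Lg).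
move=> v Xv; have [[Lv _ hd] _] := Xv; have [Ld _] := wdivP hd.
rewrite (innerNl oOm (L2_sqC oOm Lg) (L2_sqC oOm Ld)) (innervN LG Lv) -opprD.
by rewrite natural_condition// oppr0.
Qed.

(** The tangential trace of the gradient of [g] is zero, because [g] is a limit of test
functions in [H^1]. *)
Lemma grad_curl_orth phi : Hsv F Om 1 phi -> innerv Om G (wcurl F Om phi) = 0.
Proof.
move=> Hphi; have [Lc phic] := wcurlP (Hsv1_weak_curl scF oOm Hphi).
have Lphi k : L2 F Om (phi k) := (Hphi k).1.
have [p [q [tpq _ pG _]]] := approx_parts scF oOm Lg LG gG natural_condition.
have sG k : sqC Om (G k) := L2_sqC oOm (LG k).
have orth (s : nat -> R3 R -> R) (W : 'I_3 -> R3 R -> R) :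
    (forall n, test Om (s n)) -> (forall k, sq_int (@lebesgue3 R) Om (W k)) ->
    (forall i, cvgL2 Om (fun n => pderiv i (s n)) (W i)) ->
    innerv Om (fun k => ofR (W k)) (wcurl F Om phi) = 0.
  by move=> ts sW sl; exact: (grad_orth_curl scF oOm ts sW sl Lphi (conj Lc phic)).
have re0 := orth p (fun k => re \o G k) (fun n => (tpq n).1) (fun k => (sG k).1) (fun i => (pG i).1).
have im0 := orth q (fun k => im \o G k) (fun n => (tpq n).2) (fun k => (sG k).2) (fun i => (pG i).2).
transitivity (innerv Om (fun k => ofR (re \o G k)) (wcurl F Om phi)
    + 'i%C * innerv Om (fun k => ofR (im \o G k)) (wcurl F Om phi)); last first.
  by rewrite re0 im0 mulr0 addr0.
rewrite /innerv mulr_sumr -big_split; apply: eq_bigr => k _ /=.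
exact: (inner_split oOm (sG k) (L2_sqC oOm (Lc k))).
Qed.

(** The field equation and its curl express the trace of [f] through those of [K], of
the gradient of [g] and of [u]; the last two vanish. *)
Lemma solution_ttrace phi : Hsv F Om 1 phi -> ttrace F Om f phi = c1%:C%C * ttrace F Om K phi.
Proof.
move=> Hphi; have [Lc phic] := wcurlP (Hsv1_weak_curl scF oOm Hphi).
have Lphi k : L2 F Om (phi k) := (Hphi k).1.
have [Lcf fc] := wcurlP (Hsv1_weak_curl scF oOm Hf).
have [LcK Kc] := wcurlP (solution_curl_curl_Hcurl.2).
have curl_f j chi : test Om chi -> distr_of Om (wcurl F Om f j) chi =
    c1%:C%C * distr_of Om (wcurl F Om K j) chi + 0%:C%C * distr_of Om (E j) chi
    + (- c3)%:C%C * distr_of Om (E j) chi.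
  move=> tchi; rewrite mul0r addr0 rmorphN mulNr.
  have -> : distr_of Om (wcurl F Om f j) chi = curlD (distrv_of Om f) j chi.
    exact: esym (fc j _ tchi).
  have -> : distr_of Om (wcurl F Om K j) chi = curlD (curlD (distrv_of Om E)) j chi.
    by rewrite (curl_curl j tchi); exact: esym (Kc j _ tchi).
  exact: solution_maxwell.
rewrite /ttrace (innerv_comb3 Lcf LcK LE LE curl_f Lphi).
rewrite (innerv_comb3 Lf LK LG Lu field_equation Lc) (grad_curl_orth Hphi).
have -> : innerv Om E phi = innerv Om u (wcurl F Om phi) by exact: (subr0_eq (Xu.2 _ Hphi)).
by rewrite mul0r mulr0 !addr0 opprD addrACA subrr addr0 mulrBr.
Qed.

End Solution.
End Elasticity.

(** * The Helmholtz and Maxwell problems *)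

Lemma scaled_eq (R : realType) (c : R) (x y : R[i]) : 0 < c ->
  c%:C%C * x = y -> x = (c^-1)%:C%C * y.
Proof.
by move=> c0 <-; rewrite mulrA -rmorphM mulVf ?gt_eqF// rmorph1 mul1r.
Qed.

Lemma sqr_div_sqrt (R : realType) (a c : R) : 0 < c -> (a / Num.sqrt c) ^+ 2 = c^-1 * a ^+ 2.
Proof. by move=> c0; rewrite expr_div_n sqr_sqrtr ?ltW// mulrC. Qed.

Theorem theorem3p3 (R : realType) (F : set R[i]) (Om : set (R3 R))
    (lambda mu omega : R) (f u : 'I_3 -> R3 R -> R[i]) :
  scalar_field F ->
  domain Om -> bounded_set Om -> simply_connected Om -> lipschitz_domain Om ->
  connected (boundary Om) -> piecewise_C21_boundary Om ->
  0 < lambda -> 0 < mu -> 0 < omega ->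
  Hsv F Om 1 f ->
  XN F Om u ->
  (forall v, XN F Om v ->
    mu%:C%C * innerv Om (wcurl F Om u) (wcurl F Om v)
    + (lambda + 2 * mu)%:C%C * inner Om (wdiv F Om u) (wdiv F Om v)
    - (omega ^+ 2)%:C%C * innerv Om u v
    = innerv Om f v) ->
  Hsv F Om 3 u ->
  let kp := omega / Num.sqrt (lambda + 2 * mu) in
  let ks := omega / Num.sqrt mu in
  let vp := fun x => - wdiv F Om u x in
  let Es := wcurl F Om u in
  (* Helmholtz problem for vp *)
  (eqD Om (laplaceD (distr_of Om vp) + scaleD (kp ^+ 2) (distr_of Om vp))
     (scaleD (lambda + 2 * mu)^-1 (divD (distrv_of Om f)))
   /\ is_trace F Om vp (fun=> 0))
  /\
  (* Maxwell system for Es *)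
  [/\ Hcurl F Om Es,
      forall j : 'I_3,
        eqD Om (curlD (curlD (distrv_of Om Es)) j
                - scaleD (ks ^+ 2) (distrv_of Om Es j))
          (scaleD mu^-1 (curlD (distrv_of Om f) j)),
      eqD Om (divD (distrv_of Om Es)) (fun=> 0) &
      [/\ Hcurl F Om (wcurl F Om Es), Hcurl F Om f &
          forall phi, Hsv F Om 1 phi ->
            ttrace F Om (wcurl F Om Es) phi
            = (mu^-1)%:C%C * ttrace F Om f phi]].
Proof.
move=> scF [_ oOm _] _ _ _ _ _ lambda_gt0 mu_gt0 _ Hf Xu weak Hu kp ks vp Es.
have c_gt0 : 0 < lambda + 2 * mu by rewrite addr_gt0// mulr_gt0.
have H1E : Hsv F Om 1 Es by exact: Hsv_le (solution_curl_H2 scF oOm Xu Hu).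
split; first split.
- move=> phi tphi; apply: (scaled_eq c_gt0).
  rewrite (solution_helmholtz scF oOm Xu Hu weak tphi) mulrDr; congr (_ + _).
  rewrite /scaleD /kp (sqr_div_sqrt _ c_gt0) mulrA -rmorphM; congr (_%:C%C * _).
  by rewrite mulrA divff ?gt_eqF// mul1r.
- exact: (solution_div_trace scF oOm c_gt0 Hf Xu Hu weak).
split.
- by split; [move=> j; exact: (H1E j).1 | exact: (Hsv1_weak_curl scF oOm H1E)].
- move=> j phi tphi; apply: (scaled_eq mu_gt0).
  rewrite (solution_maxwell scF oOm Hf Xu Hu weak j tphi) mulrBr; congr (_ - _).
  rewrite /scaleD /ks (sqr_div_sqrt _ mu_gt0) mulrA -rmorphM; congr (_%:C%C * _).
  by rewrite mulrA divff ?gt_eqF// mul1r.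
- by move=> phi tphi; exact: (solution_curl_div oOm Xu tphi).
split.
- exact: (solution_curl_curl_Hcurl scF oOm Xu Hu).
- by split; [move=> j; exact: (Hf j).1 | exact: (Hsv1_weak_curl scF oOm Hf)].
move=> phi Hphi; apply: (scaled_eq mu_gt0).
exact: esym (solution_ttrace scF oOm c_gt0 Hf Xu Hu weak Hphi).
Qed.
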